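(* Let $n\ge 2$. Let $\sigma^c_{2n+1}\in\mathfrak g^{\mathfrak m}$ be the canonical element (defined in the context) and $\underline\sigma^c_{2n+1}=\frac{B_{2n}}{(2n)!}\sigma^c_{2n+1}$. Then $$i_1(\underline{\sigma}^c_{2n+1})\equiv \underline{\varepsilon}^{\vee}_{2n+2}+\sum_{p+q=n,\ p,q\ge 1}\frac{1}{2q}\,\big[\underline{\varepsilon}^{\vee}_{2p+2},[\underline{\varepsilon}^{\vee}_{2q+2},\underline{\varepsilon}^{\vee}_{0}]\big]\pmod{W_{-2n-5}}.$$
   Context: $B_k$ denotes the $k$-th Bernoulli number. $\mathbb L(\cdot,\cdot)$ is the free Lie algebra over $\mathbb Q$ on two generators, embedded in the tensor algebra $T(\cdot,\cdot)$; $\wedge$ is completion with respect to the lower central series; derivations of completed Lie algebras are continuous. **Motivic Lie algebra.** $\mathcal{MT}(\mathbb Z)$ is the category of mixed Tate motives over $\mathbb Z$, $G^{dR}=U^{dR}\rtimes\mathbb G_m$ its de Rham Tannaka group, and $\mathfrak g^{\mathfrak m}$ the graded Lie algebra of $U^{dR}$; it is free with one generator in each degree $-(2n+1)$, $n\ge1$. The action of $G^{dR}$ on the trivial de Rham path in $\pi_1^{dR}(\mathbb P^1\setminus\{0,1,\infty\},\overset{\rightarrow}{1}_0,-\overset{\rightarrow}{1}_1)$ gives an (injective) map $i:\mathfrak g^{\mathfrak m}\to\mathbb L(\mathsf x_0,\mathsf x_1)$, a Lie homomorphism for the Ihara bracket on the target, taking degree $-m$ to words of length $m$. Let $i_0(\sigma)$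 be the derivation $\mathsf x_0\mapsto[\mathsf x_0,i(\sigma)]$, $\mathsf x_1\mapsto 0$. The depth of a word in $\mathsf x_0,\mathsf x_1$ is its number of $\mathsf x_1$'s. **Genus one.** $\Theta=[a,b]$, and $\mathrm{Der}^\Theta$ denotes derivations killing $\Theta$. Let $\phi:\mathbb L(\mathsf x_0,\mathsf x_1)^\wedge\to\mathbb L(a,b)^\wedge$ be the continuous homomorphism $\mathsf x_0\mapsto\frac{\mathrm{ad}(b)}{e^{\mathrm{ad}(b)}-1}a$, $\mathsf x_1\mapsto[a,b]$. The map $i_1:\mathfrak g^{\mathfrak m}\to\mathrm{Der}^\Theta\,\mathbb L(a,b)^\wedge$ is the action of $\mathfrak g^{\mathfrak m}$ on the de Rham fundamental Lie algebra of the fibre $E^\times_{\partial/\partial q}$ of the universal punctured elliptic curve at the tangential base point $\partial/\partial q$ (with tangential base point $\overset{\rightarrow}{1}_1$), whose bigraded Lie algebra is $\mathbb L(a,b)$; $i_1$ is characterised by $i_1(\sigma)\circ\phi=\phi\circ i_0(\sigma)$. For $n\ge-1$, $\varepsilon^\vee_{2n+2}\in\mathrm{Der}^\Theta\,\mathbb L(a,b)$ is the unique derivation with $\varepsilon^\vee_{2n+2}(a)=\mathrm{ad}(a)^{2n+2}(b)$, $\varepsilon^\vee_{2n+2}([a,b])=0$, and such that the coefficient of $a$ in $\varepsilon_{2n+2}^\vee(b)$ is $0$ (so $\varepsilon^\vee_0(a)=b$, $\varepsilon^\vee_0(b)=0$). Put $\underline\varepsilon^\vee_0=\frac1{12}\varepsilon_0^\vee$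 and $\underline\varepsilon^\vee_{2n+2}=\frac{B_{2n}}{(2n)!}\varepsilon^\vee_{2n+2}$ for $n\ge1$. $W_{-m}$ is the space of derivations increasing word length in $a,b$ by at least $m$. Brackets of derivations are commutators. **Commutative polynomials and Ihara bracket.** The depth $r$ part of an element of $\mathbb L(\mathsf x_0,\mathsf x_1)$ is encoded by the polynomial obtained from $\mathsf x_0^{i_0}\mathsf x_1\mathsf x_0^{i_1}\cdots\mathsf x_1\mathsf x_0^{i_r}\mapsto y_0^{i_0}\cdots y_r^{i_r}$, which for $r\ge 1$ is translation invariant; its reduced form is obtained by $(y_0,\dots,y_r)\mapsto(0,x_1,\dots,x_r)$. For homogeneous rational functions $f(y_0,\dots,y_r)$, $g(y_0,\dots,y_s)$ put $$f\,\underline\circ\, g=\sum_{i=0}^s f(y_i,\dots,y_{i+r})\,g(y_0,\dots,y_i,y_{i+r+1},\dots,y_{r+s})+(-1)^{\deg f+r}\sum_{i=1}^s f(y_{i+r},\dots,y_i)\,g(y_0,\dots,y_{i-1},y_{i+r},\dots,y_{r+s}),$$ extended bilinearly, and $\{f,g\}=f\,\underline\circ\, g-g\,\underline\circ\, f$. A rational function $f(x_1,\dots,x_r)$ is identified with the translation-invariant function $f(y_1-y_0,\dots,y_r-y_0)$. **Canonical elements.** Let $s^{(1)}=\frac1{2x_1}$, $s^{(2)}=\frac1{12}\big(\frac1{x_1x_2}+\frac1{x_2(x_1-x_2)}\big)$, and $\xi^{(1)}_{2n+1}=x_1^{2n}$, $\xi^{(2)}_{2n+1}=\{s^{(1)},x_1^{2n}\}$,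 $\xi^{(3)}_{2n+1}=\{s^{(2)},x_1^{2n}\}+\frac12\{s^{(1)},\{s^{(1)},x_1^{2n}\}\}$. For $n\ge2$, $\sigma^c_{2n+1}\in\mathfrak g^{\mathfrak m}$ is an element of degree $-(2n+1)$ such that the reduced polynomials of $i(\sigma^c_{2n+1})$ in depths $1$ and $2$ are $\xi^{(1)}_{2n+1}$, $\xi^{(2)}_{2n+1}$, and in depth $3$ is $$\xi^{(3)}_{2n+1}+\sum_{p+q=n,\ p,q\ge1}\frac{B_{2p}B_{2q}}{B_{2n}}\binom{2n}{2p}\frac1{24q}\{x_1^{2p},\{x_1^{2q},x_1^{-2}\}\};$$ such an element exists and is unique modulo elements whose image under $i$ has depth $\ge4$. *)

(* Defs.v *)
From HB Require Import structures.
From mathcomp Require Import all_boot all_order all_algebra.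
From mathcomp Require Import mpoly.
From mathcomp Require Import boolp.
From mathcomp Require Import ring zify.

Set Implicit Arguments.
Unset Strict Implicit.
Unset Printing Implicit Defensive.

Import GRing.Theory.
Local Open Scope ring_scope.

Fact addrr_eq (V : zmodType) (x : V) : x = x + x -> x = 0.
Proof. by rewrite -{1}[x]addr0 => /addrI. Qed.

(** Noncommutative power series: [u w] is the coefficient of the word [w] in [u]. *)

Definition series (A : finType) : Type := seq A -> rat.

Section SeriesAlgebra.
Variable A : finType.
Implicit Types (u v w : series A) (s : seq A) (k : rat).

HB.instance Definition _ := gen_eqMixin (series A).
HB.instance Definition _ := gen_choiceMixin (series A).

Let zeroS : series A := fun _ => 0.
Let addS u v : series A := fun s => u s + v s.
Let oppS u : series A := fun s => - u s.

Fact addS_A : associative addS.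
Proof. by move=> u v w; apply/funext => s; rewrite /addS addrA. Qed.
Fact addS_C : commutative addS.
Proof. by move=> u v; apply/funext => s; rewrite /addS addrC. Qed.
Fact addS_0 : left_id zeroS addS.
Proof. by move=> u; apply/funext => s; rewrite /addS add0r. Qed.
Fact addS_N : left_inverse zeroS oppS addS.
Proof. by move=> u; apply/funext => s; rewrite /addS addNr. Qed.

HB.instance Definition _ :=
  GRing.isZmodule.Build (series A) addS_A addS_C addS_0 addS_N.

Let scaleS k u : series A := fun s => k * u s.

Fact scaleS_A k1 k2 u : scaleS k1 (scaleS k2 u) = scaleS (k1 * k2) u.
Proof. by apply/funext => s; rewrite /scaleS mulrA. Qed.
Fact scaleS_1 : left_id 1 scaleS.
Proof. by move=> u; apply/funext => s; rewrite /scaleS mul1r. Qed.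
Fact scaleS_Dr : right_distributive scaleS +%R.
Proof. by move=> k u v; apply/funext => s; rewrite /scaleS mulrDr. Qed.
Fact scaleS_Dl u : {morph scaleS^~ u : k1 k2 / k1 + k2}.
Proof. by move=> k1 k2; apply/funext => s; rewrite /scaleS mulrDl. Qed.

HB.instance Definition _ := GRing.Zmodule_isLmodule.Build rat (series A)
  scaleS_A scaleS_1 scaleS_Dr scaleS_Dl.

Lemma seriesD u v s : (u + v) s = u s + v s. Proof. by []. Qed.
Lemma seriesN u s : (- u) s = - u s. Proof. by []. Qed.
Lemma seriesB u v s : (u - v) s = u s - v s. Proof. by []. Qed.
Lemma series0 s : (0 : series A) s = 0. Proof. by []. Qed.
Lemma seriesZ k u s : (k *: u) s = k * u s. Proof. by []. Qed.
Lemma series_sum (I : Type) (r : seq I) (P : pred I) (F : I -> series A) s :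
  (\sum_(i <- r | P i) F i) s = \sum_(i <- r | P i) F i s.
Proof. by elim/big_rec2: _ => // i x y _ <-. Qed.

Definition seriesE := (seriesD, seriesN, series0, seriesZ, series_sum).

Let oneS : series A := fun s => (s == [::])%:R.
Let mulS u v : series A :=
  fun s => \sum_(i < (size s).+1) u (take i s) * v (drop i s).

(* [u = u [::] + \sum_c gen c * shift c u] *)
Definition shift (c : A) u : series A := fun s => u (c :: s).

Fact mulS_nil u v : mulS u v [::] = u [::] * v [::].
Proof. by rewrite /mulS big_ord1. Qed.
Fact mulS_cons u v c s :
  mulS u v (c :: s) = u [::] * v (c :: s) + mulS (shift c u) v s.
Proof. by rewrite /mulS /= big_ord_recl. Qed.

Fact mulS_Dl : left_distributive mulS +%R.
Proof.
move=> u v w; apply/funext => s; rewrite seriesD /mulS -big_split /=.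
by apply: eq_bigr => i _; rewrite seriesD mulrDl.
Qed.
Fact mulS_Dr : right_distributive mulS +%R.
Proof.
move=> u v w; apply/funext => s; rewrite seriesD /mulS -big_split /=.
by apply: eq_bigr => i _; rewrite seriesD mulrDr.
Qed.
Fact mulS_Zl k u v : k *: mulS u v = mulS (k *: u) v.
Proof.
apply/funext => s; rewrite seriesZ /mulS mulr_sumr.
by apply: eq_bigr => i _; rewrite seriesZ mulrA.
Qed.
Fact mulS_Zr k u v : k *: mulS u v = mulS u (k *: v).
Proof.
apply/funext => s; rewrite seriesZ /mulS mulr_sumr.
by apply: eq_bigr => i _; rewrite seriesZ mulrCA.
Qed.
Fact mulS_A : associative mulS.
Proof.
move=> u v w; apply/funext => s; elim: s u v w => [|c s IH] u v w.
  by rewrite !mulS_nil mulrA.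
rewrite !mulS_cons mulS_nil mulrDr mulrA -addrA; congr (_ + _).
have -> : shift c (mulS u v) = u [::] *: shift c v + mulS (shift c u) v.
  by apply/funext => t; rewrite /shift mulS_cons.
by rewrite mulS_Dl seriesD -mulS_Zl seriesZ IH.
Qed.
Fact mulS_1l : left_id oneS mulS.
Proof.
move=> u; apply/funext => -[|c s]; first by rewrite mulS_nil mul1r.
rewrite mulS_cons mul1r; have -> : shift c oneS = 0 by apply/funext.
rewrite /mulS big1 ?addr0 // => i _; exact: mul0r.
Qed.
Fact mulS_1r : right_id oneS mulS.
Proof.
move=> u; apply/funext => s; elim: s u => [|c s IH] u.
  by rewrite mulS_nil mulr1.
by rewrite mulS_cons mulr0 add0r IH.
Qed.
Fact oneS_neq0 : oneS != 0.
Proof.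
by apply/eqP => /(congr1 (fun f => f [::])); rewrite series0 => /eqP.
Qed.

HB.instance Definition _ := GRing.Zmodule_isNzRing.Build (series A)
  mulS_A mulS_1l mulS_1r mulS_Dl mulS_Dr oneS_neq0.
HB.instance Definition _ :=
  GRing.Lmodule_isLalgebra.Build rat (series A) mulS_Zl.
HB.instance Definition _ :=
  GRing.Lalgebra_isAlgebra.Build rat (series A) mulS_Zr.

Lemma series1 s : (1 : series A) s = (s == [::])%:R. Proof. by []. Qed.
Lemma seriesM u v s :
  (u * v) s = \sum_(i < (size s).+1) u (take i s) * v (drop i s).
Proof. by []. Qed.
Lemma seriesM_nil u v : (u * v) [::] = u [::] * v [::].
Proof. exact: mulS_nil. Qed.
Lemma seriesM_cons u v c s :
  (u * v) (c :: s) = u [::] * v (c :: s) + (shift c u * v) s.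
Proof. exact: mulS_cons. Qed.

Definition genS (c : A) : series A := fun s => (s == [:: c])%:R.
Definition com u v : series A := u * v - v * u.

Definition ord_ge (n : nat) (u : series A) : Prop :=
  forall s, (size s < n)%N -> u s = 0.

End SeriesAlgebra.

HB.mixin Record Lmodule_isLie (R : pzRingType) L of GRing.Lmodule R L := {
  lie_br : L -> L -> L;
  lie_brPl : forall z : L, linear (lie_br^~ z);
  lie_brPr : forall z : L, linear (lie_br z);
  lie_brxx : forall x : L, lie_br x x = 0;
  lie_jacobi : forall x y z : L,
    lie_br x (lie_br y z) + lie_br y (lie_br z x) + lie_br z (lie_br x y) = 0
}.

#[short(type="lieType")]
HB.structure Definition Lie (R : pzRingType) :=
  { L of GRing.Lmodule R L & Lmodule_isLie R L }.

Notation "[lie x , y ]" := (lie_br x y)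
  (at level 0, x at level 99, y at level 99, format "[lie  x ,  y ]")
  : ring_scope.

Definition lie_ad (L : lieType rat) (n : nat) (x y : L) : L :=
  iter n (lie_br x) y.

Definition lie_morphism (L M : lieType rat) (f : L -> M) : Prop :=
  linear f /\ (forall x y, f [lie x, y] = [lie f x, f y]).

Section Filtration.
Variable A : finType.
Implicit Types (u v w : series A) (n m k : nat).

Lemma ord_ge_lin n (k : rat) u v :
  ord_ge n u -> ord_ge n v -> ord_ge n (k *: u + v).
Proof.
by move=> hu hv s hs; rewrite seriesD seriesZ hu // hv // mulr0 addr0.
Qed.
Lemma ord_ge0 n : ord_ge n (0 : series A). Proof. by []. Qed.
Lemma ord_geD n u v : ord_ge n u -> ord_ge n v -> ord_ge n (u + v).
Proof. by move=> hu hv; rewrite -[u]scale1r; apply: ord_ge_lin. Qed.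
Lemma ord_geZ n (k : rat) u : ord_ge n u -> ord_ge n (k *: u).
Proof. by move=> hu; rewrite -[_ *: _]addr0; apply: ord_ge_lin. Qed.
Lemma ord_geN n u : ord_ge n u -> ord_ge n (- u).
Proof. by move=> hu; rewrite -scaleN1r; apply: ord_geZ. Qed.
Lemma ord_geB n u v : ord_ge n u -> ord_ge n v -> ord_ge n (u - v).
Proof. by move=> hu hv; apply: ord_geD => //; apply: ord_geN. Qed.
Lemma ord_ge_leq n m u : (m <= n)%N -> ord_ge n u -> ord_ge m u.
Proof. by move=> hmn hu s hs; apply: hu; apply: leq_trans hmn. Qed.
Lemma ord_ge_any u : ord_ge 0 u. Proof. by []. Qed.
Lemma ord_geM n m u v : ord_ge n u -> ord_ge m v -> ord_ge (n + m) (u * v).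
Proof.
move=> hu hv s hs; rewrite seriesM big1 // => i _.
have hi : (i <= size s)%N by rewrite -ltnS.
case: (ltnP i n) => hin; first by rewrite hu ?mul0r // size_takel.
rewrite hv ?mulr0 // size_drop ltn_subLR //.
exact: leq_trans hs (leq_add hin _).
Qed.
Lemma ord_ge_com n m u v : ord_ge n u -> ord_ge m v -> ord_ge (n + m) (com u v).
Proof.
move=> hu hv; apply: ord_geB; first exact: ord_geM.
by rewrite addnC; apply: ord_geM.
Qed.
Lemma ord_ge_sum n (I : Type) (r : seq I) (P : pred I) (F : I -> series A) :
  (forall i, P i -> ord_ge n (F i)) -> ord_ge n (\sum_(i <- r | P i) F i).
Proof. by move=> h; elim/big_rec: _ => // i x /h hi hx; apply: ord_geD. Qed.
Lemma ord_ge_shift n u (c : A) : ord_ge n.+1 u -> ord_ge n (shift c u).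
Proof. by move=> h s hs; apply: h. Qed.
Lemma ord_ge_gen (c : A) : ord_ge 1 (genS c).
Proof. by case. Qed.
Lemma ord_ge_eq0 u : (forall n, ord_ge n u) -> u = 0.
Proof. by move=> h; apply/funext => s; apply: (h (size s).+1). Qed.

Lemma com_linl v : linear (fun u => com u v).
Proof.
move=> k u w; rewrite /com mulrDl mulrDr -scalerAl -scalerAr scalerBr.
by rewrite opprD addrACA.
Qed.
Lemma com_linr v : linear (com v).
Proof.
move=> k u w; rewrite /com mulrDl mulrDr -scalerAl -scalerAr scalerBr.
by rewrite opprD addrACA.
Qed.
Lemma comBl u v w : com (u - v) w = com u w - com v w.
Proof. by rewrite /com mulrBl mulrBr !opprD !opprK addrACA. Qed.
Lemma comBr u v w : com w (u - v) = com w u - com w v.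
Proof. by rewrite /com mulrBl mulrBr !opprD !opprK addrACA. Qed.
Lemma comxx u : com u u = 0. Proof. exact: subrr. Qed.
Lemma com_jacobi u v w :
  com u (com v w) + com v (com w u) + com w (com u v) = 0.
Proof.
apply/funext => s; rewrite /com !(mulrBl, mulrBr) !mulrA !seriesE.
ring.
Qed.

End Filtration.

Section FreeLie.
Variable A : finType.
Implicit Types (u v w : series A) (n m k : nat).

(* The Lie subalgebra generated by the letters. *)
Inductive free_lie : series A -> Prop :=
| FreeLieGen (c : A) : free_lie (genS c)
| FreeLie0 : free_lie 0
| FreeLieLin (k : rat) u v : free_lie u -> free_lie v -> free_lie (k *: u + v)
| FreeLieCom u v : free_lie u -> free_lie v -> free_lie (com u v).

(* Its closure.  The terms of the lower central series of the free Lie algebra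
   are its intersections with the filtration by word length, so the closure is
   the completion with respect to the lower central series. *)
Definition free_liec u : Prop :=
  forall n, exists2 v, free_lie v & ord_ge n (u - v).

Lemma free_lie_ord1 u : free_lie u -> ord_ge 1 u.
Proof.
elim=> [c|//|k {}u v _ hu _ hv|{}u v _ hu _ hv]; first exact: ord_ge_gen.
- exact: ord_ge_lin.
- by apply: (@ord_ge_leq _ 2) => //; apply: (@ord_ge_com _ 1 1).
Qed.
Lemma free_lie_liec u : free_lie u -> free_liec u.
Proof. by move=> hu n; exists u => //; rewrite subrr. Qed.
Lemma free_liec_ord1 u : free_liec u -> ord_ge 1 u.
Proof.
move=> /(_ 1%N) [v /free_lie_ord1 hv h].
by rewrite -(subrK v u); apply: ord_geD.
Qed.
Lemma free_liec_lin (k : rat) u v :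
  free_liec u -> free_liec v -> free_liec (k *: u + v).
Proof.
move=> hu hv n; have [u' hu' eu] := hu n; have [v' hv' ev] := hv n.
exists (k *: u' + v'); first exact: FreeLieLin.
have -> : k *: u + v - (k *: u' + v') = k *: (u - u') + (v - v').
  by rewrite scalerBr opprD addrACA.
exact: ord_ge_lin.
Qed.
Lemma free_liec_com u v : free_liec u -> free_liec v -> free_liec (com u v).
Proof.
move=> hu hv n; have [u' hu' eu] := hu n; have [v' hv' ev] := hv n.
exists (com u' v'); first exact: FreeLieCom.
have -> : com u v - com u' v' = com (u - u') v + com u' (v - v').
  by rewrite comBl comBr addrA subrK.
apply: ord_geD; first by rewrite -[n]addn0; apply: ord_ge_com.
by rewrite -[n]add0n; apply: ord_ge_com.
Qed.
Lemma free_liec_lim u :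
  (forall n, exists2 v, free_liec v & ord_ge n (u - v)) -> free_liec u.
Proof.
move=> h n; have [v hv ev] := h n; have [w hw ew] := hv n.
exists w => //; rewrite -(subrK v u) -addrA; exact: ord_geD.
Qed.

Definition free_lie_pred : {pred series A} := fun u => `[< free_lie u >].
Definition free_liec_pred : {pred series A} := fun u => `[< free_liec u >].

Fact free_lie_pred_closed : submod_closed free_lie_pred.
Proof.
split; first by apply/asboolP; exact: FreeLie0.
by move=> k u v /asboolP hu /asboolP hv; apply/asboolP/FreeLieLin.
Qed.
Fact free_liec_pred_closed : submod_closed free_liec_pred.
Proof.
split; first by apply/asboolP; apply: free_lie_liec; exact: FreeLie0.
by move=> k u v /asboolP hu /asboolP hv; apply/asboolP/free_liec_lin.
Qed.
HB.instance Definition _ := GRing.isSubmodClosed.Build rat (series A)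
  free_lie_pred (GRing.submod_closed_semi free_lie_pred_closed).
HB.instance Definition _ := GRing.isSubmodClosed.Build rat (series A)
  free_liec_pred (GRing.submod_closed_semi free_liec_pred_closed).

(* [flie A] is the free Lie algebra, [fliec A] its completion. *)
Record flie := FLie { flie_val :> series A; _ : flie_val \in free_lie_pred }.
HB.instance Definition _ := [isSub for flie_val].
HB.instance Definition _ := [Choice of flie by <:].
HB.instance Definition _ := [SubChoice_isSubLmodule of flie by <:].

Record fliec :=
  FLiec { fliec_val :> series A; _ : fliec_val \in free_liec_pred }.
HB.instance Definition _ := [isSub for fliec_val].
HB.instance Definition _ := [Choice of fliec by <:].
HB.instance Definition _ := [SubChoice_isSubLmodule of fliec by <:].

Lemma flieP (x : flie) : free_lie x.
Proof. by case: x => u h; apply/asboolP. Qed.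
Lemma fliecP (x : fliec) : free_liec x.
Proof. by case: x => u h; apply/asboolP. Qed.
Definition mkflie u (h : free_lie u) : flie := FLie (asboolT h).
Definition mkfliec u (h : free_liec u) : fliec := FLiec (asboolT h).
Lemma flie_inj : injective flie_val. Proof. exact: val_inj. Qed.
Lemma fliec_inj : injective fliec_val. Proof. exact: val_inj. Qed.

Lemma flie_valL (k : rat) (x y : flie) :
  flie_val (k *: x + y) = k *: flie_val x + flie_val y.
Proof. by []. Qed.
Lemma fliec_valL (k : rat) (x y : fliec) :
  fliec_val (k *: x + y) = k *: fliec_val x + fliec_val y.
Proof. by []. Qed.
Lemma fliec_valD (x y : fliec) :
  fliec_val (x + y) = fliec_val x + fliec_val y.
Proof. by []. Qed.
Lemma fliec_valB (x y : fliec) :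
  fliec_val (x - y) = fliec_val x - fliec_val y.
Proof. by []. Qed.
Lemma fliec_val0 : fliec_val 0 = 0. Proof. by []. Qed.

Definition flie_br (x y : flie) : flie :=
  mkflie (FreeLieCom (flieP x) (flieP y)).
Definition fliec_br (x y : fliec) : fliec :=
  mkfliec (free_liec_com (fliecP x) (fliecP y)).

Fact flie_brPl z : linear (flie_br^~ z).
Proof. by move=> k x y; apply: flie_inj; rewrite /= com_linl. Qed.
Fact flie_brPr z : linear (flie_br z).
Proof. by move=> k x y; apply: flie_inj; rewrite /= com_linr. Qed.
Fact flie_brxx x : flie_br x x = 0.
Proof. by apply: flie_inj; exact: comxx. Qed.
Fact flie_jacobi x y z :
  flie_br x (flie_br y z) + flie_br y (flie_br z x)
  + flie_br z (flie_br x y) = 0.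
Proof. by apply: flie_inj; exact: com_jacobi. Qed.
HB.instance Definition _ := Lmodule_isLie.Build rat flie
  flie_brPl flie_brPr flie_brxx flie_jacobi.

Fact fliec_brPl z : linear (fliec_br^~ z).
Proof. by move=> k x y; apply: fliec_inj; rewrite /= com_linl. Qed.
Fact fliec_brPr z : linear (fliec_br z).
Proof. by move=> k x y; apply: fliec_inj; rewrite /= com_linr. Qed.
Fact fliec_brxx x : fliec_br x x = 0.
Proof. by apply: fliec_inj; exact: comxx. Qed.
Fact fliec_jacobi x y z :
  fliec_br x (fliec_br y z) + fliec_br y (fliec_br z x)
  + fliec_br z (fliec_br x y) = 0.
Proof. by apply: fliec_inj; exact: com_jacobi. Qed.
HB.instance Definition _ := Lmodule_isLie.Build rat fliec
  fliec_brPl fliec_brPr fliec_brxx fliec_jacobi.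

Definition gen (c : A) : fliec := mkfliec (free_lie_liec (FreeLieGen c)).
Definition complete (x : flie) : fliec := mkfliec (free_lie_liec (flieP x)).

End FreeLie.

Arguments gen {A} c.

Section Derivations.
Variable A : finType.
Implicit Types (x y z : fliec A) (n m : nat).

Definition is_cder (D : fliec A -> fliec A) : Prop :=
  [/\ linear D,
      forall x y, D [lie x, y] = [lie D x, y] + [lie x, D y]
    & forall n, exists m, forall x, ord_ge m x -> ord_ge n (D x)].

Record cder := CDer { cder_fun :> fliec A -> fliec A; cderP : is_cder cder_fun }.

Lemma cder_ext (D E : cder) : D =1 E -> D = E.
Proof.
case: D E => [D hD] [E hE] /= /funext e; rewrite -e in hE *.
by congr CDer; apply: Prop_irrelevance.
Qed.

Lemma lie_brDl x y z : [lie x + y, z] = [lie x, z] + [lie y, z].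
Proof. by rewrite -[x in LHS]scale1r lie_brPl scale1r. Qed.
Lemma lie_brDr x y z : [lie z, x + y] = [lie z, x] + [lie z, y].
Proof. by rewrite -[x in LHS]scale1r lie_brPr scale1r. Qed.
Lemma lie_br0l z : [lie 0, z] = 0.
Proof. by apply: (addIr [lie 0, z]); rewrite -lie_brDl !add0r. Qed.
Lemma lie_br0r z : [lie z, 0] = 0.
Proof. by apply: (addIr [lie z, 0]); rewrite -lie_brDr !add0r. Qed.
Lemma lie_brZl (k : rat) x z : [lie k *: x, z] = k *: [lie x, z].
Proof. by rewrite -[k *: x]addr0 lie_brPl lie_br0l addr0. Qed.
Lemma lie_brZr (k : rat) x z : [lie z, k *: x] = k *: [lie z, x].
Proof. by rewrite -[k *: x]addr0 lie_brPr lie_br0r addr0. Qed.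

Lemma cderL (D : cder) (k : rat) x y : D (k *: x + y) = k *: D x + D y.
Proof. by case: D => D [h1 h2 h3]; apply: h1. Qed.
Lemma cder_br (D : cder) x y : D [lie x, y] = [lie D x, y] + [lie x, D y].
Proof. by case: D => D [h1 h2 h3]; apply: h2. Qed.
Lemma cder_cont (D : cder) n :
  exists m, forall x, ord_ge m x -> ord_ge n (D x).
Proof. by case: D => D [h1 h2 h3]; apply: h3. Qed.
Lemma cderD (D : cder) x y : D (x + y) = D x + D y.
Proof. by rewrite -[x in LHS]scale1r cderL scale1r. Qed.
Lemma cder0 (D : cder) : D 0 = 0.
Proof. by apply: (addIr (D 0)); rewrite -cderD !add0r. Qed.
Lemma cderZ (D : cder) (k : rat) x : D (k *: x) = k *: D x.
Proof. by rewrite -[k *: x]addr0 cderL cder0 addr0. Qed.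
Lemma cderN (D : cder) x : D (- x) = - D x.
Proof. by rewrite -scaleN1r cderZ scaleN1r. Qed.

Fact cder_lin_subproof (k : rat) (D E : cder) :
  is_cder (fun x => k *: D x + E x).
Proof.
split=> [h x y|x y|n].
- rewrite !cderL !scalerDr !scalerA [k * h]mulrC -!addrA; congr (_ + _).
  by rewrite addrCA.
- by rewrite !cder_br scalerDr lie_brPl lie_brPr addrACA.
have [m1 h1] := cder_cont D n; have [m2 h2] := cder_cont E n.
exists (maxn m1 m2) => x hx; apply: ord_ge_lin.
  by apply: h1; apply: ord_ge_leq hx; apply: leq_maxl.
by apply: h2; apply: ord_ge_leq hx; apply: leq_maxr.
Qed.
Fact cder_zero_subproof : is_cder (fun=> 0).
Proof.
split=> [h x y|x y|n]; first by rewrite scaler0 addr0.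
  by rewrite lie_br0l lie_br0r addr0.
by exists 0%N.
Qed.
Fact cder_add_subproof (D E : cder) : is_cder (fun x => D x + E x).
Proof.
have := cder_lin_subproof 1 D E.
by under [X in is_cder X -> _]funext => x do rewrite scale1r.
Qed.
Fact cder_scale_subproof (k : rat) (D : cder) : is_cder (fun x => k *: D x).
Proof.
have := cder_lin_subproof k D (CDer cder_zero_subproof).
by under [X in is_cder X -> _]funext => x do rewrite addr0.
Qed.
Fact cder_opp_subproof (D : cder) : is_cder (fun x => - D x).
Proof.
have := cder_scale_subproof (-1) D.
by under [X in is_cder X -> _]funext => x do rewrite scaleN1r.
Qed.
Fact cder_com_subproof (D E : cder) : is_cder (fun x => D (E x) - E (D x)).
Proof.
split=> [h x y|x y|n].
- by rewrite !cderL scalerBr opprD addrACA.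
- rewrite !cder_br !cderD !cder_br.
  apply: fliec_inj; apply/funext => s.
  rewrite /= !comBl !comBr !(seriesE, fliec_valD); ring.
have [m1 h1] := cder_cont D n; have [m2 h2] := cder_cont E m1.
have [m3 h3] := cder_cont E n; have [m4 h4] := cder_cont D m3.
exists (maxn m2 m4) => x hx; apply: ord_geB.
  by apply/h1/h2; apply: ord_ge_leq hx; apply: leq_maxl.
by apply/h3/h4; apply: ord_ge_leq hx; apply: leq_maxr.
Qed.

HB.instance Definition _ := gen_eqMixin cder.
HB.instance Definition _ := gen_choiceMixin cder.

Let zeroD : cder := CDer cder_zero_subproof.
Let addD (D E : cder) : cder := CDer (cder_add_subproof D E).
Let oppD (D : cder) : cder := CDer (cder_opp_subproof D).
Let scaleD (k : rat) (D : cder) : cder := CDer (cder_scale_subproof k D).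
Let comD (D E : cder) : cder := CDer (cder_com_subproof D E).

Fact addD_A : associative addD.
Proof. by move=> D E F; apply: cder_ext => x /=; rewrite addrA. Qed.
Fact addD_C : commutative addD.
Proof. by move=> D E; apply: cder_ext => x /=; rewrite addrC. Qed.
Fact addD_0 : left_id zeroD addD.
Proof. by move=> D; apply: cder_ext => x /=; rewrite add0r. Qed.
Fact addD_N : left_inverse zeroD oppD addD.
Proof. by move=> D; apply: cder_ext => x /=; rewrite addNr. Qed.
HB.instance Definition _ :=
  GRing.isZmodule.Build cder addD_A addD_C addD_0 addD_N.

Fact scaleD_A k1 k2 D : scaleD k1 (scaleD k2 D) = scaleD (k1 * k2) D.
Proof. by apply: cder_ext => x /=; rewrite scalerA. Qed.
Fact scaleD_1 : left_id 1 scaleD.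
Proof. by move=> D; apply: cder_ext => x /=; rewrite scale1r. Qed.
Fact scaleD_Dr : right_distributive scaleD +%R.
Proof. by move=> k D E; apply: cder_ext => x /=; rewrite scalerDr. Qed.
Fact scaleD_Dl D : {morph scaleD^~ D : k1 k2 / k1 + k2}.
Proof. by move=> k1 k2; apply: cder_ext => x /=; rewrite scalerDl. Qed.
HB.instance Definition _ := GRing.Zmodule_isLmodule.Build rat cder
  scaleD_A scaleD_1 scaleD_Dr scaleD_Dl.

Fact comD_Pl F : linear (fun D => comD D F).
Proof.
move=> k D E; apply: cder_ext => x /=.
by rewrite cderL scalerBr opprD addrACA.
Qed.
Fact comD_Pr F : linear (comD F).
Proof.
move=> k D E; apply: cder_ext => x /=.
by rewrite cderL scalerBr opprD addrACA.
Qed.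
Fact comD_xx D : comD D D = 0.
Proof. by apply: cder_ext => x /=; rewrite subrr. Qed.
Fact comD_jacobi D E F :
  comD D (comD E F) + comD E (comD F D) + comD F (comD D E) = 0.
Proof.
apply: cder_ext => x /=; rewrite !(cderD, cderN).
apply: fliec_inj; apply/funext => s /=; rewrite !seriesE; ring.
Qed.
HB.instance Definition _ := Lmodule_isLie.Build rat cder
  comD_Pl comD_Pr comD_xx comD_jacobi.

Lemma cderE_add (D E : cder) x : (D + E) x = D x + E x. Proof. by []. Qed.
Lemma cderE_opp (D : cder) x : (- D) x = - D x. Proof. by []. Qed.
Lemma cderE_scale k (D : cder) x : (k *: D) x = k *: D x. Proof. by []. Qed.
Lemma cderE_br (D E : cder) x : [lie D, E] x = D (E x) - E (D x).
Proof. by []. Qed.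

Lemma cder_gen_ext (D E : cder) :
  (forall c, D (gen c) = E (gen c)) -> D = E.
Proof.
move=> h.
have hF u : free_lie u -> forall x : fliec A, fliec_val x = u -> D x = E x.
  elim=> [c|x e|k u1 u2 f1 h1 f2 h2 x e|u1 u2 f1 h1 f2 h2 x e].
  - by move=> x e; have -> : x = gen c by apply: fliec_inj.
  - by have -> : x = 0 by [apply: fliec_inj]; rewrite !cder0.
  - pose y1 := mkfliec (free_lie_liec f1); pose y2 := mkfliec (free_lie_liec f2).
    have -> : x = k *: y1 + y2 by apply: fliec_inj.
    by rewrite !cderL (h1 y1) // (h2 y2).
  pose y1 := mkfliec (free_lie_liec f1); pose y2 := mkfliec (free_lie_liec f2).
  have -> : x = [lie y1, y2] by apply: fliec_inj.
  by rewrite !cder_br (h1 y1) // (h2 y2).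
apply: cder_ext => x; apply/eqP; rewrite -subr_eq0; apply/eqP.
apply: fliec_inj; apply: ord_ge_eq0 => n.
have [m1 c1] := cder_cont D n; have [m2 c2] := cder_cont E n.
have [v fv e] := fliecP x (maxn m1 m2).
pose y := mkfliec (free_lie_liec fv).
have -> : D x - E x = D (x - y) - E (x - y).
  by rewrite !cderD !cderN (hF v fv y) // opprD opprK addrACA addNr addr0.
apply: ord_geB.
  by apply: c1; apply: ord_ge_leq e; apply: leq_maxl.
by apply: c2; apply: ord_ge_leq e; apply: leq_maxr.
Qed.

(* On derivations this is the subspace [W_(-n)]: word length increases by at
   least [n]. *)
Definition cder_ge n (D : cder) : Prop :=
  forall m x, ord_ge m x -> ord_ge (m + n) (D x).

(** The continuous derivation with prescribed values [d c] on the letters.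
    On [u = u [::] + \sum_c gen c * shift c u] the Leibniz rule gives
    [D u = \sum_c d c * shift c u + \sum_c gen c * D (shift c u)]. *)
Fixpoint derS (d : A -> series A) (w : seq A) (u : series A) : rat :=
  (\sum_c d c * shift c u) w
  + (if w is c :: w' then derS d w' (shift c u) else 0).

Section LieDer.
Variable d : A -> fliec A.

Let D (u : series A) : series A := fun w => derS d w u.
Let E (u : series A) : series A := \sum_c (d c : series A) * shift c u.
Let S (u : series A) : series A :=
  fun w => if w is c :: w' then D (shift c u) w' else 0.

Let DE u : D u = E u + S u.
Proof. by apply/funext => -[|c w]. Qed.

Let DEp u w : D u w = E u w + S u w. Proof. by rewrite DE. Qed.

Let E_lin : linear E.
Proof.
move=> k u v; rewrite /E scaler_sumr -big_split /=; apply: eq_bigr => c _.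
by rewrite scalerAr -mulrDr.
Qed.

Let D_lin : linear D.
Proof.
move=> k u v; apply/funext => w; elim: w u v => [|c w IH] u v;
  rewrite DE E_lin !seriesE !DE !seriesE /S ?mulr0 ?addr0 //.
have -> : shift c (k *: u + v) = k *: shift c u + shift c v by [].
by rewrite IH !seriesE; ring.
Qed.

Let D0 : D 0 = 0.
Proof. by apply: addrr_eq; have := D_lin 1 0 0; rewrite !scale1r addr0. Qed.

Let shiftM (u v : series A) (c : A) :
  shift c (u * v) = u [::] *: shift c v + shift c u * v.
Proof. by apply/funext => w; rewrite /shift seriesM_cons. Qed.

Let EM (u v : series A) : E (u * v) = u [::] *: E v + E u * v.
Proof.
rewrite /E scaler_sumr mulr_suml -big_split /=; apply: eq_bigr => c _.
by rewrite shiftM mulrDr scalerAr mulrA.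
Qed.

Let DM (u v : series A) : D (u * v) = D u * v + u * D v.
Proof.
apply/funext => w; elim: w u v => [|c w IH] u v.
  rewrite !DE EM !seriesE !seriesM_nil !seriesE /S; ring.
rewrite seriesD [(u * D v) _]seriesM_cons.
rewrite [D u]DE mulrDl seriesD [(S u * v) _]seriesM_cons.
have -> : shift c (S u) = D (shift c u) by [].
rewrite [in LHS]DE EM !seriesE /S shiftM D_lin !seriesE IH seriesD.
rewrite [D v (c :: w)]DEp /S; ring.
Qed.

Let D_ord n u : ord_ge n.+1 u -> ord_ge n (D u).
Proof.
move=> hu w; elim: w n u hu => [|c w IH] n u hu hw; rewrite DE seriesD /=.
  rewrite addr0 /E series_sum big1 // => c _; rewrite seriesM_nil.
  by rewrite (free_liec_ord1 (fliecP (d c))) ?mul0r.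
rewrite /E (@ord_ge_sum _ n) ?add0r //.
  by case: n hu hw => // n hu hw; apply: (IH n); first exact: ord_ge_shift.
move=> c' _; rewrite -[n]add0n; apply: ord_geM => //.
exact: ord_ge_shift.
Qed.

Let D_gen c : D (genS c) = d c.
Proof.
have h (c' : A) : shift c' (genS c) = (c' == c)%:R *: 1.
  apply/funext => w; rewrite seriesZ series1 /shift /genS eqseq_cons.
  by case: eqP; rewrite ?mul1r ?mul0r.
have D1 : D 1 = 0 by apply: addrr_eq; have := DM 1 1; rewrite !mulr1 mul1r.
rewrite DE; have -> : S (genS c) = 0.
  apply/funext => -[|c' w] //=; rewrite h -[_ *: 1]addr0 D_lin D1.
  rewrite scaler0 add0r.
  by rewrite D0.
rewrite addr0 /E (bigD1 c) //= h eqxx scale1r mulr1 big1 ?addr0 // => c' hc.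
by rewrite h (negbTE hc) scale0r mulr0.
Qed.

Let D_com u v : D (com u v) = com (D u) v + com u (D v).
Proof.
rewrite /com -scaleN1r addrC D_lin !DM scaleN1r.
apply/funext => s; rewrite !seriesE; ring.
Qed.

Let D_liec u : free_liec u -> free_liec (D u).
Proof.
move=> hu; apply: free_liec_lim => n; have [v hv e] := hu n.+1.
exists (D v); last first.
  have -> : D u - D v = D (u - v) by rewrite addrC -scaleN1r -D_lin scaleN1r addrC.
  exact: D_ord.
elim: hv {e} => [c||k u1 v1 _ hu1 _ hv1|u1 v1 fu1 hu1 fv1 hv1].
- by rewrite D_gen; apply: fliecP.
- by rewrite D0; apply: free_lie_liec; apply: FreeLie0.
- by rewrite D_lin; apply: free_liec_lin.
- rewrite D_com -[com (D _) _]scale1r; apply: free_liec_lin;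
    apply: free_liec_com => //; exact: free_lie_liec.
Qed.

Fact lie_der_subproof :
  is_cder (fun x => mkfliec (D_liec (fliecP x))).
Proof.
split=> [k x y|x y|n]; first by apply: fliec_inj; exact: D_lin.
  by apply: fliec_inj; exact: D_com.
by exists n.+1 => x /= /D_ord.
Qed.
Definition lie_der : cder := CDer lie_der_subproof.

Lemma lie_der_gen c : lie_der (gen c) = d c.
Proof. by apply: fliec_inj; exact: D_gen. Qed.

End LieDer.

End Derivations.

(** The continuous algebra homomorphism with prescribed values [s c], without
    constant term, on the letters: on
    [u = u [::] + \sum_c gen c * shift c u] it is
    [u [::] + \sum_c s c * hom (shift c u)].  [homN s n u] is its value modulo
    words of length greater than [n]. *)
Fixpoint homN (A B : finType) (s : A -> series B) (n : nat) (u : series A) :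
    series B :=
  (u [::])%:A + (if n is m.+1 then \sum_c s c * homN s m (shift c u) else 0).

Definition homS (A B : finType) (s : A -> series B) (u : series A) : series B :=
  fun w => homN s (size w) u w.

Section LieHom.
Variables (A B : finType) (s : A -> fliec B).
Let N := homN s.
Let H := homS s.

Let s_ord c : ord_ge 1 (s c).
Proof. exact: free_liec_ord1 (fliecP _). Qed.

Let N_lin n : linear (N n).
Proof.
elim: n => [|n IH] k u v; rewrite /N /= seriesD seriesZ scalerDl -scalerA.
  by rewrite !addr0.
rewrite scalerDr addrACA; congr (_ + _).
rewrite scaler_sumr -big_split /=; apply: eq_bigr => c _.
have -> : shift c (k *: u + v) = k *: shift c u + shift c v by [].
by rewrite [homN _ _ _]IH mulrDr scalerAr.
Qed.

Let N_stab n k u : ord_ge n.+1 (N (n + k) u - N n u).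
Proof.
elim: n u => [|n IH] u.
  rewrite add0n /N; case: k => [|k]; first by rewrite subrr.
  rewrite /= addr0 addrC addKr; apply: ord_ge_sum => c _.
  by rewrite -[1%N]addn0; apply: ord_geM.
rewrite addSn /N /= opprD addrACA subrr add0r -sumrB.
apply: ord_ge_sum => c _; rewrite -mulrBr -[n.+2]add1n.
by apply: ord_geM => //; apply: IH.
Qed.

Let H_N n u : ord_ge n.+1 (H u - N n u).
Proof.
move=> w; rewrite ltnS => hw; have := @N_stab (size w) (n - size w) u w (ltnSn _).
by rewrite subnKC // !seriesE => /eqP; rewrite subr_eq0 => /eqP ->; rewrite subrr.
Qed.

Let H_ext u v : (forall n, ord_ge n.+1 (N n u - v)) -> H u = v.
Proof.
move=> h; apply/funext => w; have := h (size w) w (ltnSn _).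
by rewrite seriesB => /eqP; rewrite subr_eq0 => /eqP.
Qed.

Let H_lin : linear H.
Proof.
move=> k u v; apply/funext => w.
by rewrite /H /homS [homN _ _ _]N_lin.
Qed.

Let H_ord n u : ord_ge n u -> ord_ge n (H u).
Proof.
have hN m : ord_ge n u -> ord_ge n (N m u).
  elim: m n u => [|m IH] n u' hu; case: n hu => // n hu; rewrite /N /=.
    by rewrite hu // scale0r addr0.
  rewrite hu // scale0r add0r; apply: ord_ge_sum => c _; rewrite -add1n.
  by apply: ord_geM => //; apply: IH; apply: ord_ge_shift.
by move=> hu w hw; apply: hN.
Qed.

Let NM n u v : ord_ge n.+1 (N n (u * v) - N n u * N n v).
Proof.
elim: n u v => [|n IH] u v.
  by rewrite /N /= !addr0 seriesM_nil -scalerAl mul1r scalerA subrr.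
have e : N n.+1 (u * v) - N n.+1 u * N n.+1 v =
    \sum_c (s c : series B) * (N n (shift c u * v) - N n (shift c u) * N n v)
    - (\sum_c (s c : series B) * N n (shift c u)) * (N n.+1 v - N n v).
  have eu w : N n.+1 w = (w [::])%:A + \sum_c (s c : series B) * N n (shift c w).
    by [].
  have -> : N n.+1 (u * v) = u [::] *: N n.+1 v
      + \sum_c (s c : series B) * N n (shift c u * v).
    rewrite !eu seriesM_nil scalerDr scalerA -addrA; congr (_ + _).
    rewrite scaler_sumr -big_split /=; apply: eq_bigr => c _.
    have -> : shift c (u * v) = u [::] *: shift c v + shift c u * v.
      by apply/funext => w; rewrite /shift seriesM_cons.
    by rewrite N_lin mulrDr scalerAr.
  rewrite [N n.+1 u]eu mulrDl -scalerAl mul1r.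
  under [in RHS]eq_bigr => c _ do rewrite mulrBr mulrA.
  rewrite sumrB -mulr_suml mulrBr !opprD opprK.
  by rewrite [LHS]addrACA subrr add0r addrA addrAC subrK.
rewrite e; apply: ord_geB.
  by apply: ord_ge_sum => c _; rewrite -[n.+2]add1n; apply: ord_geM.
rewrite -[n.+2]add1n; apply: ord_geM.
  by apply: ord_ge_sum => c _; rewrite -[1%N]addn0; apply: ord_geM.
by have := @N_stab n 1 v; rewrite addn1.
Qed.

Let HM u v : H (u * v) = H u * H v.
Proof.
apply: H_ext => n.
have -> : N n (u * v) - H u * H v = (N n (u * v) - N n u * N n v)
    - ((H u - N n u) * H v + N n u * (H v - N n v)).
  by rewrite mulrBl mulrBr subrKA opprB subrKA.
apply: ord_geB; first exact: NM.
apply: ord_geD; first by rewrite -[n.+1]addn0; apply: ord_geM.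
by rewrite -[n.+1]add0n; apply: ord_geM.
Qed.

Let H0 : H 0 = 0.
Proof. by apply: addrr_eq; have := H_lin 1 0 0; rewrite !scale1r addr0. Qed.

Let H_B u v : H (u - v) = H u - H v.
Proof. by rewrite addrC -scaleN1r H_lin scaleN1r addrC. Qed.

Let H_com u v : H (com u v) = com (H u) (H v).
Proof. by rewrite /com H_B !HM. Qed.

Let N1 n : N n 1 = 1.
Proof.
case: n => [|n]; rewrite /N /= series1 eqxx scale1r ?addr0 //.
rewrite big1 ?addr0 // => c _.
have -> : shift c (1 : series A) = 0 by apply/funext.
have -> : homN s n 0 = 0.
  by apply: addrr_eq; have := @N_lin n 1 0 0; rewrite !scale1r addr0.
by rewrite mulr0.
Qed.

Let H_gen c : H (genS c) = s c.
Proof.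
apply: H_ext => -[|n].
  rewrite /N /= scale0r !add0r; apply: ord_geN; exact: s_ord.
have h (c' : A) : shift c' (genS c) = (c' == c)%:R *: 1 + 0.
  rewrite addr0; apply/funext => w.
  rewrite seriesZ series1 /shift /genS eqseq_cons.
  by case: eqP; rewrite ?mul1r ?mul0r.
rewrite /N /= scale0r add0r (bigD1 c) //= big1 ?addr0.
  rewrite h eqxx scale1r addr0 [homN _ _ _]N1 mulr1 subrr; exact: ord_ge0.
move=> c' hc; rewrite h (negbTE hc) scale0r addr0.
have -> : homN s n 0 = 0.
  by apply: addrr_eq; have := @N_lin n 1 0 0; rewrite !scale1r addr0.
by rewrite mulr0.
Qed.

Let H_liec u : free_liec u -> free_liec (H u).
Proof.
move=> hu; apply: free_liec_lim => n; have [v hv e] := hu n.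
exists (H v); last by rewrite -H_B; apply: H_ord.
elim: hv {e} => [c||k u1 v1 _ hu1 _ hv1|u1 v1 fu1 hu1 fv1 hv1].
- by rewrite H_gen; apply: fliecP.
- by rewrite H0; apply: free_lie_liec; apply: FreeLie0.
- by rewrite H_lin; apply: free_liec_lin.
- by rewrite H_com; apply: free_liec_com.
Qed.

Definition lie_hom (x : fliec A) : fliec B := mkfliec (H_liec (fliecP x)).

Lemma lie_hom_morphism : lie_morphism lie_hom.
Proof.
split=> [k x y|x y]; apply: fliec_inj; [exact: H_lin | exact: H_com].
Qed.
Lemma lie_hom_cont n (x : fliec A) : ord_ge n x -> ord_ge n (lie_hom x).
Proof. exact: H_ord. Qed.
Lemma lie_hom_gen c : lie_hom (gen c) = s c.
Proof. by apply: fliec_inj; exact: H_gen. Qed.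

End LieHom.

Fixpoint bernoulli_seq (n : nat) : seq rat :=
  if n is m.+1 then
    let B := bernoulli_seq m in
    rcons B (- (\sum_(k < n) 'C(n.+1, k)%:R * B`_k) / n.+1%:R)
  else [:: 1].

Definition bernoulli (n : nat) : rat := (bernoulli_seq n)`_n.

Lemma size_bernoulli_seq n : size (bernoulli_seq n) = n.+1.
Proof. by elim: n => //= n IH; rewrite size_rcons IH. Qed.

Lemma nth_bernoulli_seq n k : (k <= n)%N -> (bernoulli_seq n)`_k = bernoulli k.
Proof.
elim: n => [|n IH] hk; first by case: k hk.
case: (ltngtP k n.+1) hk => // [hk|->] _ //.
by rewrite /= nth_rcons size_bernoulli_seq hk IH.
Qed.

Lemma bernoulli_rec n :
  \sum_(k < n.+1) 'C(n.+1, k)%:R * bernoulli k = (n == 0)%:R.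
Proof.
case: n => [|n]; first by rewrite big_ord1 bin0 mul1r.
rewrite big_ord_recr /= {2}/bernoulli /= nth_rcons size_bernoulli_seq ltnn eqxx.
have h : n.+2%:R != 0 :> rat by rewrite Num.Theory.pnatr_eq0.
rewrite binSn mulrCA divff // mulr1.
apply/eqP; rewrite subr_eq0; apply/eqP/eq_bigr => k _.
by rewrite nth_bernoulli_seq // -ltnS.
Qed.

Section AdSeries.
Variables (A : finType) (c : nat -> rat) (x y : fliec A).

Let ord_ad n : ord_ge n.+1 (lie_ad n x y).
Proof.
elim: n => [|n IH]; first exact: free_liec_ord1 (fliecP y).
rewrite -[n.+2]add1n /= ; apply: ord_ge_com => //.
exact: free_liec_ord1 (fliecP x).
Qed.

(* The sum over all [k] of [c k *: lie_ad k x y]; the term of index [k] has no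
   words of length at most [k]. *)
Definition ad_seriesS : series A :=
  fun w => \sum_(k < size w) c k * (lie_ad k x y : series A) w.

Fact ad_series_subproof : free_liec ad_seriesS.
Proof.
have e m (F : nat -> fliec A) :
    fliec_val (\sum_(k < m) F k) = \sum_(k < m) fliec_val (F k).
  by elim/big_rec2: _ => // i u v _ <-.
apply: free_liec_lim => n.
exists (fliec_val (\sum_(k < n) c k *: lie_ad k x y)); first exact: fliecP.
move=> w hw; rewrite (e n (fun k => c k *: lie_ad k x y)) !seriesE /ad_seriesS.
have -> : \sum_(k < size w) c k * (lie_ad k x y : series A) w
    = \sum_(k < n) c k * (lie_ad k x y : series A) w.
  rewrite (big_ord_widen _ (fun k => c k * (lie_ad k x y : series A) w) (ltnW hw)).
  rewrite big_mkcond /=; apply: eq_bigr => k _; case: ltnP => // hk.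
  by rewrite (@ord_ad k w) ?mulr0.
exact: subrr.
Qed.
Definition ad_series : fliec A := mkfliec ad_series_subproof.

End AdSeries.

Local Notation "p %:F" := (FracField.tofrac p).

Section FracNumDen.
Import FracField.
Lemma frac_numden (R : idomainType) (f : {fraction R}) :
  f = (frac (repr f)).1%:F / (frac (repr f)).2%:F.
Proof.
rewrite -{1}[f]reprK; set x := repr f; unlock tofrac.
rewrite -[X in _ * X]pi_inv -[RHS]pi_mul /invf /mulf /=.
by rewrite !numden_Ratio ?oner_neq0 ?denom_ratioP // mulr1 mul1r Ratio_numden.
Qed.

End FracNumDen.

(* Rational functions of [y_0, ..., y_r]. *)
Notation ratfun r := {fraction {mpoly rat[r.+1]}}.

Definition rf_num r (f : ratfun r) : {mpoly rat[r.+1]} := (frac (repr f)).1.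
Definition rf_den r (f : ratfun r) : {mpoly rat[r.+1]} := (frac (repr f)).2.

(* The degree of a nonzero homogeneous rational function; see [rf_degE]. *)
Definition rf_deg r (f : ratfun r) : int :=
  (msize (rf_num f))%:Z - (msize (rf_den f))%:Z.

Definition mp_ren r t (v : 'I_r.+1 -> 'I_t.+1) (p : {mpoly rat[r.+1]}) :
    {mpoly rat[t.+1]} :=
  p \mPo [tuple 'X_(v i) | i < r.+1].

(* [f (y_(v 0), ..., y_(v r))], for an injective [v]; see [rf_renE]. *)
Definition rf_ren r t (v : 'I_r.+1 -> 'I_t.+1) (f : ratfun r) : ratfun t :=
  (mp_ren v (rf_num f))%:F / (mp_ren v (rf_den f))%:F.

Lemma rf_den_neq0 r (f : ratfun r) : rf_den f != 0.
Proof. exact: denom_ratioP. Qed.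
Lemma rf_cross r (p q : {mpoly rat[r.+1]}) : q != 0 ->
  rf_num (p%:F / q%:F) * q = p * rf_den (p%:F / q%:F).
Proof.
move=> nq; set f := _ / _.
have nz : (rf_den f)%:F != 0 :> ratfun r by rewrite tofrac_eq0 rf_den_neq0.
have nq' : q%:F != 0 :> ratfun r by rewrite tofrac_eq0.
have e : (rf_num f)%:F = f * (rf_den f)%:F by rewrite {2}[f]frac_numden divfK.
apply/eqP; rewrite -tofrac_eq !tofracM e /f mulrAC divfK //.
Qed.

Lemma rf_degE r (p q : {mpoly rat[r.+1]}) : p != 0 -> q != 0 ->
  rf_deg (p%:F / q%:F) = (msize p)%:Z - (msize q)%:Z.
Proof.
move=> np nq; have /(congr1 (fun u => msize u)) := rf_cross p nq.
rewrite /rf_deg; set n := rf_num _; set d := rf_den _.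
have nd : d != 0 by apply: rf_den_neq0.
have nn : n != 0.
  apply: contraNneq np => e0; have := rf_cross p nq; rewrite -/n e0 mul0r.
  by move/esym/eqP; rewrite mulf_eq0 (negbTE nd) orbF.
rewrite !msizeM // => e.
have gt0 (u : {mpoly rat[r.+1]}) : u != 0 -> (0 < msize u)%N.
  by rewrite lt0n msize_poly_eq0.
have key (a b c k : nat) : (0 < a)%N -> (0 < b)%N -> (0 < c)%N -> (0 < k)%N ->
  (a + b).-1 = (c + k).-1 -> (a%:Z - k%:Z = c%:Z - b%:Z)%R by lia.
by apply: key e; apply: gt0.
Qed.

Lemma mp_ren_inj r t (v : 'I_r.+1 -> 'I_t.+1) : injective v -> injective (mp_ren v).
Proof.
move=> iv; pose v' (j : 'I_t.+1) := odflt ord0 [pick i | v i == j].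
have v'K : cancel v v'.
  move=> i; rewrite /v'; case: pickP => [k /eqP /iv //|/(_ i)]; by rewrite eqxx.
apply: (can_inj (g := mp_ren v')) => p.
rewrite [RHS]mpolyE /mp_ren [X in X \mPo _]comp_mpolyEX raddf_sum /=.
apply: eq_bigr => m _.
rewrite comp_mpolyZ; congr (_ *: _).
rewrite [X in X \mPo _]comp_mpolyX rmorph_prod /= mpolyXE_id.
apply: eq_bigr => i _; rewrite rmorphXn /= tnth_mktuple comp_mpolyXU.
by rewrite -tnth_nth tnth_mktuple v'K.
Qed.
Lemma rf_renE r t (v : 'I_r.+1 -> 'I_t.+1) p q : injective v -> q != 0 ->
  rf_ren v (p%:F / q%:F) = (mp_ren v p)%:F / (mp_ren v q)%:F.
Proof.
move=> iv nq; have e := rf_cross p nq.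
have nz w : w != 0 -> (mp_ren v w)%:F != 0 :> ratfun t.
  move=> nw; rewrite tofrac_eq0; apply: contra nw => /eqP h.
  by apply/eqP/(mp_ren_inj iv); rewrite h /mp_ren comp_mpoly0.
have nd := rf_den_neq0 (p%:F / q%:F).
rewrite /rf_ren; apply/eqP; rewrite eqr_div ?nz // -!tofracM tofrac_eq.
by rewrite -!rmorphM /= e mulrC.
Qed.

(* The linearised Ihara action, for [t = r + s] and homogeneous [f]; the number
   of variables [t] is an argument of its own so that both terms of [ih_br] have
   the same type. *)
Definition ih_circ t r s (f : ratfun r) (g : ratfun s) : ratfun t :=
  \sum_(i < s.+1)
     rf_ren (fun k => inord (i + k)%N) f *
     rf_ren (fun k => inord (if k <= i then k : nat else k + r)%N) g
  + (-1) ^ (rf_deg f + r%:Z) *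
    \sum_(i < s.+1 | (0 < i)%N)
       rf_ren (fun k => inord (i + r - k)%N) f *
       rf_ren (fun k => inord (if k < i then k : nat else k + r)%N) g.

Definition ih_br r s (f : ratfun r) (g : ratfun s) : ratfun (r + s) :=
  ih_circ (r + s) f g - ih_circ (r + s) g f.

(* A function [f (x_1, ..., x_r)] is identified with the translation-invariant
   function [f (y_1 - y_0, ..., y_r - y_0)], so [x_j] is [y_j - y_0]. *)
Definition xvar r (j : nat) : ratfun r := ('X_(inord j) - 'X_ord0)%:F.

Definition rf_cst r (q : rat) : ratfun r := (q%:MP)%:F.

Definition xpow (k : nat) : ratfun 1 := xvar 1 1 ^+ k.

Definition can_s1 : ratfun 1 := (2 * xvar 1 1)^-1.
Definition can_s2 : ratfun 2 :=
  let x1 := xvar 2 1 in let x2 := xvar 2 2 in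
  rf_cst 2 (1 / 12) * ((x1 * x2)^-1 + (x2 * (x1 - x2))^-1).

Definition xi1 (n : nat) : ratfun 1 := xpow n.*2.
Definition xi2 (n : nat) : ratfun 2 := ih_br can_s1 (xpow n.*2).
Definition xi3 (n : nat) : ratfun 3 :=
  ih_br can_s2 (xpow n.*2) + rf_cst 3 (1 / 2) * ih_br can_s1 (ih_br can_s1 (xpow n.*2)).

(* [q] is [n - p]. *)
Definition xi3_correction (n : nat) : ratfun 3 :=
  \sum_(1 <= p < n) let q := (n - p)%N in
    rf_cst 3 (bernoulli p.*2 * bernoulli q.*2 / bernoulli n.*2
              * 'C(n.*2, p.*2)%:R / (24 * q)%:R)
    * ih_br (xpow p.*2) (ih_br (xpow q.*2) (xpow 2)^-1).

Inductive xlet := X0 | X1.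
Inductive ablet := La | Lb.

Definition xlet_bool (c : xlet) : bool := if c is X0 then false else true.
Definition bool_xlet (c : bool) : xlet := if c then X1 else X0.
Fact xlet_boolK : cancel xlet_bool bool_xlet. Proof. by case. Qed.
HB.instance Definition _ := Finite.copy xlet (can_type xlet_boolK).

Definition ablet_bool (c : ablet) : bool := if c is La then false else true.
Definition bool_ablet (c : bool) : ablet := if c then Lb else La.
Fact ablet_boolK : cancel ablet_bool bool_ablet. Proof. by case. Qed.
HB.instance Definition _ := Finite.copy ablet (can_type ablet_boolK).

Definition gx0 : fliec xlet := gen X0.
Definition gx1 : fliec xlet := gen X1.
Definition ga : fliec ablet := gen La.
Definition gb : fliec ablet := gen Lb.
Definition Theta : fliec ablet := [lie ga, gb].

(* [x0^(m 0) x1 x0^(m 1) ... x1 x0^(m r)] *)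
Definition depth_word r (m : 'X_{1..r.+1}) : seq xlet :=
  nseq (m ord0) X0
  ++ flatten [seq X1 :: nseq (m (lift ord0 j)) X0 | j <- enum 'I_r].

(* [p (y_0, ..., y_r)] encodes the depth [r] part of [u]. *)
Definition is_depth_poly r (u : series xlet) (p : {mpoly rat[r.+1]}) : Prop :=
  forall m : 'X_{1..r.+1}, p@_m = u (depth_word m).

(* [p (0, x_1, ..., x_r)] *)
Definition reduced r (p : {mpoly rat[r.+1]}) : {mpoly rat[r]} :=
  p \mPo [tuple (if unlift ord0 i is Some j then 'X_j else 0) | i < r.+1].

(* [q (y_1 - y_0, ..., y_r - y_0)] *)
Definition rf_of_reduced r (q : {mpoly rat[r]}) : ratfun r :=
  (q \mPo [tuple 'X_(lift ord0 j) - 'X_ord0 | j < r])%:F.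

(* The reduced polynomial of [u] in depth [r] is the rational function [f]. *)
Definition reduced_in_depth r (u : series xlet) (f : ratfun r) : Prop :=
  exists2 p, is_depth_poly u p & rf_of_reduced (reduced p) = f.

(* For [f = i(sigma)] this is the derivation [i_0(sigma)]. *)
Definition der0 (f : fliec xlet) : cder xlet :=
  lie_der (fun c => if c is X0 then [lie gx0, f] else 0).

(* The Ihara bracket on Lie series; by [der0_ihara] it is the one that makes
   [der0] a homomorphism. *)
Definition ihara (f g : fliec xlet) : fliec xlet :=
  [lie f, g] + der0 f g - der0 g f.

Lemma der0_gx0 f : der0 f gx0 = [lie gx0, f].
Proof. exact: lie_der_gen. Qed.
Lemma der0_gx1 f : der0 f gx1 = 0.
Proof. exact: lie_der_gen. Qed.

Lemma der0_ihara f g : der0 (ihara f g) = [lie der0 f, der0 g].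
Proof.
apply: cder_gen_ext => -[].
  rewrite !cderE_br !der0_gx0 !cder_br !der0_gx0 /ihara.
  apply: fliec_inj; apply/funext => s.
  rewrite !(fliec_valB, fliec_valD) /= /com.
  rewrite !(mulrBl, mulrBr, mulrDl, mulrDr, mulrA) !seriesE; ring.
by rewrite !cderE_br !der0_gx1 !cder0 subr0.
Qed.

Definition phi : fliec xlet -> fliec ablet :=
  lie_hom (fun c =>
    if c is X0 then ad_series (fun k => bernoulli k / k`!%:R) gb ga else Theta).

Definition is_eps_dual (k : nat) (D : cder ablet) : Prop :=
  [/\ D ga = lie_ad k ga gb, D Theta = 0 & (D gb : series ablet) [:: La] = 0].

Lemma is_eps_dual_exists m : exists D, is_eps_dual m.*2 D.
Proof.
pose e i : fliec ablet := lie_ad i ga gb.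
pose eb := \sum_(i < m) (-1) ^+ i *: [lie e i, e (m.*2.-1 - i)%N].
pose D := lie_der (fun c => if c is La then e m.*2 else eb).
have Da : D ga = e m.*2 by exact: lie_der_gen.
have Db : D gb = eb by exact: lie_der_gen.
have anti (x y : fliec ablet) : [lie x, y] = - [lie y, x].
  by apply: fliec_inj; rewrite /= /com opprB.
have leib (x y z : fliec ablet) :
    [lie x, [lie y, z]] = [lie [lie x, y], z] + [lie y, [lie x, z]].
  apply: fliec_inj; apply/funext => w.
  by rewrite /= /com !(mulrBl, mulrBr) !mulrA !seriesE; ring.
have lie_adZ (r : rat) (x y : fliec ablet) :
    [lie x, r *: y] = r *: [lie x, y] by exact: lie_brZr.
pose T i := (-1) ^+ i *: [lie e i, e (m.*2 - i)%N].
have tel n : (n <= m)%N ->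
    [lie ga, \sum_(i < n) (-1) ^+ i *: [lie e i, e (m.*2.-1 - i)%N]] = T 0%N - T n.
  elim: n => [|n IH] hn; first by rewrite big_ord0 lie_br0r subrr.
  rewrite big_ord_recr /= lie_brDr IH 1?ltnW // lie_adZ leib /T exprS mulN1r.
  have -> : (m.*2 - n = (m.*2.-1 - n).+1)%N by lia.
  have -> : (m.*2 - n.+1 = m.*2.-1 - n)%N by lia.
  by rewrite scaleNr opprK scalerDr [X in _ + X]addrC addrA addrNK.
exists D; split=> //.
  rewrite /Theta cder_br Da Db /eb tel // /T subn0 expr0 scale1r.
  have -> : (m.*2 - m = m)%N by lia.
  by rewrite lie_brxx scaler0 subr0 anti addNr.
have h2 : ord_ge 2 (eb : series ablet).
  have h0 : ord_ge 2 (fliec_val (0 : fliec ablet)) by [].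
  rewrite /eb; elim/big_rec: _ => // i x _ hx.
  apply: ord_ge_lin => //; apply: (@ord_ge_com _ 1 1);
    exact: free_liec_ord1 (fliecP _).
by rewrite Db; exact: h2.
Qed.

Definition ueps_coef (k : nat) : rat :=
  if k == 0%N then 1 / 12 else bernoulli (k - 2) / (k - 2)`!%:R.

Definition len_homog (A : finType) (m : nat) (u : series A) : Prop :=
  forall w, u w <> 0 -> size w = m.

Definition letter_homog (A : finType) (c : A) (m : nat) (u : series A) : Prop :=
  forall w, u w <> 0 -> count_mem c w = m.

(* [deg m] is the summand of index [m] of a grading of the Lie algebra [L]. *)
Definition lie_grading (L : lieType rat) (deg : nat -> L -> Prop) : Prop :=
  [/\ forall m, deg m 0 /\
        forall (k : rat) x y, deg m x -> deg m y -> deg m (k *: x + y),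
      forall x, exists N (y : nat -> L),
        (forall m, deg m (y m)) /\ x = \sum_(m < N) y m,
      forall N (y : nat -> L), (forall m, deg m (y m)) ->
        \sum_(m < N) y m = 0 -> forall m, (m < N)%N -> y m = 0
    & forall m p x y, deg m x -> deg p y -> deg (m + p)%N [lie x, y]].

(* [L] is free on the family [s n], [P n]. *)
Definition free_lie_on (L : lieType rat) (P : pred nat) (s : nat -> L) : Prop :=
  forall (M : lieType rat) (t : nat -> M),
    exists f : L -> M, [/\ lie_morphism f, forall n, P n -> f (s n) = t n
      & forall g : L -> M, lie_morphism g ->
          (forall n, P n -> g (s n) = t n) -> g =1 f].

(** The category of mixed Tate motives over the integers is not constructed
    here.  The motivic Lie algebra enters through the structure that its de Rham
    Tannaka group gives it: it is free, graded, and acts on the genus zero and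
    genus one fundamental Lie algebras.  [gm_deg m] is its part of degree [-m].

    [gm_i1_deg] says that the action on the bigraded Lie algebra of the punctured
    Tate curve respects weights, the weight of a word being given by its number
    of letters [a]; [gm_i] respects weights in the same way.  It cannot be
    dropped, as [gm_i1_phi] alone determines [gm_i1] only up to multiples of the
    monodromy derivation, which kills [Theta] and the image of [phi] and raises
    the number of letters [a] by 1. *)
Record motivic_lie := MotivicLie {
  gm :> lieType rat;
  gm_deg : nat -> gm -> Prop;
  gm_grading : lie_grading gm_deg;
  gm_free : exists2 s : nat -> gm,
    free_lie_on (fun n => 0 < n)%N s
    & forall n, (0 < n)%N -> gm_deg n.*2.+1 (s n);
  gm_i : gm -> flie xlet;
  gm_i_linear : linear gm_i;
  gm_i_inj : injective gm_i;
  gm_i_ihara : forall sigma tau, complete (gm_i [lie sigma, tau])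
    = ihara (complete (gm_i sigma)) (complete (gm_i tau));
  gm_i_deg : forall m sigma, gm_deg m sigma -> len_homog m (gm_i sigma);
  gm_i1 : gm -> cder ablet;
  gm_i1_morphism : lie_morphism gm_i1;
  gm_i1_Theta : forall sigma, gm_i1 sigma Theta = 0;
  gm_i1_phi : forall sigma x,
    gm_i1 sigma (phi x) = phi (der0 (complete (gm_i sigma)) x);
  gm_i1_deg : forall m sigma, gm_deg m sigma ->
    forall k (x : fliec ablet), letter_homog La k x -> letter_homog La (k + m) (gm_i1 sigma x)
}.

Definition is_canonical (G : motivic_lie) (n : nat) (sigma : G) : Prop :=
  [/\ gm_deg n.*2.+1 sigma,
      reduced_in_depth (gm_i sigma) (xi1 n),
      reduced_in_depth (gm_i sigma) (xi2 n)
    & reduced_in_depth (gm_i sigma) (xi3 n + xi3_correction n)].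

(* Main.v *)
Require Import Defs.
From HB Require Import structures.
From mathcomp Require Import all_boot all_order all_algebra.
From mathcomp Require Import mpoly boolp ring lra zify.

Set Implicit Arguments.
Unset Strict Implicit.
Unset Printing Implicit Defensive.

Import GRing.Theory.
Local Open Scope ring_scope.
Local Notation "p %:F" := (FracField.tofrac p).

(** Write f for the Lie series i(sigma), D for the derivation i_1(sigma), Theta
    for [a,b], and t01 for the image of x0 under phi, which is
    a + Theta/2 + [b,[b,a]]/12 up to terms with at least three letters b.  The
    characterisation of i_1 says that D t01 = [t01, phi f] and D Theta = 0.  As D
    adds exactly 2n+1 letters a, working modulo W_(-2n-5) means keeping at most
    three letters b in D(a); since D kills Theta, D(a) controls D(b).  The part
    of D(a) with r letters b involves f in depths at most r only, so the
    canonical form of f in depths 1, 2, 3 is all that is needed.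

    Everything is turned into identities between rational functions.  A word
    a^i0 b a^i1 ... b a^ir is evaluated at points y_0, ..., y_r as
    y_0^i0 ... y_r^ir; this is a corner entry of a representation in which a is
    diagonal and b is a shift, so a product is evaluated by cutting the sequence
    of points in all possible ways ([evM]).  When the points are independent
    variables, the evaluation of f is its depth polynomial ([reduced_rf_at]), and
    an element whose evaluations vanish is zero ([path_eval_eq0]).

    Under phi the letters x0 and x1 become upper triangular matrices X0 and X1.
    The eigenvalues of X0 are the points; conjugation by a unipotent matrix U
    with X0 U = U diag(y) turns phi f into the evaluation of f with x1 replaced
    by the strictly triangular matrix U^(-1) X1 U, that is, into a sum over
    subsequences of the points ([E_phi2], [E_phi3], [E_phi4]).  Solving
    D t01 = [t01, phi f] then expresses D(a) through the values of f ([tate_der1],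
    [tate_der2], [tate_der3]).

    For the depth components xi^(1), xi^(2), xi^(3), built from s^(1) and s^(2),
    the result is (y_0 - y_1)^(2n+2), 0 and 0 ([xi2_vanish], [xi3_vanish]): their
    only contribution is epsilon_(2n+2).  The remaining term of depth 3 enters
    D(a) multiplied by (y_0 - y_3)(y_0 - y_1)(y_1 - y_2)(y_2 - y_3), and after
    this multiplication {x^(2p), {x^(2q), x^(-2)}} is exactly the value of
    [epsilon_(2p+2), [epsilon_(2q+2), epsilon_0]] at a ([corr_tau]): derivations
    killing Theta compose like rational functions under the Ihara bracket, with
    x^(2k) corresponding to epsilon_(2k+2) and x^(-2) to epsilon_0.  The
    coefficients agree because B_(2n), which occurs in the denominator of the
    canonical element, is not zero ([bernoulli_neq0]). *)

(** * Bernoulli numbers of even index do not vanish *)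

Lemma bernoulli_unique (C : nat -> rat) :
  (forall n, \sum_(k < n.+1) 'C(n.+1, k)%:R * C k = (n == 0)%:R) -> C =1 bernoulli.
Proof.
move=> h n; have [m] := ubnP n; elim: m n => // m IH n hn.
have := h n; rewrite -(bernoulli_rec n) !big_ord_recr /=.
have -> : \sum_(k < n) 'C(n.+1, k)%:R * C k = \sum_(k < n) 'C(n.+1, k)%:R * bernoulli k.
  by apply: eq_bigr => k _; rewrite IH // (leq_trans (ltn_ord k)).
move/addrI; apply: mulfI; by rewrite binSn Num.Theory.pnatr_eq0.
Qed.

(** The alternating left-hand side satisfies the defining recursion, because
    alternating sums of binomial coefficients vanish. *)
Lemma bernoulli_reflect n :
  (-1) ^+ n * (\sum_(k < n.+1) 'C(n, k)%:R * bernoulli k) = bernoulli n.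
Proof.
apply: (bernoulli_unique
  (C := fun n => (-1) ^+ n * (\sum_(k < n.+1) 'C(n, k)%:R * bernoulli k))) => {}n.
pose G (k j : nat) : rat := 'C(n.+1, k)%:R * (-1) ^+ k * 'C(k, j)%:R * bernoulli j.
transitivity (\sum_(k < n.+1) \sum_(j < n.+1) G k j).
  apply: eq_bigr => k _; rewrite !mulr_sumr.
  rewrite (@big_ord_widen _ _ _ k.+1 n.+1 (fun j => 'C(n.+1, k)%:R * ((-1) ^+ k * ('C(k,
    j)%:R * bernoulli j)))) //.
  rewrite big_mkcond; apply: eq_bigr => j _; rewrite /G.
  case: ltnP => h; first by rewrite !mulrA.
  by rewrite (bin_small h) mulr0 mul0r.
rewrite exchange_big /=.
transitivity (\sum_(j < n.+1) (-1) ^+ n * ('C(n.+1, j)%:R * bernoulli j)); last first.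
  by rewrite -mulr_sumr bernoulli_rec; case: n {G} => [|n]; rewrite ?mulr0 // expr0 mul1r.
apply: eq_bigr => j _; have hj : (j <= n.+1)%N by apply: ltnW.
have bs (k : nat) : (j <= k <= n.+1)%N -> ('C(n.+1, k) * 'C(k, j) =
  'C(n.+1, j) * 'C(n.+1 - j, k - j))%N.
  case/andP=> h1 h2; apply/eqP.
  have p1 : (0 < j`! * (k - j)`! * (n.+1 - k)`!)%N by rewrite !muln_gt0 !fact_gt0.
  rewrite -(eqn_pmul2r p1); apply/eqP.
  have e1 := bin_fact h2; have e2 := bin_fact h1; have e3 := bin_fact hj.
  have h4 : (k - j <= n.+1 - j)%N by lia.
  have e4 := bin_fact h4; have e5 : (n.+1 - j - (k - j) = n.+1 - k)%N by lia.
  rewrite e5 in e4.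
  transitivity (n.+1`!); first by rewrite -e1 -e2; ring.
  by rewrite -e3 -e4; ring.
have alt : \sum_(i < (n.+1 - j).+1) (-1) ^+ i * 'C(n.+1 - j, i)%:R = 0 :> rat.
  have := exprDn (1 : rat) (-1) (n.+1 - j); rewrite subrr expr0n.
  have -> : (n.+1 - j == 0)%N = false by have := ltn_ord j; lia.
  move=> e; rewrite [RHS]e; apply: eq_bigr => i _.
  by rewrite expr1n mul1r mulr_natr.
have -> : \sum_(k < n.+1) G k j =
   'C(n.+1, j)%:R * bernoulli j * ((-1) ^+ j * \sum_(i < (n.+1 - j)) (-1) ^+ i * 'C(n.+1 -
     j, i)%:R).
  have -> : \sum_(k < n.+1) G k j = \sum_(0 <= k < n.+1) G k j by rewrite big_mkord.
  rewrite (@big_cat_nat _ _ _ j) //= ?(ltnW (ltn_ord j)) //.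
  rewrite big_nat big1 ?add0r; last first.
    by move=> k /andP[_ h]; rewrite /G (bin_small h) mulr0 mul0r.
  rewrite -{1}[nat_of_ord j]add0n big_addn big_mkord !mulr_sumr.
  apply: eq_bigr => i _; rewrite /G addnC exprD.
  have := bs (j + i)%N; rewrite leq_addr addKn => /(_ _) e.
  have {e}e : ('C(n.+1, j + i) * 'C(j + i, j) = 'C(n.+1, j) * 'C(n.+1 - j, i))%N.
    by apply: e; have := ltn_ord i; lia.
  have e' : 'C(n.+1, j + i)%:R * 'C(j + i, j)%:R = 'C(n.+1, j)%:R * 'C(n.+1 - j, i)%:R :> rat.
    by rewrite -!natrM e.
  transitivity ((-1) ^+ j * (-1) ^+ i * bernoulli j * ('C(n.+1, j + i)%:R * 'C(j + i,
    j)%:R)); first by ring.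
  by rewrite e'; ring.
move: alt; rewrite big_ord_recr /= binn mulr1 => /eqP; rewrite addr_eq0 => /eqP ->.
have -> : - (-1) ^+ (n.+1 - j) = (-1) ^+ j * (-1) ^+ n :> rat.
  rewrite -exprD -mulN1r -exprS -signr_odd -[RHS]signr_odd; congr (_ ^+ _).
  by rewrite oddS oddB // oddD oddS; case: (odd n); case: (odd j).
by rewrite [X in _ * X = _]mulrA -expr2 sqrr_sign mul1r mulrC.
Qed.

(** For n > 1 the sum in [bernoulli_reflect] is B_n itself, whence
    B_n = - B_n when n is odd. *)
Lemma bernoulli_odd n : odd n -> (1 < n)%N -> bernoulli n = 0.
Proof.
move=> on n1; have := bernoulli_reflect n.
rewrite -signr_odd on expr1 mulN1r big_ord_recr /= binn mul1r.
case: n on n1 => // n on n1; rewrite bernoulli_rec.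
have -> : (n == 0)%N = false by case: n on n1.
by rewrite add0r => h; lra.
Qed.

Definition integral_at2 (x : rat) := exists (a : int) (b : nat), odd b /\ x * b%:R = a%:~R.

Lemma integral_at2D x y : integral_at2 x -> integral_at2 y -> integral_at2 (x + y).
Proof.
move=> [a [b [hb e]]] [a' [b' [hb' e']]]; exists (a * b' + a' * b), (b * b')%N.
rewrite oddM hb hb'; split=> //; rewrite rmorphD !rmorphM /= -e -e' ?natrM.
by rewrite -?pmulrn; ring.
Qed.
Lemma integral_at2M x y : integral_at2 x -> integral_at2 y -> integral_at2 (x * y).
Proof.
move=> [a [b [hb e]]] [a' [b' [hb' e']]]; exists (a * a'), (b * b')%N.
rewrite oddM hb hb'; split=> //; rewrite [RHS]rmorphM /= -e -e' ?natrM; ring.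
Qed.
Lemma integral_at2_int (a : int) : integral_at2 a%:~R.
Proof. by exists a, 1%N; rewrite mulr1. Qed.
Lemma integral_at2_nat (a : nat) : integral_at2 a%:R.
Proof. by exact: (integral_at2_int a). Qed.
Lemma integral_at2N x : integral_at2 x -> integral_at2 (- x).
Proof. by move=> h; rewrite -mulN1r; apply: integral_at2M => //;
  exact: (integral_at2_int (-1)). Qed.
Lemma integral_at2V b : odd b -> integral_at2 b%:R^-1.
Proof.
move=> hb; exists 1, b; split=> //.
by rewrite mulVf // Num.Theory.pnatr_eq0; case: b hb.
Qed.
Lemma integral_at2_sum n (F : 'I_n -> rat) : (forall i, integral_at2 (F i)) ->
  integral_at2 (\sum_i F i).
Proof. by move=> h; elim/big_rec: _ => [|i x _ hx];
  [exact: (integral_at2_nat 0)|exact: integral_at2D]. Qed.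
Lemma integral_at2_half : ~ integral_at2 (2^-1).
Proof.
move=> [a [b [hb e]]].
have /eqP : (b%:Z)%:~R = (2 * a)%:~R :> rat by rewrite rmorphM /= -e mulrA divff // mul1r.
rewrite eqr_int => /eqP h.
have : ~~ odd b by lia.
by rewrite hb.
Qed.

Lemma even_bin_sum n : \sum_(k < n.*2.+1) 'C(n.*2.+1, k)%:R * (~~ odd k)%:R = 2 ^+ n.*2 :> rat.
Proof.
set m := n.*2.+1.
have h1 : \sum_(k < m.+1) 'C(m, k)%:R = 2 ^+ m :> rat.
  rewrite (natrD _ 1 1) exprDn; apply: eq_bigr => k _.
  by rewrite !expr1n mul1r.
have h2 : \sum_(k < m.+1) (-1) ^+ k * 'C(m, k)%:R = 0 :> rat.
  transitivity ((1 - 1) ^+ m : rat); last by rewrite subrr expr0n.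
  by rewrite exprDn; apply: eq_bigr => k _; rewrite expr1n mul1r mulr_natr.
apply: (@mulfI _ 2) => //; rewrite -exprS.
have -> : 2 ^+ m = \sum_(k < m.+1) ('C(m, k)%:R + (-1) ^+ k * 'C(m, k)%:R) :> rat.
  by rewrite big_split /= h1 h2 addr0.
rewrite [RHS]big_ord_recr mulr_sumr [X in _ = _ + X](_ : _ = 0); last first.
  by rewrite /= binn -signr_odd /= odd_double expr1 mulr1 subrr.
rewrite addr0; apply: eq_bigr => k _ /=.
by rewrite -signr_odd; case: (odd k) => /=; rewrite ?expr1 ?expr0; ring.
Qed.

(** The prime 2 in the von Staudt-Clausen theorem.  In the recursion of index
    m = 2n+1 replace each even B_k by B_k - 1/2; what remains is half the sum of
    the even binomial coefficients of m, which is 2^(2n-1), corrected at k = 0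
    and k = 1. *)
Lemma bernoulli_even n : (0 < n)%N -> integral_at2 (bernoulli n.*2 - 2^-1).
Proof.
have [m] := ubnP n; elim: m n => // m IH n hn n0.
pose be k := bernoulli k - (~~ odd k)%:R / 2.
have hb k : (1 < k < n.*2)%N -> integral_at2 (be k).
  case/andP=> k1 k2; rewrite /be; case: (boolP (odd k)) => ok.
    by rewrite bernoulli_odd //= mul0r subr0; exact: (integral_at2_nat 0).
  by rewrite /= -(even_halfK ok) mul1r; apply: IH; have := even_halfK ok; lia.
have hn' : (n.*2.+1)%:R != 0 :> rat by rewrite Num.Theory.pnatr_eq0.
suff h : integral_at2 (n.*2.+1%:R * (bernoulli n.*2 - 2^-1)).
  rewrite -[X in integral_at2 X](mulKf hn'); apply: integral_at2M => //; apply: integral_at2V.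
  by rewrite /= odd_double.
have := bernoulli_rec n.*2.
have -> : (n.*2 == 0)%N = false by case: n n0 {hn hb hn'}.
have eB k : bernoulli k = be k + (~~ odd k)%:R / 2 by rewrite subrK.
under eq_bigr => k _ do rewrite eB mulrDr mulrA.
rewrite big_split /= -mulr_suml even_bin_sum big_ord_recr /= binSn.
have -> : bernoulli n.*2 - 2^-1 = be n.*2 by rewrite /be odd_double mul1r.
move/eqP; rewrite addrAC addr_eq0 => /eqP e.
have -> : n.*2.+1%:R * be n.*2 = - (\sum_(k < n.*2) 'C(n.*2.+1, k)%:R * be k + 2 ^+ n.*2 / 2).
  by rewrite e opprK.
apply: integral_at2N; apply: integral_at2D; last first.
  case: n n0 {hn hb hn' e} => // n _; rewrite doubleS !exprS mulrC mulKf //.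
  by apply: integral_at2M; [exact: (integral_at2_nat 2)|rewrite -natrX;
    exact: integral_at2_nat].
case: n n0 hb {hn hn' e} => // n _ hb.
rewrite doubleS !big_ord_recl /= addrA.
apply: integral_at2D; last first.
  by apply: integral_at2_sum => i; apply: integral_at2M;
    [exact: integral_at2_nat|apply: hb; have := ltn_ord i; rewrite /bump /=; lia].
have -> : 'C(n.*2.+3, 0)%:R * be 0%N + 'C(n.*2.+3, bump 0 0)%:R * be (bump 0 0) = - (n.+1)%:R.
  rewrite /bump /be /= bin0 bin1 (_ : bernoulli 0 = 1) //.
  have -> : bernoulli 1 = - 2^-1.
    have := bernoulli_rec 1; rewrite !big_ord_recl big_ord0 /= (_ : bernoulli 0 = 1) //.
    rewrite -[bump 0 0]/1%N -['C(2, 0)]/1%N -['C(2, 1)]/2%N.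
    by move: (bernoulli 1) => x h; lra.
  by rewrite -mul2n -!natr1 natrM; field.
by apply: integral_at2N; exact: integral_at2_nat.
Qed.

Lemma bernoulli_neq0 n : (0 < n)%N -> bernoulli n.*2 != 0.
Proof.
move=> /bernoulli_even h; apply/eqP => e; move: h; rewrite e sub0r => /integral_at2N.
by rewrite opprK; exact: integral_at2_half.
Qed.

(** * Evaluating series at sequences of points *)

Section PathEvaluation.
Variables (R : comNzRingType) (k : {rmorphism rat -> R}) (A : finType) (a b : A).
Implicit Types (u v : series A) (ys : seq R) (N : nat).

(** The sum over the words of length [N] of the form
    [a^i0 b a^i1 ... b a^ir], with [r.+1 = size ys], of their coefficient in [u]
    times [y_0^i0 ... y_r^ir]: an entry of the representation sending [a] to a
    diagonal matrix and [b] to a shift. *)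
Fixpoint path_eval N ys u : R :=
  if ys is y :: ys' then
    if N is N'.+1 then y * path_eval N' ys (shift a u) + path_eval N' ys' (shift b u)
    else if ys' is [::] then k (u [::]) else 0
  else 0.

Local Notation ev := path_eval.

Lemma ev_nil N u : ev N [::] u = 0. Proof. by case: N. Qed.

Lemma evS N y ys u :
  ev N.+1 (y :: ys) u = y * ev N (y :: ys) (shift a u) + ev N ys (shift b u).
Proof. by []. Qed.

Lemma ev0 y ys u : ev 0 (y :: ys) u = (if ys is [::] then k (u [::]) else 0).
Proof. by []. Qed.

Lemma ev_lin (c : rat) N ys u v :
  ev N ys (c *: u + v) = k c * ev N ys u + ev N ys v.
Proof.
elim: N ys u v => [|N IH] [|y ys] u v; rewrite ?ev_nil ?mulr0 ?addr0 //.
  by case: ys => [|? ?]; rewrite /= ?mulr0 ?addr0 // seriesD seriesZ rmorphD rmorphM.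
rewrite !evS.
have sl c' : shift c' (c *: u + v) = c *: shift c' u + shift c' v by [].
rewrite !sl !IH; ring.
Qed.
Lemma evD N ys u v : ev N ys (u + v) = ev N ys u + ev N ys v.
Proof. by rewrite -[u in LHS]scale1r ev_lin rmorph1 mul1r. Qed.
Lemma ev_0 N ys : ev N ys 0 = 0.
Proof. by apply: (addrI (ev N ys 0)); rewrite -evD !addr0. Qed.
Lemma evZ c N ys u : ev N ys (c *: u) = k c * ev N ys u.
Proof. by rewrite -[c *: u]addr0 ev_lin ev_0 addr0. Qed.
Lemma evN N ys u : ev N ys (- u) = - ev N ys u.
Proof. by rewrite -scaleN1r evZ rmorphN1 mulN1r. Qed.
Lemma evB N ys u v : ev N ys (u - v) = ev N ys u - ev N ys v.
Proof. by rewrite evD evN. Qed.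
Lemma ev_sum (I : Type) (r : seq I) (P : pred I) (F : I -> series A) N ys :
  ev N ys (\sum_(i <- r | P i) F i) = \sum_(i <- r | P i) ev N ys (F i).
Proof. by elim/big_rec2: _ => [|i x y _ <-]; rewrite ?ev_0 ?evD. Qed.

(** Cauchy product of sequences: lengths add up in a product of words. *)
Definition conv (f g : nat -> R) (N : nat) : R :=
  \sum_(i < N.+1) f i * g (N - i)%N.

Lemma convS f g N :
  conv f g N.+1 = f 0%N * g N.+1 + conv (fun i => f i.+1) g N.
Proof. by rewrite /conv big_ord_recl subn0; congr (_ + _). Qed.

Lemma convC f g : conv f g =1 conv g f.
Proof.
move=> N; rewrite /conv (reindex_inj rev_ord_inj) /=; apply: eq_bigr => i _.
by rewrite mulrC subSS subKn // -ltnS.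
Qed.
Lemma eq_conv f f' g g' N : f =1 f' -> g =1 g' -> conv f g N = conv f' g' N.
Proof. by move=> e e'; apply: eq_bigr => i _; rewrite e e'. Qed.
Lemma conv_linl c f f' g N :
  conv (fun i => c * f i + f' i) g N = c * conv f g N + conv f' g N.
Proof.
rewrite /conv mulr_sumr -big_split /=; apply: eq_bigr => i _; ring.
Qed.
Lemma conv_pick f g i N : (forall j, j != i -> f j = 0) ->
  conv f g (i + N) = f i * g N.
Proof.
move=> h; have hi : (i < (i + N).+1)%N by rewrite ltnS leq_addr.
rewrite /conv (bigD1 (Ordinal hi)) //= addKn big1 ?addr0 // => j /negP hj.
by rewrite h ?mul0r //; apply/eqP => e; apply: hj; apply/eqP/val_inj.
Qed.

(** A factorisation of a word cuts its sequence of points at a point which both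
    factors share. *)
Lemma evM N ys u v :
  ev N ys (u * v) =
  \sum_(i < size ys)
    conv (fun n => ev n (take i.+1 ys) u) (fun n => ev n (drop i ys) v) N.
Proof.
have sM c u' v' : shift c (u' * v') = u' [::] *: shift c v' + shift c u' * v'.
  by apply/funext => w; rewrite /shift seriesM_cons.
elim: N ys u v => [|N IH] [|y ys] u v; rewrite ?ev_nil ?big_ord0 //.
  rewrite big_ord_recl /= /conv big_ord1 /= take0 big1 => [|i _].
    by rewrite addr0; case: ys => [|? ?]; rewrite ?mulr0 //= seriesM_nil rmorphM.
  rewrite big_ord1 /=.
  by case: ys i => [[]|z ys i] //=; rewrite mul0r.
rewrite evS !sM !ev_lin !IH.
rewrite [RHS](big_ord_recl (size ys)) [in RHS]/= take0 convS.
have e1 i : ev i.+1 [:: y] u = y * ev i [:: y] (shift a u) + 0.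
  by rewrite evS ev_nil.
rewrite (eq_conv N e1 (frefl _)) conv_linl.
rewrite [X in y * (_ + X)](big_ord_recl (size ys)) [in X in y * X]/= take0.
have e2 (i : 'I_(size ys)) :
   conv (fun n => ev n (take (lift ord0 i).+1 (y :: ys)) u)
        (fun n => ev n (drop (lift ord0 i) (y :: ys)) v) N.+1 =
   y * conv (fun n => ev n (y :: take i.+1 ys) (shift a u)) (fun n => ev n (drop i ys) v) N +
   conv (fun n => ev n (take i.+1 ys) (shift b u)) (fun n => ev n (drop i ys) v) N.
  rewrite convS /= -conv_linl.
  case: ys i => [[]//|z ys] i /=; rewrite mul0r add0r.
  by apply: eq_conv.
rewrite (eq_bigr _ (fun i _ => e2 i)) big_split /= -mulr_sumr.
have -> : conv (fun=> 0) (fun n => ev n (y :: ys) v) N = 0.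
  by rewrite /conv big1 // => i _; rewrite mul0r.
rewrite -/(ev N (y :: ys) (shift a v)).
ring.
Qed.

Local Notation evs ys u := (fun n => ev n ys u).

Lemma ev2M N y0 y1 u v :
  ev N [:: y0; y1] (u * v) =
    conv (evs [:: y0] u) (evs [:: y0; y1] v) N
    + conv (evs [:: y0; y1] u) (evs [:: y1] v) N.
Proof. by rewrite evM !big_ord_recl big_ord0 addr0. Qed.
Lemma ev3M N y0 y1 y2 u v :
  ev N [:: y0; y1; y2] (u * v) =
    conv (evs [:: y0] u) (evs [:: y0; y1; y2] v) N
    + (conv (evs [:: y0; y1] u) (evs [:: y1; y2] v) N
    + conv (evs [:: y0; y1; y2] u) (evs [:: y2] v) N).
Proof. by rewrite evM !big_ord_recl big_ord0 addr0. Qed.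
Lemma ev4M N y0 y1 y2 y3 u v :
  ev N [:: y0; y1; y2; y3] (u * v) =
    conv (evs [:: y0] u) (evs [:: y0; y1; y2; y3] v) N
    + (conv (evs [:: y0; y1] u) (evs [:: y1; y2; y3] v) N
    + (conv (evs [:: y0; y1; y2] u) (evs [:: y2; y3] v) N
    + conv (evs [:: y0; y1; y2; y3] u) (evs [:: y3] v) N)).
Proof. by rewrite evM !big_ord_recl big_ord0 addr0. Qed.

Hypothesis neq_ab : a != b.

Lemma ev_supp N ys u :
  (forall w, count_mem b w = (size ys).-1 ->
     (count_mem a w + count_mem b w)%N = N -> size w = N -> u w = 0) ->
  ev N ys u = 0.
Proof.
elim: N ys u => [|N IH] [|y ys] u h; rewrite ?ev_nil //.
  by case: ys h => [h|//]; rewrite ev0 h ?rmorph0.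
have nba : (b == a) = false by rewrite eq_sym (negbTE neq_ab).
rewrite evS IH => [|w h1 h2 h3].
  rewrite mulr0 add0r; case: ys h => [_|z ys h]; first by rewrite ev_nil.
  apply: IH => w h1 h2 h3.
  by apply: h; rewrite /= ?eqxx ?nba ?h1 ?h3 // -h2 h1 add0n add1n addnS.
by apply: h; rewrite /= ?eqxx ?(negbTE neq_ab) ?h1 ?h3 // -h2 h1 add0n add1n addSn.
Qed.

Lemma ev_homog m N ys u : letter_homog a m u -> (0 < size ys)%N ->
  N != (m + (size ys).-1)%N -> ev N ys u = 0.
Proof.
move=> hu hs hN; apply: ev_supp => w h1 h2 _.
apply: contrapT => /hu h3; case/eqP: hN.
by rewrite -h2 h1 h3.
Qed.

(** The length is the one of a word with [m] letters [a] and [(size ys).-1]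
    letters [b].  For a series homogeneous in [a] this is the only length that
    contributes, and no index has to be summed over in products. *)
Definition path_evald m ys u : R := ev (m + (size ys).-1) ys u.

Local Notation E := path_evald.

Lemma path_evaldM_l m m' ys u v : letter_homog a m u ->
  E (m + m') ys (u * v) =
  \sum_(i < size ys) E m (take i.+1 ys) u * E m' (drop i ys) v.
Proof.
move=> hu; rewrite /path_evald evM; apply: eq_bigr => i _.
have hi := ltn_ord i.
have st : size (take i.+1 ys) = i.+1 by rewrite size_takel.
have -> : (m + m' + (size ys).-1 = (m + i) + (m' + (size (drop i ys)).-1))%N.
  by rewrite size_drop; lia.
rewrite conv_pick ?st // => j hj; apply: (ev_homog hu); rewrite st //.
Qed.
Lemma path_evaldM_r m m' ys u v : letter_homog a m v ->
  E (m' + m) ys (u * v) =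
  \sum_(i < size ys) E m' (take i.+1 ys) u * E m (drop i ys) v.
Proof.
move=> hu; rewrite /path_evald evM; apply: eq_bigr => i _.
have hi := ltn_ord i.
have st : size (take i.+1 ys) = i.+1 by rewrite size_takel.
have -> : (m' + m + (size ys).-1 = (m + (size (drop i ys)).-1) + (m' + i))%N.
  by rewrite size_drop; lia.
rewrite convC conv_pick ?st 1?mulrC // => j hj; apply: (ev_homog hu) => //.
by rewrite size_drop; lia.
Qed.

Lemma ev_len m N ys u : len_homog m u -> N != m -> ev N ys u = 0.
Proof.
move=> hu hN; apply: ev_supp => w _ _ h3.
by apply: contrapT => /hu h4; case/eqP: hN; rewrite -h3 h4.
Qed.
Lemma evM_len m m' ys u v : len_homog m u ->
  ev (m + m') ys (u * v) =
  \sum_(i < size ys) ev m (take i.+1 ys) u * ev m' (drop i ys) v.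
Proof.
move=> hu; rewrite evM; apply: eq_bigr => i _.
by rewrite conv_pick // => j; apply: ev_len.
Qed.

Lemma ev1 N y u : ev N [:: y] u = y ^+ N * k (u (nseq N a)).
Proof.
elim: N u => [|N IH] u; first by rewrite ev0 mul1r.
by rewrite evS IH ev_nil addr0 exprS mulrA.
Qed.

Lemma ev_gena N y ys : ev N (y :: ys) (genS a) = if ys is [::] then y *+ (N == 1%N) else 0.
Proof.
have z M zs : ev M zs (shift b (genS a)) = 0.
  apply: ev_supp => w _ _ _; rewrite /shift /genS eqseq_cons eq_sym.
  by rewrite (negbTE neq_ab).
case: N => [|N]; first by rewrite ev0; case: ys => // ; rewrite rmorph0.
have e1 : shift a (genS a) = 1.
  by apply/funext => w; rewrite /shift /genS eqseq_cons eqxx series1.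
rewrite evS z addr0 e1; case: N => [|N]; first by case: ys => [|? ?];
  rewrite ev0 ?mulr0 // rmorph1 mulr1.
rewrite ev_supp ?mulr0 => [|w _ _]; first by case: ys.
by rewrite series1; case: w.
Qed.
Lemma ev_genb N ys : ev N ys (genS b) = ((N == 1%N) && (size ys == 2%N))%:R.
Proof.
have nba : (b == a) = false by rewrite eq_sym (negbTE neq_ab).
have z M zs : ev M zs (shift a (genS b)) = 0.
  by apply: ev_supp => w _ _ _; rewrite /shift /genS eqseq_cons (negbTE neq_ab).
case: ys => [|y ys]; first by rewrite ev_nil andbF.
case: N => [|N]; first by rewrite ev0; case: ys => // ; rewrite rmorph0.
have e1 : shift b (genS b) = 1.
  by apply/funext => w; rewrite /shift /genS eqseq_cons eqxx series1.
rewrite evS z mulr0 add0r e1; case: N => [|N].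
  by case: ys => [|? [|? ?]] //; rewrite ev0 rmorph1.
by rewrite ev_supp // => w _ _; rewrite series1; case: w.
Qed.

(** A commutator vanishes in the commutative algebra of power series in [a]. *)
Lemma free_lie_nseq u n : free_lie u -> u (nseq n.+2 a) = 0.
Proof.
elim=> [c||c u' v' _ hu _ hv|u' v' _ hu _ hv] //.
- by rewrite /genS /=; case: n => [|n]; rewrite eqseq_cons andbF.
- by rewrite seriesD seriesZ hu hv mulr0 addr0.
have e i : (i <= n.+2)%N -> (take i (nseq n.+2 a) = nseq i a) * (drop i (nseq n.+2 a) =
  nseq (n.+2 - i) a).
  by move=> hi; rewrite take_nseq // drop_nseq.
rewrite /com seriesB !seriesM size_nseq [X in _ - X](reindex_inj rev_ord_inj) /=.
apply/eqP; rewrite subr_eq0; apply/eqP; apply: eq_bigr => i _.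
have hi : (i <= n.+2)%N by rewrite -ltnS.
have hi' : (n.+3 - i.+1 <= n.+2)%N by rewrite subSS leq_subr.
by rewrite !(e _ hi) !(e _ hi') mulrC subSS subKn.
Qed.
Lemma free_liec_nseq u n : free_liec u -> u (nseq n.+2 a) = 0.
Proof.
move=> /(_ n.+3) [v hv h].
have := h (nseq n.+2 a); rewrite size_nseq seriesB (free_lie_nseq n hv) subr0.
by apply.
Qed.

Lemma ev1_lie u N y : free_liec u -> N != 1%N -> ev N [:: y] u = 0.
Proof.
move=> hu; rewrite ev1; case: N => [|[//|N]] _.
  by rewrite (free_liec_ord1 hu) // rmorph0 mulr0.
by rewrite free_liec_nseq // rmorph0 mulr0.
Qed.

Lemma conv1_lie u f N y : free_liec u -> conv (evs [:: y] u) f N.+1 = y * k (u [:: a]) * f N.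
Proof.
move=> hu; rewrite -add1n conv_pick ?ev1 ?expr1 // => j hj; exact: ev1_lie.
Qed.
Lemma conv1_lie0 u f y : free_liec u -> conv (evs [:: y] u) f 0 = 0.
Proof.
by move=> hu; rewrite /conv big_ord1 ev1_lie ?mul0r.
Qed.

(** Translating the points adds a scalar matrix to the image of [a], which
    commutators do not see.  In a commutator only the two extreme cuts involve
    single points, and their contributions cancel. *)
Lemma free_lie_translate t u : free_lie u ->
  [/\ forall N y0 y1, ev N [:: y0 + t; y1 + t] u = ev N [:: y0; y1] u,
      forall N y0 y1 y2, ev N [:: y0 + t; y1 + t; y2 + t] u = ev N [:: y0; y1; y2] u
    & forall N y0 y1 y2 y3,
        ev N [:: y0 + t; y1 + t; y2 + t; y3 + t] u = ev N [:: y0; y1; y2; y3] u].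
Proof.
elim=> [c||c u' v' _ [h2 h3 h4] _ [i2 i3 i4]|u' v' fu [h2 h3 h4] fv [i2 i3 i4]].
- have [->|ca] := eqVneq c a; first by split=> *; rewrite !ev_gena.
  have [->|cb] := eqVneq c b; first by split=> *; rewrite !ev_genb.
  have z N ys : ev N ys (genS c) = 0.
    apply: ev_supp => w; rewrite /genS; case: eqP => [->|//] /=.
    by rewrite (negbTE ca) (negbTE cb) => _ <-.
  by split=> *; rewrite !z.
- by split=> *; rewrite !ev_0.
- by split=> *; rewrite !ev_lin ?h2 ?i2 ?h3 ?i3 ?h4 ?i4.
have lu := free_lie_liec fu; have lv := free_lie_liec fv.
have e22 N y0 y1 z0 z1 := (eq_conv N (fun n => h2 n y0 y1) (fun n => i2 n z0 z1)).
have e22' N y0 y1 z0 z1 := (eq_conv N (fun n => i2 n y0 y1) (fun n => h2 n z0 z1)).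
have e23 N y0 y1 z0 z1 z2 := (eq_conv N (fun n => h2 n y0 y1) (fun n => i3 n z0 z1 z2)).
have e23' N y0 y1 z0 z1 z2 := (eq_conv N (fun n => i2 n y0 y1) (fun n => h3 n z0 z1 z2)).
have e32 N y0 y1 y2 z0 z1 := (eq_conv N (fun n => h3 n y0 y1 y2) (fun n => i2 n z0 z1)).
have e32' N y0 y1 y2 z0 z1 := (eq_conv N (fun n => i3 n y0 y1 y2) (fun n => h2 n z0 z1)).
split=> -[|N] *; rewrite /com !evB ?ev2M ?ev3M ?ev4M.
all: rewrite ?(convC _ (evs [:: _] u')) ?(convC _ (evs [:: _] v')).
all: rewrite ?conv1_lie0 ?conv1_lie //.
all: rewrite ?h2 ?h3 ?h4 ?i2 ?i3 ?i4.
all: rewrite ?e22 ?e22' ?e23 ?e23' ?e32 ?e32'; ring.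
Qed.

End PathEvaluation.

Lemma ev_rmorph (R S : comNzRingType) (k : {rmorphism rat -> R})
    (l : {rmorphism rat -> S}) (f : {rmorphism R -> S}) (A : finType) (a b : A)
    N ys (u : series A) : (forall q, f (k q) = l q) ->
  f (path_eval k a b N ys u) = path_eval l a b N (map f ys) u.
Proof.
move=> h; elim: N ys u => [|N IH] [|y ys] u; rewrite ?ev_nil ?rmorph0 //.
  by case: ys => [|z ys]; rewrite !ev0 ?rmorph0.
by rewrite /= !rmorphD rmorphM !IH.
Qed.

(** * Evaluation at independent variables *)

Section Coefficients.
Variables (n : nat) (A : finType) (a b : A).
Implicit Types (vs : seq 'I_n) (m : 'X_{1..n}) (u : series A).

Let C : {rmorphism rat -> {mpoly rat[n]}} := @mpolyC n rat.

(** The word whose evaluation at the variables [vs] is the monomial [m]. *)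
Fixpoint path_word vs m : seq A :=
  if vs is v :: vs' then
    nseq (m v) a ++ (if vs' is [::] then [::] else b :: path_word vs' m)
  else [::].

Lemma path_word_cons v vs m :
  path_word (v :: vs) m = nseq (m v) a ++ (if vs is [::] then [::] else b :: path_word vs m).
Proof. by []. Qed.

Lemma eq_path_word vs m m' : {in vs, m =1 m'} -> path_word vs m = path_word vs m'.
Proof.
elim: vs => // v vs IH h; rewrite !path_word_cons h ?mem_head // IH // => i hi.
by apply: h; rewrite inE hi orbT.
Qed.

Lemma ev_coef N vs m u : uniq vs ->
  (path_eval C a b N [seq 'X_v | v <- vs] u)@_m =
  ([forall i, (i \notin vs) ==> (m i == 0%N)] && (size (path_word vs m) == N))%:R
    * (if vs is [::] then 0 else u (path_word vs m)).
Proof.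
elim: N vs m u => [|N IH] [|v vs] m u; rewrite ?ev_nil ?mcoeff0 ?mulr0 //.
  move=> _; have -> : path_eval C a b 0 [seq 'X_v0 | v0 <- v :: vs] u =
     if vs is [::] then (u [::])%:MP else 0 by case: vs.
  case: vs => [|v' vs]; last first.
    by rewrite mcoeff0 path_word_cons size_cat addnS andbF mul0r.
  rewrite mcoeffC path_word_cons cats0 size_nseq.
  case: (boolP (m v == 0%N)) => [/eqP e|e]; last first.
    rewrite andbF mul0r; case: eqP => [h|]; last by rewrite mulr0.
    by move: e; rewrite h mnm0E.
  rewrite e /= andbT mulrC; congr (_%:R * _); congr nat_of_bool.
  apply/eqP/forallP => [-> i|h]; first by rewrite mnm0E eqxx implybT.
  apply/mnmP => i; rewrite mnm0E; have := h i; rewrite inE.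
  by case: eqP => [-> _|_ /eqP].
move=> /= /andP[nv uv].
rewrite mcoeffD mulrC.
have IH1 := fun m u => IH (v :: vs) m u; rewrite /= nv uv in IH1.
have [e0|e0] := posnP (m v); last first.
  have [m' em] : exists m', m = (U_(v) + m')%MM.
    exists (m - U_(v))%MM; rewrite addmC submK //; apply/mnm_lepP => i.
    by rewrite mnm1E; case: eqP => [<-|].
  rewrite em mcoeffMX IH1 // IH // [X in _ + X](_ : _ = 0) ?addr0; last first.
    case: forallP => [/(_ v)|]; last by rewrite mul0r.
    by rewrite nv mnmDE mnm1E eqxx.
  have -> : path_word vs (U_(v) + m') = path_word vs m'.
    apply: eq_path_word => i hi; rewrite mnmDE mnm1E; case: eqP => [e|//].
    by rewrite e hi in nv.
  rewrite mnmDE mnm1E eqxx add1n /= eqSS; congr (_ * _); congr (_%:R).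
  congr (nat_of_bool (_ && _)); apply: eq_forallb => i; rewrite inE negb_or.
  by rewrite mnmDE mnm1E eq_sym; case: eqP.
have -> : (path_eval C a b N ('X_v :: [seq 'X_v | v <- vs]) (shift a u) * 'X_v)@_m = 0.
  apply/eqP; rewrite mcoeff_eq0 (perm_mem (msuppMX _ _)).
  by apply/mapP => -[m' _ e]; move: e0; rewrite e mnmDE mnm1E eqxx.
rewrite add0r IH // e0 /= {IH1}; case: vs nv uv => [|v' vs] nv uv;
  first by rewrite mulr0 andbF mul0r.
rewrite /= eqSS; congr (_ * _); congr (_%:R).
congr (nat_of_bool (_ && _)); apply: eq_forallb => i; rewrite !inE.
by have [->|] := eqVneq i v; rewrite ?e0 ?eqxx ?implybT.
Qed.

End Coefficients.

Section Words.
Variables (n : nat) (A : finType) (a b : A).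
Hypothesis cover : forall c, c = a \/ c = b.
Hypothesis neq_ab : a != b.
Implicit Types (vs : seq 'I_n) (m : 'X_{1..n}) (u : series A).

Lemma path_word_surj vs w : uniq vs -> size vs = (count_mem b w).+1 ->
  exists2 m : 'X_{1..n}, path_word a b vs m = w & forall i, i \notin vs -> m i = 0%N.
Proof.
elim: w vs => [|c w IH] [|v vs] //= /andP[nv uv].
  by case: vs {nv uv} => // _; exists 0%MM => [|i _]; rewrite mnm0E.
have [->|->] := cover c.
  rewrite (negbTE neq_ab) add0n => hs; have [|m e h] := IH (v :: vs) _ hs.
    by rewrite /= nv.
  exists (U_(v) + m)%MM => [|i hi].
    rewrite mnmDE mnm1E eqxx add1n /= -e /=; congr (_ :: _ ++ _).
    case: vs nv {uv hs e h} => // v' vs nv; congr (_ :: _); apply: eq_path_word => i hi.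
    by rewrite mnmDE mnm1E; case: eqP => // e; rewrite e hi in nv.
  rewrite mnmDE h // mnm1E; case: eqP hi => [->|//]; by rewrite inE eqxx.
rewrite eqxx add1n => -[] hs; have [m e h] := IH vs uv hs.
exists m => [|i]; last by rewrite inE negb_or => /andP[_ /h].
by rewrite h // e; case: vs hs {nv uv e h} => [|v' vs].
Qed.

Lemma ev_eq0_coef vs N u w : uniq vs ->
  path_eval (@mpolyC n rat) a b N [seq 'X_v | v <- vs] u = 0 ->
  size w = N -> size vs = (count_mem b w).+1 -> u w = 0.
Proof.
move=> uv h hN hs; have [m e hm] := path_word_surj uv hs.
have := ev_coef a b N m u uv; rewrite h mcoeff0 e hN eqxx andbT.
have -> : [forall i, (i \notin vs) ==> (m i == 0%N)].
  by apply/forallP => i; apply/implyP => /hm ->.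
by rewrite mul1r; case: vs hs {uv h e hm}.
Qed.

End Words.

Lemma X01 : X0 != X1. Proof. by []. Qed.
Lemma Lab : La != Lb. Proof. by []. Qed.
Lemma cover_ab c : c = La \/ c = Lb. Proof. by case: c; [left|right]. Qed.

Lemma depth_wordE r (m : 'X_{1..r.+1}) :
  depth_word m = path_word X0 X1 (enum 'I_r.+1) m.
Proof.
rewrite enum_ordSl path_word_cons /depth_word; congr (_ ++ _).
elim: (enum 'I_r) => [//|j s IH]; by rewrite /= IH.
Qed.

(** Both sides have the same coefficients, by [ev_coef] with all the variables. *)
Lemma depth_poly_ev r N u (p : {mpoly rat[r.+1]}) :
  len_homog N u -> is_depth_poly u p ->
  p = path_eval (@mpolyC r.+1 rat) X0 X1 N [seq 'X_v | v <- enum 'I_r.+1] u.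
Proof.
move=> hu hp; apply/mpolyP => m; rewrite hp ev_coef ?enum_uniq // depth_wordE.
have -> : [forall i, (i \notin enum 'I_r.+1) ==> (m i == 0%N)].
  by apply/forallP => i; rewrite mem_enum.
rewrite /=; case: eqP => [_|h]; first by rewrite mul1r enum_ordSl.
by rewrite mul0r; apply: contrapT => /hu.
Qed.

Lemma ev_translate (R : comNzRingType) (k : {rmorphism rat -> R}) (A : finType)
    (a b : A) N ys t u : a != b -> free_lie u -> (1 < size ys <= 4)%N ->
  path_eval k a b N [seq y + t | y <- ys] u = path_eval k a b N ys u.
Proof.
move=> ab fu; have [h2 h3 h4] := free_lie_translate k ab t fu.
by case: ys => [|? [|? [|? [|? []]]]] //= _; rewrite ?h2 ?h3 ?h4.
Qed.

(** Setting [y_0] to [0] and then substituting differences amounts to a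
    translation of the points by [- y_0]. *)
Lemma reduced_ev r N (u : flie xlet) (p : {mpoly rat[r.+1]}) :
  (0 < r <= 3)%N -> len_homog N u -> is_depth_poly u p ->
  rf_of_reduced (reduced p) = p%:F.
Proof.
move=> hr hu hp; rewrite /rf_of_reduced; congr (_%:F).
have ep := depth_poly_ev hu hp.
rewrite /reduced {1}ep.
pose t1 := [tuple (if unlift ord0 i is Some j then 'X_j else 0 : {mpoly rat[r]}) | i < r.+1].
pose t2 := [tuple 'X_(lift ord0 j) - 'X_ord0 : {mpoly rat[r.+1]} | j < r].
rewrite -/t1 -/t2.
rewrite (@ev_rmorph _ _ (@mpolyC r.+1 rat) (@mpolyC r rat) (comp_mpoly t1)); last first.
  by move=> q; exact: comp_mpolyC.
rewrite (@ev_rmorph _ _ (@mpolyC r rat) (@mpolyC r.+1 rat) (comp_mpoly t2)); last first.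
  by move=> q; exact: comp_mpolyC.
have -> : [seq comp_mpoly t2 q | q <- [seq comp_mpoly t1 q | q <- [seq 'X_v | v <- enum
  'I_r.+1]]]
   = [seq y - 'X_ord0 | y <- [seq 'X_v | v <- enum 'I_r.+1]].
  rewrite -!map_comp; apply: eq_map => i /=.
  rewrite comp_mpolyXU -tnth_nth tnth_mktuple; case: unliftP => [j ->|->].
    by rewrite comp_mpolyXU -tnth_nth tnth_mktuple.
  by rewrite comp_mpoly0 subrr.
rewrite ev_translate // ?ep //; first exact: flieP.
by rewrite size_map size_enum_ord.
Qed.

Definition rat3 : {rmorphism rat -> ratfun 3} :=
  (@FracField.tofrac _ \o @mpolyC 4 rat)%FUN.

Definition ycoord (i : nat) : ratfun 3 := ('X_(inord i))%:F.

(** [f] at the coordinates of indices [s] among four independent variables; the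
    whole proof takes place in the field of rational functions of these. *)
Definition rf_at r (f : ratfun r) (s : seq nat) : ratfun 3 :=
  rf_ren (fun k : 'I_r.+1 => inord (nth 0%N s k)) f.

Definition distinct_pts r (s : seq nat) := [&& uniq s, all (ltn^~ 4%N) s & size s == r.+1].

Lemma nth_inj r s : distinct_pts r s ->
  injective (fun k : 'I_r.+1 => inord (nth 0%N s k) : 'I_4).
Proof.
case/and3P=> us /allP hs /eqP es i j /(congr1 val) /=.
have hn (k : 'I_r.+1) : (nth 0%N s k < 4)%N by apply/hs/mem_nth; rewrite es.
by rewrite !inordK // => /eqP; rewrite nth_uniq ?es // => /eqP /val_inj.
Qed.

(** This turns the hypotheses on the depth components of i(sigma) into values of
    the Lie series. *)
Lemma reduced_rf_at r N (u : flie xlet) (f : ratfun r) s :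
  (0 < r <= 3)%N -> len_homog N u -> reduced_in_depth u f -> distinct_pts r s ->
  path_eval rat3 X0 X1 N [seq ycoord i | i <- s] u = rf_at f s.
Proof.
move=> hr hu [p hp <-] hs; rewrite (reduced_ev hr hu hp) /rf_at.
rewrite -[p%:F]divr1 -(rmorph1 (@FracField.tofrac _)) rf_renE ?oner_neq0 //;
  last exact: nth_inj.
rewrite /mp_ren rmorph1 /= rmorph1 divr1 (depth_poly_ev hu hp).
rewrite (@ev_rmorph _ _ (@mpolyC r.+1 rat) (@mpolyC 4 rat) (comp_mpoly _)); last first.
  by move=> q; exact: comp_mpolyC.
rewrite (@ev_rmorph _ _ (@mpolyC 4 rat) rat3 (@FracField.tofrac _)) //.
congr path_eval; set e := enum _; have se : size e = r.+1 by rewrite size_enum_ord.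
have ne i : (i < r.+1)%N -> nth ord0 e i = i :> nat by exact: nth_enum_ord.
move: e se ne => e se ne; rewrite -!map_comp.
case/and3P: hs => _ _ /eqP es.
apply: (@eq_from_nth _ 0) => [|i hi]; first by rewrite !size_map se es.
rewrite size_map in hi.
rewrite (nth_map 0%N) // (nth_map ord0) ?se -?es //= comp_mpolyXU.
by rewrite -tnth_nth tnth_mktuple ne -?es //.
Qed.

(** Distinct words of the same length and the same number of letters [b] have
    distinct monomials as evaluations at independent variables. *)
Lemma path_eval_eq0 (A : finType) (a b : A) N s (u : series A) w :
  (forall c, c = a \/ c = b) -> a != b ->
  distinct_pts (count_mem b w) s -> size w = N ->
  path_eval rat3 a b N [seq ycoord i | i <- s] u = 0 -> u w = 0.
Proof.
move=> hc hab /and3P[us /allP hs /eqP es] hN h.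
pose vs : seq 'I_4 := [seq inord i | i <- s].
apply: (@ev_eq0_coef 4 _ a b hc hab vs N u) => //; last by rewrite size_map.
  rewrite map_inj_in_uniq // => i j /hs hi /hs hj /(congr1 val) /=.
  by rewrite !inordK.
apply/eqP; rewrite -(@tofrac_eq0 {mpoly rat[4]}); apply/eqP.
rewrite (@ev_rmorph _ _ (@mpolyC 4 rat) rat3 (@FracField.tofrac _)) //.
by rewrite -!map_comp.
Qed.

Lemma ycoord_inj i j : (i < 4)%N -> (j < 4)%N -> (ycoord i == ycoord j) = (i == j).
Proof.
move=> hi hj; rewrite /ycoord tofrac_eq; apply/eqP/eqP => [|-> //].
move/(congr1 (fun p : {mpoly rat[4]} => p@_U_(inord i))).
rewrite !mcoeffX eqxx; case: eqP => // h _.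
have := congr1 (fun m : 'X_{1..4} => m (inord i)) h; rewrite !mnm1E eqxx.
by case: eqP => // /(congr1 val); rewrite /= !inordK.
Qed.

(** * Evaluation of the image of phi *)

Arguments path_eval : simpl never.
#[global] Hint Resolve Lab X01 : core.

Section HomRec.
Variables (A B : finType) (s : A -> fliec B).

Let homN_stable n u w : (size w <= n)%N -> homN s n u w = homS s u w.
Proof.
have H m p v x : (size x <= m)%N -> (size x <= p)%N -> homN s m v x = homN s p v x.
  have e1 v' x' : size x' = 0%N -> forall m, homN s m v' x' = v' [::].
    case: x' => // _ [|m'] /=; rewrite !seriesE series1 mulr1 ?addr0 //.
    rewrite big1 ?addr0 // => c _; rewrite seriesM_nil.
    by rewrite (free_liec_ord1 (fliecP (s c))) ?mul0r.
  elim: m p v x => [|m IH] p v x hm hp.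
    by move: hm; rewrite leqn0 => /eqP hx; rewrite !e1.
  case: p hp => [|p] hp; first by move: hp; rewrite leqn0 => /eqP hx; rewrite !e1.
  rewrite /= !seriesD; congr (_ + _); rewrite !series_sum; apply: eq_bigr => c _.
  rewrite !seriesM; apply: eq_bigr => i _.
  case: (posnP i) => [->|i0].
    by rewrite take0 (free_liec_ord1 (fliecP (s c))) ?mul0r.
  congr (_ * _); apply: IH; rewrite size_drop; lia.
by move=> hw; apply: H.
Qed.

(** A series is its constant term plus the sum of the letters times its shifts,
    and [homS] is a continuous homomorphism. *)
Lemma homS_rec u :
  homS s u = (u [::])%:A + \sum_c (s c : series B) * homS s (shift c u).
Proof.
apply/funext => w; rewrite -(@homN_stable (size w).+1) //= !seriesD; congr (_ + _).
rewrite !series_sum; apply: eq_bigr => c _; rewrite !seriesM; apply: eq_bigr => i _.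
case: (posnP i) => [->|i0].
  by rewrite take0 (free_liec_ord1 (fliecP (s c))) ?mul0r.
by congr (_ * _); apply: homN_stable; rewrite size_drop; lia.
Qed.

End HomRec.

Section Letters.
Variables (R : comNzRingType) (k : {rmorphism rat -> R}) (A : finType) (a b : A).
Hypothesis neq_ab : a != b.
Implicit Types (u v : series A) (ys : seq R) (N : nat).
Local Notation ev := (path_eval k a b).

Lemma eq_ev N ys u v : (forall w, size w = N -> u w = v w) -> ev N ys u = ev N ys v.
Proof.
move=> h; apply/eqP; rewrite -subr_eq0 -evB; apply/eqP/ev_supp => // w _ _ e.
by rewrite seriesB h // subrr.
Qed.

Lemma shift_genM c d u : shift c (genS d * u) = (c == d)%:R *: u.
Proof.
apply/funext => w; rewrite /shift seriesM_cons /genS mul0r add0r seriesZ.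
have -> : shift c (fun s : seq A => (s == [:: d])%:R) = (c == d)%:R *: (1 : series A).
  by apply/funext => x; rewrite seriesZ series1 /shift eqseq_cons; case: eqP;
    rewrite ?mul1r ?mul0r.
by rewrite -scalerAl mul1r.
Qed.
Lemma ev_ma N y ys u : ev N.+1 (y :: ys) (genS a * u) = y * ev N (y :: ys) u.
Proof.
by rewrite evS !shift_genM eqxx eq_sym (negbTE neq_ab) scale0r scale1r ev_0 addr0.
Qed.
Lemma ev_mb N y ys u : ev N.+1 (y :: ys) (genS b * u) = ev N ys u.
Proof.
by rewrite evS !shift_genM eqxx (negbTE neq_ab) scale0r scale1r ev_0 mulr0 add0r.
Qed.

Let sMg c d u : shift c (u * genS d) = (u [::] * (c == d)%:R) *: 1 + shift c u * genS d.
Proof.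
apply/funext => w; rewrite /shift seriesM_cons !seriesE series1 /genS eqseq_cons.
by rewrite -mulrA; case: eqP; rewrite ?mul1r ?mul0r.
Qed.
Lemma ev_one N y ys : ev N (y :: ys) 1 = ((N == 0%N) && (size ys == 0%N))%:R.
Proof.
case: N => [|N]; first by rewrite ev0; case: ys; rewrite // rmorph1.
by rewrite ev_supp // => w _ _; rewrite series1; case: w.
Qed.
Lemma ev_am N y ys u : ev N.+1 (y :: ys) (u * genS a) = last y ys * ev N (y :: ys) u.
Proof.
elim: N y ys u => [|N IH] y ys u; rewrite evS !sMg !ev_lin eqxx eq_sym (negbTE neq_ab)
  !mulr0 !rmorph0 !mul0r !add0r mulr1n mulr1.
  have z v zs : ev 0 zs (v * genS a) = 0.
    by case: zs => [|z [|? ?]] //; rewrite ev0 // seriesM_nil mulr0 rmorph0.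
   by rewrite ev_one !z !addr0 ev0; case: ys => [|y' ys]; rewrite ?mulr1 ?mulr0.
rewrite IH ev_one mulr0 add0r evS mulrDr; congr (_ + _); first by rewrite mulrCA.
by case: ys => [|z ys]; rewrite ?ev_nil ?mulr0 // IH.
Qed.
Lemma ev_bm N y ys u : ev N.+1 (y :: ys) (u * genS b) = ev N (belast y ys) u.
Proof.
elim: N y ys u => [|N IH] y ys u; rewrite evS !sMg !ev_lin eqxx (negbTE neq_ab) !mulr0
  !rmorph0 !mul0r !add0r mulr1n mulr1.
  have z v zs : ev 0 zs (v * genS b) = 0.
    by case: zs => [|z [|? ?]] //; rewrite ev0 // seriesM_nil mulr0 rmorph0.
  rewrite !z mulr0 addr0 add0r; case: ys => [|z' [|z'' ys]]; first by rewrite ev_nil mulr0.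
    by rewrite ev_one mulr1.
  by rewrite ev_one mulr0.
rewrite IH; case: ys => [|z ys]; first by rewrite /= !ev_nil !mulr0 !addr0.
by rewrite ev_one mulr0 add0r IH.
Qed.

Lemma ev_coma N y ys u :
  ev N.+1 (y :: ys) (com (genS a) u) = (y - last y ys) * ev N (y :: ys) u.
Proof. by rewrite /com evB ev_ma ev_am mulrBl. Qed.
Lemma ev_comb N y ys u :
  ev N.+1 (y :: ys) (com (genS b) u) = ev N ys u - ev N (belast y ys) u.
Proof. by rewrite /com evB ev_mb ev_bm. Qed.

End Letters.

Lemma sum_xlet (V : zmodType) (F : xlet -> V) : \sum_c F c = F X0 + F X1.
Proof. by rewrite (bigD1 X0) // (bigD1 X1) //= big1 ?addr0 //; case; rewrite eqxx ?andbF. Qed.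
Lemma sum_ablet (V : zmodType) (F : ablet -> V) : \sum_c F c = F La + F Lb.
Proof. by rewrite (bigD1 La) // (bigD1 Lb) //= big1 ?addr0 //; case; rewrite eqxx ?andbF. Qed.

Definition t01 : fliec ablet := ad_series (fun k => bernoulli k / k`!%:R) gb ga.

Definition phi_gen (c : xlet) : fliec ablet := if c is X0 then t01 else Theta.

Section Homog.
Variables (A : finType) (c : A).
Implicit Types u v : series A.

Lemma homog0 m u w : letter_homog c m u -> count_mem c w <> m -> u w = 0.
Proof. by move=> hu hw; apply: contrapT => /hu. Qed.

Lemma homogM m p u v : letter_homog c m u -> letter_homog c p v ->
  letter_homog c (m + p) (u * v).
Proof.
move=> hu hv w; apply: contra_notP => hw; rewrite seriesM big1 // => i _.
apply: contrapT => /eqP; rewrite mulf_eq0 negb_or => /andP[/eqP/hu h1 /eqP/hv h2].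
by apply: hw; rewrite -h1 -h2 -count_cat cat_take_drop.
Qed.
Lemma homogL m (k : rat) u v : letter_homog c m u -> letter_homog c m v ->
  letter_homog c m (k *: u + v).
Proof.
move=> hu hv w; apply: contra_notP => hw; rewrite seriesD seriesZ.
by rewrite (homog0 hu) // (homog0 hv) // mulr0 addr0.
Qed.
Lemma homogB m u v : letter_homog c m u -> letter_homog c m v -> letter_homog c m (u - v).
Proof. by move=> hu hv; rewrite addrC -scaleN1r; apply: homogL. Qed.
Lemma homog_com m p u v : letter_homog c m u -> letter_homog c p v ->
  letter_homog c (m + p) (com u v).
Proof.
move=> hu hv; apply: homogB; first exact: homogM.
by rewrite addnC; apply: homogM.
Qed.
Lemma homog_gen d : letter_homog c (d == c) (genS d).
Proof.
move=> w; rewrite /genS; case: eqP => [->|] //= _.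
by rewrite addn0.
Qed.
End Homog.

Lemma homog_ad k : letter_homog La 1 (lie_ad k gb ga).
Proof.
elim: k => [|k IH]; first exact: (@homog_gen _ La La).
by apply: (@homog_com _ La 0 1) => //; exact: (@homog_gen _ La Lb).
Qed.
Lemma homog_t01 : letter_homog La 1 t01.
Proof.
move=> w; apply: contra_notP => hw; rewrite /= /ad_seriesS big1 // => k _.
by rewrite (homog0 (@homog_ad k)) ?mulr0.
Qed.
Lemma homog_Theta : letter_homog La 1 Theta.
Proof.
by apply: (@homog_com _ La 1 0); [exact: (@homog_gen _ La La)|exact: (@homog_gen _ La Lb)].
Qed.

Lemma bernoulli0 : bernoulli 0 = 1. Proof. by []. Qed.
Lemma bernoulli1 : bernoulli 1 = - 2^-1.
Proof.
have := bernoulli_rec 1; rewrite !big_ord_recl big_ord0 /= bernoulli0.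
rewrite -[bump 0 0]/1%N -['C(2, 0)]/1%N -['C(2, 1)]/2%N.
by move: (bernoulli 1) => x h; lra.
Qed.
Lemma bernoulli2 : bernoulli 2 = 6^-1.
Proof.
have := bernoulli_rec 2; rewrite !big_ord_recl big_ord0 /= bernoulli0.
rewrite -[bump 0 (bump 0 0)]/2%N -[bump 0 0]/1%N bernoulli1.
rewrite -['C(3, 0)]/1%N -['C(3, 1)]/3%N -['C(3, 2)]/3%N.
by move: (bernoulli 2) => x h; lra.
Qed.

Section Phi.
Variables (K : fieldType) (k : {rmorphism rat -> K}).
Local Notation E := (path_evald k La Lb).
Local Notation evx := (path_eval k X0 X1).

Lemma char0 n : n.+1%:R != 0 :> K.
Proof. by rewrite -(rmorph_nat k) fmorph_eq0 Num.Theory.pnatr_eq0. Qed.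

Let F (u : series xlet) : series ablet := homS phi_gen u.

Lemma E_t01_1 y : E 1 [:: y] t01 = y.
Proof.
rewrite /path_evald [(_ + _)%N]/= ev1 // (_ : (t01 : series ablet) _ = 1) ?rmorph1 ?mulr1 //.
by rewrite /= /ad_seriesS big_ord1 /= /genS !eqxx /bernoulli /= mulr1 divr1.
Qed.
Lemma ev_t01 N ys : path_eval k La Lb N ys t01 =
  \sum_(i < N) k (bernoulli i / i`!%:R) * path_eval k La Lb N ys (lie_ad i gb ga).
Proof.
pose G : series ablet := \sum_(i < N) (bernoulli i / i`!%:R) *: (lie_ad i gb ga : series ablet).
rewrite (@eq_ev _ _ _ _ _ Lab _ _ _ G); last first.
  by move=> w e; rewrite /G series_sum -e.
by rewrite /G ev_sum; apply: eq_bigr => i _; rewrite evZ.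
Qed.
Lemma E_t01_2 y0 y1 : E 1 [:: y0; y1] t01 = (y0 - y1) / 2.
Proof.
rewrite /path_evald /= ev_t01 !big_ord_recl big_ord0 /= -[bump 0 0]/1%N.
rewrite bernoulli0 bernoulli1 -[0`!]/1%N -[1`!]/1%N.
rewrite ev_comb // !ev_gena //= !rmorphM !rmorphN !fmorphV !rmorph_nat.
by field; rewrite oner_neq0 !char0.
Qed.
Lemma E_t01_3 y0 y1 y2 : E 1 [:: y0; y1; y2] t01 = (y0 - 2 * y1 + y2) / 12.
Proof.
rewrite /path_evald /= ev_t01 !big_ord_recl big_ord0 /= -[bump 0 (bump 0 0)]/2%N -[bump 0
  0]/1%N.
rewrite bernoulli0 bernoulli1 bernoulli2 -[0`!]/1%N -[1`!]/1%N -[2`!]/2%N.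
rewrite ?ev_comb //= ?ev_comb // !ev_gena //= !rmorphM !rmorphN !fmorphV !rmorph_nat.
by field; rewrite oner_neq0 !char0.
Qed.
Lemma E_Theta ys : E 1 ys Theta = if ys is [:: y0; y1] then y0 - y1 else 0.
Proof.
case: ys => [|y0 ys]; first by rewrite /path_evald ev_nil.
rewrite /path_evald /= add1n ev_coma // ev_genb //.
case: ys => [|y1 [|y2 ys]]; rewrite /= ?mulr0 //.
by rewrite mulr1.
Qed.

Lemma E_hom0 ys u : E 0 ys (F u) = if ys is [:: y] then k (u [::]) else 0.
Proof.
rewrite /F homS_rec sum_xlet /path_evald.
case: ys => [|y ys]; first by rewrite ev_nil.
rewrite add0n evD evZ ev_one //.
rewrite (@ev_supp _ k _ _ _ Lab) ?addr0 //; first by case: ys => [|? ?];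
  rewrite ?mulr1 ?mulr0 //= andbF mulr0.
move=> w h1 h2 _; have h3 : count_mem La w = 0%N by apply/eqP;
  rewrite -(eqn_add2r (count_mem Lb w)) h2 h1.
have z (u1 u2 : series ablet) : letter_homog La 1 u1 -> (u1 * u2) w = 0.
  move=> hu; rewrite seriesM big1 // => i _.
  rewrite (homog0 hu) ?mul0r // => h4.
  by move: h3; rewrite -(cat_take_drop i w) count_cat h4.
by rewrite seriesD !z ?addr0 //; [exact: homog_Theta|exact: homog_t01].
Qed.

(** Both letters have images of degree 1 in [a], so that length on one side
    becomes degree in [a] on the other. *)
Lemma E_homS m ys u : E m.+1 ys (F u) =
  \sum_(i < size ys) E 1 (take i.+1 ys) t01 * E m (drop i ys) (F (shift X0 u))
  + \sum_(i < size ys) E 1 (take i.+1 ys) Theta * E m (drop i ys) (F (shift X1 u)).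
Proof.
rewrite -!path_evaldM_l //; [|exact: homog_Theta|exact: homog_t01].
rewrite {1}/F homS_rec sum_xlet add1n {1}/path_evald evD evZ.
case: ys => [|y ys]; first by rewrite /path_evald !ev_nil mulr0 addr0.
by rewrite addSn ev_one // mulr0 add0r evD.
Qed.

Lemma E_phi1 m y u : E m [:: y] (F u) = evx m [:: y] u.
Proof.
elim: m u => [|m IH] u; first by rewrite E_hom0.
by rewrite E_homS /= !big_ord1 /= E_Theta E_t01_1 mul0r !IH evS ev_nil.
Qed.

(** The shape of this and of the next two formulas is the one of the corner entry
    of [U F U^-1], where [X0 U = U diag(y)] for the matrix [X0] of [t01], where
    [U^-1 X1 U] is strictly triangular for the matrix [X1] of [Theta], and [F] is
    the value of [u] at [diag(y)] and [U^-1 X1 U].  The first off-diagonal entries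
    of [U] are all [-1/2]. *)
Lemma E_phi2 m y0 y1 u :
  E m [:: y0; y1] (F u) =
    (y0 - y1) * evx m [:: y0; y1] u + (evx m [:: y0] u - evx m [:: y1] u) / 2.
Proof.
elim: m u => [|m IH] u; first by rewrite E_hom0 /= subrr mul0r mulr0 addr0.
rewrite E_homS /= !big_ord_recl !big_ord0 /= !E_Theta E_t01_1 E_t01_2.
rewrite !E_phi1 !IH; rewrite !evS !ev_nil; field; exact: char0.
Qed.

(** The entries of [U] and of [U^-1 X1 U] at distance two from the diagonal. *)
Definition U2 (y0 y1 y2 : K) := (y1 + y2 - 2 * y0) / (12 * (y2 - y0)).
Definition N2 (y0 y1 y2 : K) := (2 * y1 - y0 - y2) / 2.
(** The corner entry of [F]: paths from [y0] to [y2], weighted by the entries of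
    [U^-1 X1 U]. *)
Definition F2 m y0 y1 y2 u :=
  N2 y0 y1 y2 * evx m [:: y0; y2] u
  + (y0 - y1) * (y1 - y2) * evx m [:: y0; y1; y2] u.

Lemma E_phi3 m y0 y1 y2 u : y2 - y0 != 0 ->
  E m [:: y0; y1; y2] (F u) =
    F2 m y0 y1 y2 u - (y1 - y2) / 2 * evx m [:: y1; y2] u
    + U2 y0 y1 y2 * (evx m [:: y2] u - evx m [:: y0] u)
    + E m [:: y0; y1] (F u) / 2.
Proof.
move=> ne; elim: m u => [|m IH] u.
  by rewrite !E_hom0 /F2 /= subrr !(mulr0, addr0, mul0r) subrr.
rewrite E_homS /= !big_ord_recl !big_ord0 /= !E_Theta E_t01_1 E_t01_2 E_t01_3.
rewrite !IH !E_phi2 !E_phi1 /F2 /U2 /N2 !evS !ev_nil.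
by field; rewrite ne !char0.
Qed.

Definition N3 (y0 y1 y2 y3 : K) :=
  (y0 - y1) * U2 y1 y2 y3 + N2 y1 y2 y3 / 2 - U2 y0 y1 y2 * (y2 - y3).
Definition F3 m y0 y1 y2 y3 u :=
  N3 y0 y1 y2 y3 * evx m [:: y0; y3] u
  + (y0 - y1) * N2 y1 y2 y3 * evx m [:: y0; y1; y3] u
  + N2 y0 y1 y2 * (y2 - y3) * evx m [:: y0; y2; y3] u
  + (y0 - y1) * (y1 - y2) * (y2 - y3) * evx m [:: y0; y1; y2; y3] u.
(** The value of [t01] at four points is left as it is: it is multiplied by
    values of [u] at single points, which vanish for the Lie series of interest. *)
Definition U3 (y0 y1 y2 y3 : K) :=
  ((y0 - y1) / 2 * U2 y1 y2 y3 - (y0 - 2 * y1 + y2) / 24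
   + E 1 [:: y0; y1; y2; y3] t01) / (y3 - y0).

Lemma E_phi4 m y0 y1 y2 y3 u : y2 - y0 != 0 -> y3 - y1 != 0 -> y3 - y0 != 0 ->
  E m [:: y0; y1; y2; y3] (F u) =
    F3 m y0 y1 y2 y3 u - F2 m y1 y2 y3 u / 2
    + U2 y0 y1 y2 * (y2 - y3) * evx m [:: y2; y3] u
    + U3 y0 y1 y2 y3 * (evx m [:: y3] u - evx m [:: y0] u)
    + E m [:: y0; y1; y2] (F u) / 2 - U2 y1 y2 y3 * E m [:: y0; y1] (F u).
Proof.
move=> n1 n2 n3; elim: m u => [|m IH] u.
  by rewrite !E_hom0 /F3 /F2 /= subrr !(mulr0, addr0, mul0r, subrr).
rewrite E_homS /= !big_ord_recl !big_ord0 /= !E_Theta E_t01_1 E_t01_2 E_t01_3.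
rewrite !IH !E_phi3 // !E_phi2 !E_phi1 /F3 /F2 /U3 /N3 /U2 /N2 !evS !ev_nil.
move: (path_evald _ _ _ _ _ _) => X.
by field; rewrite n1 n2 n3 !char0.
Qed.

End Phi.

(** * Supports of derivations and the derivations epsilon *)

Section DerSupport.
Variable A : finType.
Implicit Types (u v : series A) (w : seq A).

Lemma seriesM_supp u v w : (u * v) w <> 0 ->
  exists w1 w2, [/\ w = w1 ++ w2, u w1 <> 0 & v w2 <> 0].
Proof.
move=> h; apply: contrapT => h'; apply: h; rewrite seriesM big1 // => i _.
apply: contrapT => /eqP; rewrite mulf_eq0 negb_or => /andP[/eqP h1 /eqP h2].
by apply: h'; exists (take i w), (drop i w); rewrite cat_take_drop.
Qed.

Lemma com_gen_supp c u w : com (genS c) u w <> 0 ->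
  exists2 v, u v <> 0 & perm_eq w (c :: v).
Proof.
rewrite /com seriesB => h.
have [h0|/seriesM_supp [w1 [w2 [->]]]] := pselect ((genS c * u) w = 0); last first.
  by rewrite /genS; case: eqP => // -> _ h2; exists w2.
have {h h0} /seriesM_supp [w1 [w2 [-> h1]]] : (u * genS c) w <> 0.
  by move=> e; apply: h; rewrite h0 e subr0.
by rewrite /genS; case: eqP => // -> _; exists w1; rewrite // cats1 perm_rcons.
Qed.

Lemma lie_ad_supp c d j w :
  (lie_ad j (gen c) (gen d) : series A) w <> 0 -> perm_eq w (rcons (nseq j c) d).
Proof.
elim: j w => [|j IH] w /=; first by rewrite /genS; case: eqP => // ->.
by case/com_gen_supp => v /IH pe /perm_trans; apply; rewrite perm_cons.
Qed.

(** The Leibniz rule, seen on words: one letter [c] is replaced by a word of its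
    image.  All the degree and filtration arguments reduce to this. *)
Lemma derS_supp (d : A -> series A) w u : derS d w u <> 0 ->
  exists p q c x, [/\ w = p ++ x ++ q, u (p ++ c :: q) <> 0 & d c x <> 0].
Proof.
have E0 w' u' : (\sum_c d c * shift c u') w' <> 0 ->
    exists p q c x, [/\ w' = p ++ x ++ q, u' (p ++ c :: q) <> 0 & d c x <> 0].
  move=> h; have [c hc] : exists c, (d c * shift c u') w' <> 0.
    apply: contrapT => h'; apply: h; rewrite series_sum big1 // => c _.
    by apply: contrapT => hc; apply: h'; exists c.
  by have [x [q [e hx hq]]] := seriesM_supp hc; exists [::], q, c, x.
elim: w u => [|c w IH] u /=; first by rewrite addr0 => /E0.
have [h|/E0//] := pselect ((\sum_c0 d c0 * shift c0 u) (c :: w) = 0).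
rewrite h add0r => /IH [p [q [c' [x [-> h1 h2]]]]].
by exists (c :: p), q, c', x.
Qed.

Lemma cder_derS (D : cder A) (x : fliec A) :
  fliec_val (D x) = fun w => derS (fun c => D (gen c)) w x.
Proof.
have {1}-> : D = lie_der (fun c => D (gen c)).
  by apply: cder_gen_ext => c; rewrite lie_der_gen.
by [].
Qed.

Lemma cder_supp (D : cder A) (x : fliec A) w : (D x : series A) w <> 0 ->
  exists p q c y, [/\ w = p ++ y ++ q, (x : series A) (p ++ c :: q) <> 0 & (D (gen c) :
    series A) y <> 0].
Proof. by rewrite cder_derS => /derS_supp. Qed.

Lemma cder_ge_gen n (D : cder A) : (forall c, ord_ge n.+1 (D (gen c))) -> cder_ge n D.
Proof.
move=> h m x hx w; rewrite ltnNge => /negP hw; apply: contrapT.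
move=> /cder_supp [p [q [c [y [ew h1 h2]]]]]; apply: hw; rewrite ew !size_cat.
have e1 : (n < size y)%N by rewrite ltnNge; apply/negP => /(h c) /h2.
have : (m <= size (p ++ c :: q))%N by rewrite leqNgt; apply/negP => /hx /h1.
by rewrite size_cat /=; lia.
Qed.
End DerSupport.

Lemma nseq_rcons (T : Type) (c : T) j : nseq j c ++ [:: c] = nseq j.+1 c.
Proof. by elim: j => //= j ->. Qed.

Lemma word_lastb w : count_mem Lb w <> 0%N ->
  exists w1 j, w = w1 ++ Lb :: nseq j La.
Proof.
elim/last_ind: w => // w c IH; rewrite -cats1 count_cat /=.
case: c => /= h; last by exists w, 0%N.
have [|w1 [j ->]] := IH; first by move: h; rewrite !addn0.
by exists w1, j.+1; rewrite -catA cat_cons nseq_rcons.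
Qed.

Lemma word_nob w : count_mem Lb w = 0%N -> w = nseq (size w) La.
Proof. by elim: w => [//|[] w IH] //= h; rewrite -IH. Qed.

(** A Lie series without term [a] can be recovered from its commutator with [a]:
    moving the last letters [a] of a word to its front one at a time changes the
    coefficient by coefficients of the commutator, until the word ends in [b]. *)
Lemma com_a_supp (v : series ablet) (P : nat -> nat -> Prop) :
  free_liec v -> v [:: La] = 0 ->
  (forall w, com (genS La) v w <> 0 -> P (count_mem Lb w) (size w)) ->
  forall w, v w <> 0 -> P (count_mem Lb w) (size w).+1.
Proof.
move=> hv v1 h w hw; have cw : count_mem Lb w <> 0%N.
  move=> /word_nob e; apply: hw; rewrite e; case: (size w) => [|[|n]] //.
    exact: free_liec_ord1.
  exact: free_liec_nseq.
have [w1 [j e]] := word_lastb cw; rewrite e in hw *; move: {w cw e} hw.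
have gl w : (genS La * v) (La :: w) = v w.
  by rewrite -[LHS]/(shift La (genS La * v) w) shift_genM eqxx scale1r.
have gr w c : (v * genS La) (rcons w c) = (c == La)%:R * v w.
  elim: w v {hv v1 h gl} => [|c' w IH] v'.
    rewrite seriesM !big_ord_recl big_ord0 /= /genS /= mulr0 !addr0.
    by rewrite eqseq_cons andbT mulrC.
  rewrite rcons_cons seriesM_cons IH /genS.
  by case: w {IH} => [|? ?] /=; rewrite eqseq_cons andbF mulr0 add0r.
elim: j w1 => [|j IH] w1 hw.
  apply: (h (La :: w1 ++ [:: Lb])).
  by rewrite /com seriesB gl cats1 -rcons_cons gr mul0r subr0 -cats1.
have [z|nz] := pselect (com (genS La) v (La :: w1 ++ Lb :: nseq j.+1 La) = 0); last first.
  by have := h _ nz.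
have e : w1 ++ Lb :: nseq j.+1 La = rcons (w1 ++ Lb :: nseq j La) La.
  by rewrite -cats1 -catA cat_cons nseq_rcons.
move: z; rewrite /com seriesB gl e -rcons_cons gr eqxx mul1r => /eqP.
rewrite subr_eq0 -e => /eqP z; rewrite z in hw.
have -> : count_mem Lb (w1 ++ Lb :: nseq j.+1 La) = count_mem Lb ((La :: w1) ++ Lb :: nseq
  j La).
  by rewrite /= !count_cat.
have -> : size (w1 ++ Lb :: nseq j.+1 La) = size ((La :: w1) ++ Lb :: nseq j La).
  by rewrite /= !size_cat /= !addnS.
exact: IH.
Qed.

Section Eps.
Variables (K : fieldType) (k : {rmorphism rat -> K}).
Local Notation ev := (path_eval k La Lb).

Variables (m : nat) (D : cder ablet).
Hypothesis hD : is_eps_dual m D.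

Let Da : D ga = lie_ad m ga gb. Proof. by case: hD. Qed.

Lemma ad_supp j w : (lie_ad j ga gb : series ablet) w <> 0 ->
  count_mem Lb w = 1%N /\ size w = j.+1.
Proof.
move/lie_ad_supp => pe; rewrite (permP pe) (perm_size pe) size_rcons size_nseq.
by rewrite -cats1 count_cat count_nseq.
Qed.

Lemma eps_comab : com (genS La) (D gb) = com (genS Lb) (D ga).
Proof.
have [_ hT _] := hD; move: hT; rewrite /Theta cder_br => /(congr1 (@fliec_val _)) /=.
by rewrite /com => /eqP; rewrite addrC addr_eq0 opprB => /eqP.
Qed.

Lemma eps_b_supp w : (D gb : series ablet) w <> 0 ->
  count_mem Lb w = 2%N /\ size w = m.+1.
Proof.
have [_ _ h1] := hD.
move=> hw; have := @com_a_supp _ (fun i j => i = 2%N /\ j = m.+2) (fliecP (D gb)) h1 _ w hw.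
case=> [w'|-> []//]; rewrite eps_comab Da => /com_gen_supp [v /ad_supp [h2 h3] pe].
by rewrite (permP pe) (perm_size pe) /= h2 h3.
Qed.

Lemma eps_supp (x : fliec ablet) w : (D x : series ablet) w <> 0 ->
  exists v, [/\ (x : series ablet) v <> 0, count_mem Lb w = (count_mem Lb v).+1
              & size w = (size v + m)%N].
Proof.
case/cder_supp => p [q [c [y [-> h1 h2]]]]; exists (p ++ c :: q); split=> //.
  rewrite !count_cat /=; case: c {h1} h2 => [|/eps_b_supp []].
    by rewrite -/ga Da => /ad_supp [-> _]; rewrite !addnS.
  by move=> -> _ /=; rewrite !addnS.
rewrite !size_cat /=; case: c {h1} h2 => [|/eps_b_supp []].
  by rewrite -/ga Da => /ad_supp [_ ->]; lia.
by move=> _ ->; lia.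
Qed.

(** If [h] has these values, then [D a = [a, h]], so that [D + ad h] kills [a]; it
    sends [b] to an element whose values at three points are given by [eps_g],
    those of [D b] being given by [eps_b]. *)
Definition eps_h (y0 y1 : K) := (y0 - y1) ^+ m / (y0 - y1).
Definition eps_b (y0 y1 y2 : K) := ((y1 - y2) ^+ m - (y0 - y1) ^+ m) / (y0 - y2).
Definition eps_g (y0 y1 y2 : K) := eps_b y0 y1 y2 - (eps_h y1 y2 - eps_h y0 y1).

Lemma ev_ad j y0 y1 : ev j.+1 [:: y0; y1] (lie_ad j ga gb) = (y0 - y1) ^+ j.
Proof.
elim: j => [|j IH]; first by rewrite ev_genb.
by rewrite [fliec_val _]/= ev_coma // IH exprS.
Qed.
Lemma ev_eps_a y0 y1 : ev m.+1 [:: y0; y1] (D ga) = (y0 - y1) ^+ m.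
Proof. by rewrite Da ev_ad. Qed.
Lemma ev_eps_b y0 y1 y2 : y0 - y2 != 0 -> ev m.+1 [:: y0; y1; y2] (D gb) = eps_b y0 y1 y2.
Proof.
move=> ne; have := congr1 (ev m.+2 [:: y0; y1; y2]) eps_comab.
rewrite ev_coma // ev_comb //= !ev_eps_a => h.
by rewrite /eps_b -h mulrC mulKf.
Qed.

Let eva0 N ys : size ys != 2%N -> ev N ys (D ga) = 0.
Proof.
move=> h; apply: ev_supp => // w h1 _ _; apply: contrapT; rewrite Da => /ad_supp [h2 _].
by move: h1 h; rewrite h2; case: ys => [|? [|? []]].
Qed.
Let evb0 N ys : size ys != 3%N -> ev N ys (D gb) = 0.
Proof.
move=> h; apply: ev_supp => // w h1 _ _; apply: contrapT => /eps_b_supp [h2 _].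
by move: h1 h; rewrite h2; case: ys => [|? [|? [|? []]]].
Qed.

Let Dser (u : series ablet) : series ablet := fun w => derS (fun c => D (gen c)) w u.

Let DDS u N y ys : ev (N + m).+1 (y :: ys) (Dser u) =
  \sum_(i < (size ys).+1) ev m.+1 (take i.+1 (y :: ys)) (D ga) * ev N (drop i (y :: ys))
    (shift La u)
  + \sum_(i < (size ys).+1) ev m.+1 (take i.+1 (y :: ys)) (D gb) * ev N (drop i (y :: ys))
    (shift Lb u)
  + (y * ev (N + m) (y :: ys) (Dser (shift La u)) + ev (N + m) ys (Dser (shift Lb u))).
Proof.
pose SS : series ablet := fun w => if w is c :: w' then Dser (shift c u) w' else 0.
have -> : Dser u = (D ga : series ablet) * shift La u + (D gb : series ablet) * shift Lb u + SS.
  apply/funext => w; rewrite seriesD /Dser; case: w => [|c w] /=; by rewrite sum_ablet.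
have e : (N + m).+1 = (m.+1 + N)%N by rewrite addSn addnC.
rewrite evD evD; congr (_ + _ + _).
  by rewrite e (@evM_len _ k _ La Lb Lab m.+1) // => w; rewrite Da => /ad_supp [].
by rewrite e (@evM_len _ k _ La Lb Lab m.+1) // => w /eps_b_supp [].
Qed.

Let DD1 N y u : ev N [:: y] (Dser u) = 0.
Proof.
apply: ev_supp => // w h1 _ _; apply: contrapT => /derS_supp [p [q [c [x [ew _ h2]]]]].
move: h1; rewrite ew !count_cat /=; case: c h2.
  by rewrite -/ga Da => /ad_supp [->]; rewrite !addnS.
by move=> /eps_b_supp [->]; rewrite !addnS.
Qed.
Let DD0 ys u : ev m ys (Dser u) = 0.
Proof.
apply: ev_supp => // w _ _ h1; apply: contrapT => /derS_supp [p [q [c [x [ew _ h2]]]]].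
have e : size x = m.+1.
  by case: c h2 => [|/eps_b_supp [] //]; rewrite -/ga Da => /ad_supp [].
by move: h1; rewrite ew !size_cat e; lia.
Qed.

Let DD2 N y0 y1 u : y0 - y1 != 0 ->
  ev (N + m) [:: y0; y1] (Dser u) = eps_h y0 y1 * (ev N [:: y0] u - ev N [:: y1] u).
Proof.
move=> ne; elim: N u => [|N IH] u; first by rewrite DD0 !ev0 subrr mulr0.
rewrite addSn DDS !big_ord_recl !big_ord0 /= IH DD1 !evb0 // (eva0 _ (ys := [:: y0])) //.
by rewrite ev_eps_a !evS !ev_nil /eps_h; field.
Qed.

Let DD3 N y0 y1 y2 u : y0 - y1 != 0 -> y1 - y2 != 0 -> y0 - y2 != 0 ->
  ev (N + m) [:: y0; y1; y2] (Dser u) =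
    ev N [:: y0; y1] u * eps_h y1 y2 - eps_h y0 y1 * ev N [:: y1; y2] u
    + ev N [:: y0; y2] u * eps_g y0 y1 y2.
Proof.
move=> n1 n2 n3; elim: N u => [|N IH] u; first by rewrite DD0 !ev0 !(mul0r, mulr0) subrr addr0.
rewrite addSn DDS !big_ord_recl !big_ord0 /= IH DD2 // !(evb0 _ (ys :=
  [:: _])) // !(evb0 _ (ys := [:: _; _])) //.
rewrite !(eva0 _ (ys := [:: _])) // !(eva0 _ (ys := [:: _; _; _])) //.
by rewrite ev_eps_a ev_eps_b // !evS ?ev_nil /eps_g /eps_b /eps_h; field; rewrite n1 n2 n3.
Qed.

Let DD4 N y0 y1 y2 y3 u : y0 - y1 != 0 -> y1 - y2 != 0 -> y2 - y3 != 0 ->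
  y0 - y2 != 0 -> y1 - y3 != 0 ->
  ev (N + m) [:: y0; y1; y2; y3] (Dser u) =
    ev N [:: y0; y1; y2] u * eps_h y2 y3 - eps_h y0 y1 * ev N [:: y1; y2; y3] u
    + ev N [:: y0; y2; y3] u * eps_g y0 y1 y2 + ev N [:: y0; y1; y3] u * eps_g y1 y2 y3.
Proof.
move=> n1 n2 n3 n4 n5; elim: N u => [|N IH] u; first
  by rewrite DD0 !ev0 !(mul0r, mulr0) subrr !addr0.
rewrite addSn DDS !big_ord_recl !big_ord0 /= IH DD3 // !(evb0 _ (ys :=
  [:: _])) // !(evb0 _ (ys := [:: _; _])) // !(evb0 _ (ys := [:: _; _; _; _])) //.
rewrite !(eva0 _ (ys := [:: _])) // !(eva0 _ (ys := [:: _; _;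
  _])) // !(eva0 _ (ys := [:: _; _; _; _])) //.
rewrite ev_eps_a ev_eps_b // !evS ?ev_nil /eps_g /eps_b /eps_h; field.
by rewrite n1 n2 n3 n4 n5.
Qed.

Lemma ev_eps3 N y0 y1 y2 (x : fliec ablet) : y0 - y1 != 0 -> y1 - y2 != 0 -> y0 - y2 != 0 ->
  ev (N + m) [:: y0; y1; y2] (D x) =
    ev N [:: y0; y1] x * eps_h y1 y2 - eps_h y0 y1 * ev N [:: y1; y2] x
    + ev N [:: y0; y2] x * eps_g y0 y1 y2.
Proof. by rewrite cder_derS; exact: DD3. Qed.

(** In terms of [eps_h] and [eps_g]: the commutator with [h] contributes at the
    two ends of the sequence of points, and replacing a letter [b] lets [u] skip
    an inner point. *)
Lemma ev_eps4 N y0 y1 y2 y3 (x : fliec ablet) : y0 - y1 != 0 -> y1 - y2 != 0 -> y2 - y3 != 0 ->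
  y0 - y2 != 0 -> y1 - y3 != 0 ->
  ev (N + m) [:: y0; y1; y2; y3] (D x) =
    ev N [:: y0; y1; y2] x * eps_h y2 y3 - eps_h y0 y1 * ev N [:: y1; y2; y3] x
    + ev N [:: y0; y2; y3] x * eps_g y0 y1 y2 + ev N [:: y0; y1; y3] x * eps_g y1 y2 y3.
Proof. by rewrite cder_derS; exact: DD4. Qed.

End Eps.

(** * The values of i_1(sigma) with one, two and three letters b *)

Section Tate.
Variables (K : fieldType) (k : {rmorphism rat -> K}).
Local Notation E := (path_evald k La Lb).
Local Notation ev := (path_eval k La Lb).
Local Notation evx := (path_eval k X0 X1).

(** The only properties of [i_1] that are used, for [f = i(sigma)] of degree
    [M]. *)
Variables (D : cder ablet) (f : flie xlet) (M : nat).
Hypothesis M2 : (2 <= M)%N.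
Hypothesis hT : D Theta = 0.
Hypothesis hphi : D t01 = [lie t01, phi (complete f)].
Hypothesis hdeg : forall j (x : fliec ablet), letter_homog La j x ->
  letter_homog La (j + M) (D x).

Let Da_homog : letter_homog La M.+1 (D ga).
Proof. exact: (@hdeg 1 ga (@homog_gen _ La La)). Qed.
Let Db_homog : letter_homog La M (D gb).
Proof. exact: (@hdeg 0 gb (@homog_gen _ La Lb)). Qed.

Let comab : com (genS La) (D gb) = com (genS Lb) (D ga).
Proof.
move: hT; rewrite /Theta cder_br => /(congr1 (@fliec_val _)) /=.
by rewrite /com => /eqP; rewrite addrC addr_eq0 opprB => /eqP.
Qed.

Lemma der_a_supp w : (D ga : series ablet) w <> 0 -> (1 <= count_mem Lb w)%N.
Proof.
move=> h; rewrite lt0n; apply/eqP => /word_nob e; have hM := Da_homog h; apply: h; move: hM.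
rewrite e count_nseq mul1n => ->; case: M M2 => [//|M' _].
by rewrite (free_liec_nseq La) //; exact: fliecP.
Qed.
Let Db_b w : (D gb : series ablet) w <> 0 -> (2 <= count_mem Lb w)%N.
Proof.
move=> h; apply: (@com_a_supp _ (fun i _ => (2 <= i)%N) (fliecP (D gb)) _ _ w h).
  by apply: (homog0 Db_homog); rewrite /=; lia.
by move=> {h}w; rewrite comab => /com_gen_supp [v /der_a_supp h1 pe];
  rewrite (permP pe) /= ltnS.
Qed.

Let bba : fliec ablet := [lie gb, [lie gb, ga]].
Let tail : fliec ablet := t01 - (ga + 2^-1 *: Theta + 12^-1 *: bba).

Let ad_b_supp j w : (lie_ad j gb ga : series ablet) w <> 0 ->
  count_mem Lb w = j /\ size w = j.+1.
Proof.
move/lie_ad_supp => pe; rewrite (permP pe) (perm_size pe) size_rcons size_nseq.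
by rewrite -cats1 count_cat count_nseq /= mul1n !addn0.
Qed.

Let tailE : tail = t01 - \sum_(i < 3) (bernoulli i / i`!%:R) *: lie_ad i gb ga.
Proof.
rewrite /tail; congr (_ - _); rewrite !big_ord_recl big_ord0 /=.
rewrite -[bump 0 (bump 0 0)]/2%N -[bump 0 0]/1%N.
rewrite bernoulli0 bernoulli1 bernoulli2 -[0`!]/1%N -[1`!]/1%N -[2`!]/2%N.
rewrite divr1 scale1r addr0 divr1 addrA; congr (_ + _ + _).
by apply: fliec_inj; rewrite /= scaleNr -scalerN /com opprB.
Qed.

Let tail_b w : (tail : series ablet) w <> 0 -> (3 <= count_mem Lb w)%N.
Proof.
move=> h; rewrite ltnNge; apply/negP => hb; apply: h; rewrite tailE.
have -> : fliec_val (t01 - \sum_(i < 3) (bernoulli i / i`!%:R) *: lie_ad i gb ga) w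
  = (t01 : series ablet) w - \sum_(i < 3) (bernoulli i / i`!%:R) * (lie_ad i gb ga : series
    ablet) w.
  by rewrite !big_ord_recl !big_ord0.
apply/eqP; rewrite subr_eq0; apply/eqP; rewrite /= /ad_seriesS.
pose G i := bernoulli i / i`!%:R * (lie_ad i gb ga : series ablet) w.
rewrite -/(\sum_(i < size w) G i) -/(\sum_(i < 3) G i).
have G0 i : i <> count_mem Lb w \/ i.+1 <> size w -> G i = 0.
  move=> hi; rewrite /G; have [->|/ad_b_supp [e1 e2]] :=
    pselect ((lie_ad i gb ga : series ablet) w = 0).
    by rewrite mulr0.
  by case: hi; rewrite ?e1 ?e2.
have [e|e] := eqVneq (count_mem Lb w).+1 (size w); last first.
  have z i : G i = 0.
    apply: G0; case: (eqVneq i (count_mem Lb w)) => [h|/eqP h]; last by left.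
    by right; rewrite h; apply/eqP.
  by rewrite !big1.
have hs : (size w <= 3)%N by rewrite -e.
rewrite (big_ord_widen _ G hs) big_mkcond /=; apply: eq_bigr => i _.
by case: ltnP => // hi; rewrite G0 //; left=> h; move: hi; rewrite h -e ltnn.
Qed.

Let Dtail_ev N ys : (size ys <= 4)%N -> ev N ys (D tail) = 0.
Proof.
move=> hs; apply: ev_supp => // w h1 _ _; apply: contrapT => /cder_supp [p [q [c [y [ew h2
  h3]]]]].
have := tail_b h2; move: h1; rewrite ew !count_cat /=.
have key (p' q' y' s c' : nat) : (c' < y')%N -> (p' + (y' + q') = s.-1)%N ->
  (s <= 4)%N -> (2 < p' + (c' + q'))%N -> False by lia.
case: c {h2} h3 => [/der_a_supp|/Db_b] h h1' h2'; exact: key h h1' hs h2'.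
Qed.

(** As [D Theta = 0], the term [Theta / 2] disappears, and [D [b,[b,a]]] can be
    written with commutators with letters only. *)
Let Dt01 : fliec_val (D t01) =
  (D ga : series ablet)
  + 12^-1 *: (com (genS La) (com (genS Lb) (D gb)) - com (genS Lb) (com (genS Lb) (D ga)))
  + (D tail : series ablet).
Proof.
have hX : fliec_val (D bba) = com (genS La) (com (genS Lb) (D gb)) - com (genS Lb) (com
  (genS Lb) (D ga)).
  rewrite /bba !cder_br !fliec_valD /=.
  have -> : com (D gb) (genS La) = - com (genS Lb) (D ga) by rewrite -comab /com opprB.
  have -> : com (D gb) (com (genS Lb) (genS La)) =
     com (genS La) (com (genS Lb) (D gb)) - com (genS Lb) (com (genS La) (D gb)).
    by rewrite /com; apply/funext => s; rewrite !(mulrBl, mulrBr, mulrA) !seriesE; ring.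
  by rewrite addNr [com _ 0]/com mulr0 mul0r subrr addr0 comab.
rewrite -hX; have {1}-> : t01 = ga + 2^-1 *: Theta + 12^-1 *: bba + tail by rewrite addrC subrK.
by rewrite !cderD !cderZ hT scaler0 addr0.
Qed.

Let E_expand ys : (0 < size ys <= 4)%N -> E M.+1 ys (D t01) = E M.+1 ys (D ga)
  + (ev (M + size ys) ys (com (genS La) (com (genS Lb) (D gb)))
     - ev (M + size ys) ys (com (genS Lb) (com (genS Lb) (D ga)))) / 12.
Proof.
case/andP=> h1 h2; rewrite Dt01 {1}/path_evald evD evD Dtail_ev //
  evZ evB addr0 fmorphV rmorph_nat.
rewrite mulrC; congr (_ + _ / _); have -> // : (M + size ys = M.+1 + (size ys).-1)%N.
by case: ys h1 h2 => // y ys _ _; rewrite addnS.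
Qed.

Let Phi := homS phi_gen f.

Let ev_Da N ys : size ys = 1%N -> ev N ys (D ga) = 0.
Proof.
move=> h; apply: ev_supp => // w h1 _ _; apply: contrapT => /der_a_supp.
by rewrite h1 h.
Qed.
Let ev_Db N ys : (size ys <= 2)%N -> ev N ys (D gb) = 0.
Proof.
move=> h; apply: ev_supp => // w h1 _ _; apply: contrapT => /Db_b.
by rewrite h1; lia.
Qed.

Let E_Dt01 ys : E M.+1 ys (D t01) =
  \sum_(i < size ys) E 1 (take i.+1 ys) t01 * E M (drop i ys) Phi
  - \sum_(i < size ys) E M (take i.+1 ys) Phi * E 1 (drop i ys) t01.
Proof.
have -> : fliec_val (D t01) = com t01 Phi by rewrite hphi.
rewrite /com {1}/path_evald evB -!/(path_evald _ _ _ _ _ _).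
congr (_ - _); first by rewrite -add1n (@path_evaldM_l _ k _ La Lb Lab 1) //; exact: homog_t01.
by rewrite -addn1 (@path_evaldM_r _ k _ La Lb Lab 1) //; exact: homog_t01.
Qed.

Let E_Phi1 y : E M [:: y] Phi = 0.
Proof.
rewrite E_phi1 ev1_lie //; first by apply: free_lie_liec; exact: flieP.
by case: M M2 => [|[]].
Qed.
Let L1 y : evx M [:: y] f = 0.
Proof. by rewrite -E_phi1 E_Phi1. Qed.

Lemma tate_der1 y0 y1 : E M.+1 [:: y0; y1] (D ga) = (y0 - y1) ^+ 2 * evx M [:: y0; y1] f.
Proof.
have := E_Dt01 [:: y0; y1]; rewrite E_expand // [(M + _)%N]/=.
rewrite addn2 ev_coma // !ev_comb //= !ev_Db // !ev_nil !(subrr, mulr0, mul0r, addr0) => ->.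
rewrite !big_ord_recl !big_ord0 /= !E_Phi1 !E_t01_1 E_phi2 !L1.
by field; exact: char0.
Qed.

(** From [[a, D b] = [b, D a]]. *)
Lemma tate_der_b2 y0 y1 y2 : y0 - y2 != 0 -> E M [:: y0; y1; y2] (D gb) =
  ((y1 - y2) ^+ 2 * evx M [:: y1; y2] f - (y0 - y1) ^+ 2 * evx M [:: y0; y1] f) / (y0 - y2).
Proof.
move=> ne; rewrite -!tate_der1 /path_evald /= !addn1 addn2.
have := congr1 (ev M.+3 [:: y0; y1; y2]) comab; rewrite ev_coma // ev_comb //= => <-.
by rewrite mulrC mulKf.
Qed.

Lemma tate_der2 y0 y1 y2 : y0 - y1 != 0 -> y1 - y2 != 0 -> y0 - y2 != 0 ->
  E M.+1 [:: y0; y1; y2] (D ga) =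
  (y0 - y2) * (F2 k M y0 y1 y2 f
    + ((y0 - y1) * evx M [:: y0; y1] f - (y1 - y2) * evx M [:: y1; y2] f) / 2)
  + (y0 - y1) * (y1 - y2) / 2 * (evx M [:: y1; y2] f - evx M [:: y0; y1] f).
Proof.
move=> n1 n2 n3; have n3' : y2 - y0 != 0 by rewrite -opprB oppr_eq0.
have := E_Dt01 [:: y0; y1; y2]; rewrite E_expand // [(M + _)%N]/=.
rewrite addn3 ev_coma // !ev_comb //= ?ev_comb //= !ev_Db // !ev_Da //
  !(subrr, mulr0, mul0r, addr0) => ->.
rewrite !big_ord_recl !big_ord0 /= !E_Phi1 !E_t01_1 !E_t01_2 E_phi3 // !E_phi2 !L1.
by field; exact: char0.
Qed.

(** Values of [D t01 = [t01, phi f]] at four points.  The last term comes from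
    [D [b,[b,a]] / 12], with [B012] and [B123] the values of [D b]. *)
Lemma tate_der3 y0 y1 y2 y3 : y0 - y1 != 0 -> y1 - y2 != 0 -> y2 - y3 != 0 ->
  y0 - y2 != 0 -> y1 - y3 != 0 -> y0 - y3 != 0 ->
  let L01 := evx M [:: y0; y1] f in
  let L12 := evx M [:: y1; y2] f in
  let L23 := evx M [:: y2; y3] f in
  let F012 := F2 k M y0 y1 y2 f in let F123 := F2 k M y1 y2 y3 f in
  let H012 := F012 + ((y0 - y1) * L01 - (y1 - y2) * L12) / 2 in
  let H123 := F123 + ((y1 - y2) * L12 - (y2 - y3) * L23) / 2 in
  let B012 := ((y1 - y2) ^+ 2 * L12 - (y0 - y1) ^+ 2 * L01) / (y0 - y2) in
  let B123 := ((y2 - y3) ^+ 2 * L23 - (y1 - y2) ^+ 2 * L12) / (y1 - y3) in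
  E M.+1 [:: y0; y1; y2; y3] (D ga) =
  (y0 - y3) * (F3 k M y0 y1 y2 y3 f - F123 / 2 + U2 y0 y1 y2 * (y2 - y3) * L23
     + H012 / 2 - U2 y1 y2 y3 * (y0 - y1) * L01)
  + (y0 - y1) / 2 * H123 - (y2 - y3) / 2 * H012
  + (y0 - 2 * y1 + y2) / 12 * (y2 - y3) * L23
  - (y1 - 2 * y2 + y3) / 12 * (y0 - y1) * L01
  - ((y0 - y3) * (B123 - B012)
     - ((y2 - y3) ^+ 2 * L23 - 2 * (y1 - y2) ^+ 2 * L12 + (y0 - y1) ^+ 2 * L01)) / 12.
Proof.
move=> n1 n2 n3 n4 n5 n6 L01 L12 L23 F012 F123 H012 H123 B012 B123.
have n4' : y2 - y0 != 0 by rewrite -opprB oppr_eq0.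
have n5' : y3 - y1 != 0 by rewrite -opprB oppr_eq0.
have n6' : y3 - y0 != 0 by rewrite -opprB oppr_eq0.
have := E_Dt01 [:: y0; y1; y2; y3]; rewrite E_expand // [(M + _)%N]/=.
rewrite -[4%N]/(3 + 1)%N addnA addn1 addn3 ev_coma // !ev_comb //= ?ev_comb //=.
have eE2 y y' : ev M.+2 [:: y; y'] (D ga) = (y - y') ^+ 2 * evx M [:: y; y'] f.
  by rewrite -tate_der1 /path_evald /= addn1.
have eE3 y y' y'' : y - y'' != 0 -> ev M.+2 [:: y; y'; y''] (D gb) =
   ((y' - y'') ^+ 2 * evx M [:: y'; y''] f - (y - y') ^+ 2 * evx M [:: y; y'] f) / (y - y'').
  by move=> ne; rewrite -tate_der_b2 // /path_evald /= addn2.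
rewrite !eE2 !eE3 //= !big_ord_recl !big_ord0 /=.
rewrite !E_Phi1 !E_t01_1 !E_t01_2 !E_t01_3 E_phi4 // !E_phi3 // !E_phi2 !L1.
rewrite -/L01 -/L12 -/L23 -/F012 -/F123.
move: (E M.+1 _ _) => A.
rewrite -/B012 -/B123 => /(canRL (addrK _)) ->.
rewrite /H123 /H012 /U2; clear H123 H012; clearbody B012 B123 F012 F123; clearbody L01 L12 L23.
by field; rewrite ?n4' ?n5' ?oner_neq0 ?char0.
Qed.

End Tate.

(** * Identities between rational functions *)

Section Identities.
Variable K : fieldType.
Hypothesis char0 : forall n, n.+1%:R != 0 :> K.
Implicit Types (T P Q : K -> K -> K).

Definition s1_val (a b : K) := (2 * (b - a))^-1.
Definition s2_val (a b c : K) :=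
  (((b - a) * (c - a))^-1 + ((c - a) * (b - c))^-1) / 12.

(** The Ihara bracket of [s1] with an even function, the symmetric [T] standing
    for [(b - a)^(2n)]. *)
Definition xi2_val T a b c : K :=
  s1_val a b * T a c + s1_val b c * T a b + s1_val c b * T a c
  - (T a b * s1_val a c + T b c * s1_val a b - T c b * s1_val a c).

Definition xi3_val T a b c d : K :=
  (s2_val a b c * T a d + s2_val b c d * T a b + s2_val d c b * T a d
   - (T a b * s2_val a c d + T b c * s2_val a b d + T c d * s2_val a b c
      - (T c b * s2_val a c d + T d c * s2_val a b d)))
  + 2^-1 * (s1_val a b * xi2_val T a c d + s1_val b c * xi2_val T a b d + s1_val c d *
    xi2_val T a b c
    + (s1_val c b * xi2_val T a c d + s1_val d c * xi2_val T a b d)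
    - (xi2_val T a b c * s1_val a d + xi2_val T b c d * s1_val a b - xi2_val T d c b *
      s1_val a d)).

(** The right-hand side of [tate_der2] as a function of the values of [f]. *)
Definition tate_depth2 (L01 L12 L02 L012 y0 y1 y2 : K) :=
  (y0 - y2) * (N2 y0 y1 y2 * L02 + (y0 - y1) * (y1 - y2) * L012
    + ((y0 - y1) * L01 - (y1 - y2) * L12) / 2)
  + (y0 - y1) * (y1 - y2) / 2 * (L12 - L01).

(** The left-hand side is linear in the three values of [T], and the coefficient of
    each of them vanishes. *)
Lemma xi2_vanish T y0 y1 y2 : (forall a b, T a b = T b a) ->
  y0 - y1 != 0 -> y1 - y2 != 0 -> y0 - y2 != 0 ->
  tate_depth2 (T y0 y1) (T y1 y2) (T y0 y2) (xi2_val T y0 y1 y2) y0 y1 y2 = 0.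
Proof.
move=> sT n1 n2 n3; rewrite /tate_depth2 /xi2_val /s1_val /N2 (sT y2 y1).
move: (T y0 y1) (T y1 y2) (T y0 y2) => t01 t12 t02.
have n1' : y1 - y0 != 0 by rewrite -opprB oppr_eq0.
have n2' : y2 - y1 != 0 by rewrite -opprB oppr_eq0.
have n3' : y2 - y0 != 0 by rewrite -opprB oppr_eq0.
field.
by rewrite n1' n2' n3' ?n2 ?oner_neq0 !char0.
Qed.

(** The right-hand side of [tate_der3] as a function of the values of [f]. *)
Definition tate_depth3 (L01 L12 L23 L02 L13 L03 L012 L123 L013 L023 L0123 y0 y1 y2 y3 : K)
  : K :=
  let F012 : K := N2 y0 y1 y2 * L02 + (y0 - y1) * (y1 - y2) * L012 in
  let F123 : K := N2 y1 y2 y3 * L13 + (y1 - y2) * (y2 - y3) * L123 in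
  let F0123 : K := N3 y0 y1 y2 y3 * L03 + (y0 - y1) * N2 y1 y2 y3 * L013
    + N2 y0 y1 y2 * (y2 - y3) * L023 + (y0 - y1) * (y1 - y2) * (y2 - y3) * L0123 in
  let H012 : K := F012 + ((y0 - y1) * L01 - (y1 - y2) * L12) / 2 in
  let H123 : K := F123 + ((y1 - y2) * L12 - (y2 - y3) * L23) / 2 in
  let B012 : K := ((y1 - y2) ^+ 2 * L12 - (y0 - y1) ^+ 2 * L01) / (y0 - y2) in
  let B123 : K := ((y2 - y3) ^+ 2 * L23 - (y1 - y2) ^+ 2 * L12) / (y1 - y3) in
  (y0 - y3) * (F0123 - F123 / 2 + U2 y0 y1 y2 * (y2 - y3) * L23
     + H012 / 2 - U2 y1 y2 y3 * (y0 - y1) * L01)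
  + (y0 - y1) / 2 * H123 - (y2 - y3) / 2 * H012
  + (y0 - 2 * y1 + y2) / 12 * (y2 - y3) * L23
  - (y1 - 2 * y2 + y3) / 12 * (y0 - y1) * L01
  - ((y0 - y3) * (B123 - B012)
     - ((y2 - y3) ^+ 2 * L23 - 2 * (y1 - y2) ^+ 2 * L12 + (y0 - y1) ^+ 2 * L01)) / 12.

Section Four.
Variables (y0 y1 y2 y3 : K).
Hypotheses (n01 : y0 - y1 != 0) (n12 : y1 - y2 != 0) (n23 : y2 - y3 != 0).
Hypotheses (n02 : y0 - y2 != 0) (n13 : y1 - y3 != 0) (n03 : y0 - y3 != 0).

Let flip (a b : K) : a - b != 0 -> b - a != 0.
Proof. by move=> h; rewrite -opprB oppr_eq0. Qed.

Lemma xi3_vanish T : (forall a b, T a b = T b a) ->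
  tate_depth3 (T y0 y1) (T y1 y2) (T y2 y3) (T y0 y2) (T y1 y3) (T y0 y3)
    (xi2_val T y0 y1 y2) (xi2_val T y1 y2 y3) (xi2_val T y0 y1 y3) (xi2_val T y0 y2 y3)
    (xi3_val T y0 y1 y2 y3) y0 y1 y2 y3 = 0.
Proof.
move=> sT; rewrite /tate_depth3 /xi3_val /xi2_val /s1_val /s2_val /N3 /N2 /U2.
rewrite (sT y2 y1) (sT y3 y2) (sT y3 y1).
move: (T y0 y1) (T y1 y2) (T y2 y3) (T y0 y2) (T y1 y3) (T y0 y3) => t01 t12 t23 t02 t13 t03.
field.
by rewrite ?(flip n01) ?(flip n12) ?(flip n23) ?(flip n02) ?(flip n13) ?(flip n03) ?n01
  ?n12 ?n23 ?n02 ?n13 ?n03 ?oner_neq0 ?char0.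
Qed.

(** [x^(-2)], which stands for [epsilon_0]. *)
Definition xm2_val (a b : K) := ((b - a) ^+ 2)^-1.
(** The values of [{x^(2q), x^(-2)}] and of [{x^(2p), {x^(2q), x^(-2)}}]. *)
Definition inner_val Q a b c : K :=
  Q a b * xm2_val a c + Q b c * xm2_val a b - Q c b * xm2_val a c
  - (xm2_val a b * Q a c + xm2_val b c * Q a b - xm2_val c b * Q a c).
Definition corr_val P Q a b c d : K :=
  P a b * inner_val Q a c d + P b c * inner_val Q a b d + P c d * inner_val Q a b c
  - (P c b * inner_val Q a c d + P d c * inner_val Q a b d)
  - (inner_val Q a b c * P a d + inner_val Q b c d * P a b + inner_val Q d c b * P a d).

(** The right-hand sides of [ev_eps3] and [ev_eps4]. *)
Definition eps_act3 m (x : K -> K -> K) a b c : K :=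
  x a b * eps_h m b c - eps_h m a b * x b c + x a c * eps_g m a b c.
Definition eps_act4 m (x : K -> K -> K -> K) a b c d : K :=
  x a b c * eps_h m c d - eps_h m a b * x b c d + x a c d * eps_g m a b c + x a b d * eps_g
    m b c d.
Definition double_br_val p q : K -> K -> K -> K -> K := fun a b c d =>
  eps_act4 p (eps_b q) a b c d
  - eps_act4 p (eps_act3 0 (fun a b => (a - b) ^+ q)) a b c d
  - (eps_act4 q (eps_act3 0 (fun a b => (a - b) ^+ p)) a b c d
     - eps_act4 0 (eps_act3 q (fun a b => (a - b) ^+ p)) a b c d).

Lemma corr_tau p q :
  (y0 - y3) * ((y0 - y1) * (y1 - y2) * (y2 - y3)
    * corr_val (fun a b => (b - a) ^+ p.*2) (fun a b => (b - a) ^+ q.*2) y0 y1 y2 y3)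
  = double_br_val p.*2.+2 q.*2.+2 y0 y1 y2 y3.
Proof.
pose P a b : K := (b - a) ^+ p.*2; pose Q a b : K := (b - a) ^+ q.*2.
have sP a b : P a b = P b a by rewrite /P -opprB exprNn -signr_odd odd_double mul1r.
have sQ a b : Q a b = Q b a by rewrite /Q -opprB exprNn -signr_odd odd_double mul1r.
have eP a b : (a - b) ^+ p.*2.+2 = P a b * (a - b) ^+ 2 by rewrite sP /P -exprD addn2.
have eQ a b : (a - b) ^+ q.*2.+2 = Q a b * (a - b) ^+ 2 by rewrite sQ /Q -exprD addn2.
rewrite -/P -/Q /double_br_val /eps_act4 /eps_act3 /eps_g /eps_b /eps_h !eP !eQ !expr0
  /corr_val /inner_val /xm2_val.
rewrite (sP y2 y1) (sP y3 y2) ?(sP y3 y1).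
rewrite (sQ y2 y1) (sQ y3 y2) ?(sQ y3 y1).
move: (P y0 y1) (P y1 y2) (P y2 y3) (P y0 y2) (P y1 y3) (P y0 y3) => p01 p12 p23 p02 p13 p03.
move: (Q y0 y1) (Q y1 y2) (Q y2 y3) (Q y0 y2) (Q y1 y3) (Q y0 y3) => q01 q12 q23 q02 q13 q03.
field.
by rewrite ?(flip n01) ?(flip n12) ?(flip n23) ?(flip n02) ?(flip n13) ?(flip n03) ?n01
  ?n12 ?n23 ?n02 ?n13 ?n03 ?oner_neq0 ?char0.
Qed.
End Four.
End Identities.

(** * Renaming the variables of a rational function *)

Lemma rf_fracP r (f : ratfun r) : exists p q : {mpoly rat[r.+1]},
  q != 0 /\ f = p%:F / q%:F.
Proof.
exists (rf_num f), (rf_den f); split; first exact: rf_den_neq0.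
exact: frac_numden.
Qed.

Section Renaming.
Variables (r t : nat) (v : 'I_r.+1 -> 'I_t.+1).
Hypothesis iv : injective v.

Let nzr q : q != 0 -> (mp_ren v q)%:F != 0 :> ratfun t.
Proof.
move=> nq; rewrite tofrac_eq0; apply: contra nq => /eqP h.
by apply/eqP/(mp_ren_inj iv); rewrite h /mp_ren comp_mpoly0.
Qed.
Let nz (q : {mpoly rat[r.+1]}) : q != 0 -> q%:F != 0 :> ratfun r.
Proof. by rewrite tofrac_eq0. Qed.
Let renM p q : mp_ren v (p * q) = mp_ren v p * mp_ren v q.
Proof. exact: rmorphM. Qed.
Let renD p q : mp_ren v (p + q) = mp_ren v p + mp_ren v q.
Proof. exact: rmorphD. Qed.

Lemma rf_ren_poly p : rf_ren v p%:F = (mp_ren v p)%:F.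
Proof.
rewrite -[p%:F]divr1 -(rmorph1 (@FracField.tofrac _)) rf_renE ?oner_neq0 //.
by rewrite /mp_ren rmorph1 rmorph1 divr1.
Qed.
Lemma rf_renD f g : rf_ren v (f + g) = rf_ren v f + rf_ren v g.
Proof.
have [p [q [nq ->]]] := rf_fracP f; have [p' [q' [nq' ->]]] := rf_fracP g.
rewrite addf_div ?nz // -!tofracM -tofracD !rf_renE ?mulf_neq0 //.
by rewrite addf_div ?nzr // renD !renM !tofracD !tofracM.
Qed.
Lemma rf_renM f g : rf_ren v (f * g) = rf_ren v f * rf_ren v g.
Proof.
have [p [q [nq ->]]] := rf_fracP f; have [p' [q' [nq' ->]]] := rf_fracP g.
rewrite mulf_div -!tofracM !rf_renE ?mulf_neq0 //.
by rewrite mulf_div !renM !tofracM.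
Qed.
Lemma rf_ren1 : rf_ren v 1 = 1.
Proof. by rewrite -tofrac1 rf_ren_poly /mp_ren rmorph1. Qed.
Lemma rf_ren0 : rf_ren v 0 = 0.
Proof. by rewrite -tofrac0 rf_ren_poly /mp_ren rmorph0. Qed.

(** The proof of injectivity is an argument so that the ring morphism structure
    can be attached to a term. *)
Definition rf_ren_hom of injective v : ratfun r -> ratfun t := rf_ren v.
Fact rf_ren_hom_zmod : zmod_morphism (rf_ren_hom iv).
Proof.
by move=> f g; apply/eqP; rewrite eq_sym subr_eq /rf_ren_hom -rf_renD subrK.
Qed.
Fact rf_ren_hom_monoid : monoid_morphism (rf_ren_hom iv).
Proof. by split; [exact: rf_ren1|exact: rf_renM]. Qed.
HB.instance Definition _ := GRing.isZmodMorphism.Build _ _ (rf_ren_hom iv) rf_ren_hom_zmod.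
HB.instance Definition _ := GRing.isMonoidMorphism.Build _ _ (rf_ren_hom iv) rf_ren_hom_monoid.

Lemma rf_ren_morph : exists h : {rmorphism ratfun r -> ratfun t}, rf_ren v =1 h.
Proof. exists (rf_ren_hom iv). done. Qed.
End Renaming.

Lemma rf_ren_comp r t w (v : 'I_r.+1 -> 'I_t.+1) (v' : 'I_t.+1 -> 'I_w.+1) f :
  injective v -> injective v' -> rf_ren v' (rf_ren v f) = rf_ren (v' \o v) f.
Proof.
move=> iv iv'; have [p [q [nq ->]]] := rf_fracP f.
have e s : mp_ren v' (mp_ren v s) = mp_ren (v' \o v) s.
  rewrite /mp_ren [in RHS]comp_mpolyEX [X in X \mPo _]comp_mpolyEX raddf_sum /=.
  apply: eq_bigr => m _; rewrite comp_mpolyZ; congr (_ *: _).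
  rewrite !comp_mpolyX rmorph_prod; apply: eq_bigr => i _.
  by rewrite rmorphXn /= !tnth_mktuple comp_mpolyXU -tnth_nth tnth_mktuple.
have ic : injective (v' \o v) by exact: inj_comp.
have nq' : mp_ren v q != 0.
  apply: contra nq => /eqP h.
  by apply/eqP/(mp_ren_inj iv); rewrite h /mp_ren comp_mpoly0.
by rewrite (rf_renE p iv nq) (rf_renE _ iv' nq') (rf_renE p ic nq) !e.
Qed.

(** [0] is homogeneous of every degree, so that sums of homogeneous functions stay
    homogeneous; [rf_deg] is only meaningful away from [0]. *)
Definition is_hom r (d : int) (f : ratfun r) : Prop :=
  f = 0 \/ exists p q dp dq, [/\ q != 0, p \is dp.-homog, q \is dq.-homog,
    f = p%:F / q%:F & d = dp%:Z - dq%:Z].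

Lemma is_hom_deg r d (f : ratfun r) : is_hom d f -> f != 0 -> rf_deg f = d.
Proof.
case=> [->|[p [q [dp [dq [nq hp hq -> ->]]]]]]; first by rewrite eqxx.
rewrite mulf_eq0 negb_or tofrac_eq0 => /andP[np _].
rewrite rf_degE // (dhomog_uniq np hp (dhomog_msize hp)) (dhomog_uniq nq hq (dhomog_msize hq)).
have := msize_poly_eq0 p; have := msize_poly_eq0 q; rewrite (negbTE np) (negbTE nq).

by move: (msize p) (msize q) => [|a] [|b] //= _ _; lia.
Qed.

Lemma is_homM r d e (f g : ratfun r) : is_hom d f -> is_hom e g -> is_hom (d + e) (f * g).
Proof.
case=> [->|[p [q [dp [dq [nq hp hq -> ->]]]]]]; first by rewrite mul0r; left.
case=> [->|[p' [q' [dp' [dq' [nq' hp' hq' -> ->]]]]]]; first by rewrite mulr0; left.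
right; exists (p * p'), (q * q'), (dp + dp')%N, (dq + dq')%N.
rewrite !dhomogM ?mulf_neq0 ?mulf_div ?tofracM //; split=> //; lia.
Qed.
Lemma is_homD r d (f g : ratfun r) : is_hom d f -> is_hom d g -> is_hom d (f + g).
Proof.
case=> [->|[p [q [dp [dq [nq hp hq -> ->]]]]]]; first by rewrite add0r.
case=> [->|[p' [q' [dp' [dq' [nq' hp' hq' -> hd]]]]]].
  by rewrite addr0; right; exists p, q, dp, dq.
right; exists (p * q' + p' * q), (q * q'), (dp + dq')%N, (dq + dq')%N.
have e : (dp + dq' = dp' + dq)%N by lia.
split; rewrite ?mulf_neq0 ?dhomogM //; last by lia.
  by apply: dhomogD; [exact: dhomogM | rewrite e; exact: dhomogM].
by rewrite addf_div ?tofrac_eq0 // tofracD !tofracM.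
Qed.
Lemma is_homV r d (f : ratfun r) : is_hom d f -> is_hom (- d) f^-1.
Proof.
case=> [->|[p [q [dp [dq [nq hp hq -> ->]]]]]]; first by rewrite invr0; left.
have [->|np] := eqVneq p 0; first by rewrite tofrac0 mul0r invr0; left.
by right; exists q, p, dq, dp; rewrite invf_div opprB.
Qed.
Lemma is_hom_poly r d (p : {mpoly rat[r.+1]}) : p \is d.-homog -> is_hom d p%:F.
Proof.
move=> hp; right; exists p, 1, d, 0%N.
by rewrite oner_neq0 tofrac1 divr1 subr0; split=> //; exact: dhomog1.
Qed.
Lemma is_homC r q : is_hom 0 (rf_cst r q).
Proof.
apply: (@is_hom_poly r 0).
by rewrite -[q%:MP]mulr1 mul_mpolyC dhomogZ ?dhomog1.
Qed.
Lemma rf_cst_rmorph r : exists h : {rmorphism rat -> ratfun r}, rf_cst r =1 h.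
Proof. by exists (@FracField.tofrac _ \o @mpolyC r.+1 rat)%FUN. Qed.
Lemma rf_cst_nat r n : rf_cst r n%:R = n%:R.
Proof. by have [h e] := rf_cst_rmorph r; rewrite e rmorph_nat. Qed.
Lemma signz (R : unitRingType) (z : int) : (-1 : R) ^ z = (-1) ^+ `|z|%N.
Proof.
case: z => n; first by rewrite -exprnP absz_nat.
by rewrite NegzE -exprnN abszN absz_nat -exprVn invrN1.
Qed.
Lemma is_hom_sign r (z : int) : is_hom 0 ((-1) ^ z : ratfun r).
Proof.
have -> : (-1) ^ z = rf_cst r ((-1) ^+ `|z|%N).
  by have [h e] := rf_cst_rmorph r; rewrite e signz rmorphXn rmorphN1.
exact: is_homC.
Qed.
Lemma is_hom_xvar r j : is_hom 1 (xvar r j).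
Proof.
apply: (@is_hom_poly r 1); apply: rpredB; by rewrite dhomogX /= mdeg1.
Qed.
Lemma is_homX r d (f : ratfun r) n : is_hom d f -> is_hom (d *+ n) (f ^+ n).
Proof.
move=> h; elim: n => [|n IH].
  by rewrite expr0 -[1]/(1%:R) -rf_cst_nat; exact: is_homC.
by rewrite exprS mulrS; exact: is_homM.
Qed.
Lemma is_hom_sum r d (I : Type) (s : seq I) (P : pred I) (F : I -> ratfun r) :
  (forall i, P i -> is_hom d (F i)) -> is_hom d (\sum_(i <- s | P i) F i).
Proof. by move=> h; elim/big_rec: _ => [|i x /h]; [left|exact: is_homD]. Qed.
Lemma mp_ren_homog r t (v : 'I_r.+1 -> 'I_t.+1) d p :
  p \is d.-homog -> mp_ren v p \is d.-homog.
Proof.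
move=> hp; rewrite /mp_ren comp_mpolyEX big_seq; apply: rpred_sum => m hm.
rewrite dhomogZ // -(dhomog_mf hp hm) comp_mpolyX /= mdegE.
elim/big_rec2: _ => [|i p' n _ IH]; first exact: dhomog1.
apply: dhomogM => //; rewrite tnth_mktuple -[X in X.-homog]mul1n.
by apply: dhomogMn; rewrite dhomogX /= mdeg1.
Qed.
Lemma is_hom_ren r t (v : 'I_r.+1 -> 'I_t.+1) d f : injective v ->
  is_hom d f -> is_hom d (rf_ren v f).
Proof.
move=> iv [->|[p [q [dp [dq [nq hp hq -> ->]]]]]]; first by rewrite rf_ren0 //; left.
right; exists (mp_ren v p), (mp_ren v q), dp, dq; rewrite rf_renE // !mp_ren_homog //;
  split=> //.
apply: contra nq => /eqP h.
by apply/eqP/(mp_ren_inj iv); rewrite h /mp_ren comp_mpoly0.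
Qed.

(** * Values of the canonical rational functions *)

Lemma rf_at_morph r s : distinct_pts r s ->
  exists h : {rmorphism ratfun r -> ratfun 3}, forall f, rf_at f s = h f.
Proof.
move=> hs; have [h e] := rf_ren_morph (nth_inj hs).
by exists h => f; rewrite /rf_at e.
Qed.

Lemma inord_inj r t (phi : nat -> nat) :
  (forall k, (k <= r)%N -> (phi k <= t)%N) ->
  (forall x y, (x <= r)%N -> (y <= r)%N -> phi x = phi y -> x = y) ->
  injective (fun k : 'I_r.+1 => inord (phi k) : 'I_t.+1).
Proof.
move=> hle hin i j /(congr1 val) /=.
have li (k : 'I_r.+1) : (k <= r)%N by rewrite -ltnS.
by rewrite !inordK ?ltnS ?hle // => /hin e; apply/val_inj/e.
Qed.

Lemma rf_at_ren r t (phi : nat -> nat) (f : ratfun r) s :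
  distinct_pts t s -> (forall k, (k <= r)%N -> (phi k <= t)%N) ->
  (forall x y, (x <= r)%N -> (y <= r)%N -> phi x = phi y -> x = y) ->
  rf_at (rf_ren (fun k : 'I_r.+1 => inord (phi k) : 'I_t.+1) f) s =
  rf_at f (mkseq (fun k => nth 0%N s (phi k)) r.+1).
Proof.
move=> hs hle hin.
rewrite /rf_at rf_ren_comp; [|exact: inord_inj|exact: nth_inj hs].
congr rf_ren; apply/funext => k /=.
by rewrite inordK ?nth_mkseq // ltnS hle // -ltnS.
Qed.

Section Circ.
Variables (t r q : nat) (f : ratfun r) (g : ratfun q) (s : seq nat) (d : int).
Hypotheses (ht : t = (r + q)%N) (hs : distinct_pts t s) (hf : is_hom d f).

(** If [f = 0], the sign in [ih_circ] is that of a meaningless degree, but it is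
    multiplied by [0]. *)
Lemma rf_at_circ : rf_at (ih_circ t f g) s =
  \sum_(i < q.+1)
    rf_at f (mkseq (fun k => nth 0%N s (i + k)) r.+1) *
    rf_at g (mkseq (fun k => nth 0%N s (if (k <= i)%N then k else (k + r)%N)) q.+1)
  + (-1) ^+ `|(d + r%:Z)%R|%N *
    \sum_(i < q)
      rf_at f (mkseq (fun k => nth 0%N s (i.+1 + r - k)) r.+1) *
      rf_at g (mkseq (fun k => nth 0%N s (if (k < i.+1)%N then k else (k + r)%N)) q.+1).
Proof.
have [h e] := rf_at_morph hs.
rewrite [LHS]e /ih_circ rmorphD rmorphM !rmorph_sum; congr (_ + _).
  apply: eq_bigr => i _; rewrite rmorphM -!e; have hi := ltn_ord i.
  rewrite (@rf_at_ren _ t (fun k => (i + k)%N)) //; first last.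
  - by move=> x y _ _; lia.
  - by move=> k hk; lia.
  rewrite (@rf_at_ren _ t (fun k => if (k <= i)%N then k else (k + r)%N)) //.
  - by move=> k hk; case: ifP => _; lia.
  - by move=> x y _ _; case: ifP => h1; case: ifP => h2; lia.
rewrite big_mkcond big_ord_recl /= add0r.
have hz : h ((-1) ^ (rf_deg f + r%:Z)) = (-1) ^+ `|(rf_deg f + r%:Z)%R|%N.
  by rewrite signz rmorphXn rmorphN1.
have hF (i : 'I_q) :
   h (rf_ren (fun k : 'I_r.+1 => inord (bump 0 i + r - k)%N : 'I_t.+1) f *
      rf_ren (fun k : 'I_q.+1 => inord (if (k < bump 0 i)%N then k : nat else k + r)%N :
        'I_t.+1) g) =
   rf_at f (mkseq (fun k => nth 0%N s (i.+1 + r - k)) r.+1) *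
      rf_at g (mkseq (fun k => nth 0%N s (if (k < i.+1)%N then k else (k + r)%N)) q.+1).
  rewrite rmorphM -!e; have hi := ltn_ord i; rewrite /bump add1n.
  rewrite (@rf_at_ren _ t (fun k => (i.+1 + r - k)%N)) //; first last.
  - by move=> x y hx hy; lia.
  - by move=> k hk; lia.
  rewrite (@rf_at_ren _ t (fun k => if (k < i.+1)%N then k else (k + r)%N)) //.
  - by move=> k hk; case: ifP => _; lia.
  - by move=> x y hx hy; case: ifP => h1; case: ifP => h2; lia.
rewrite hz; have [f0|f0] := eqVneq f 0; last first.
  by rewrite (is_hom_deg hf f0); congr (_ * _); apply: eq_bigr => i _; exact: hF.
have r0 (v : 'I_r.+1 -> 'I_t.+1) : rf_ren v 0 = 0.
  have /eqP := frac_numden (0 : ratfun r); rewrite eq_sym mulf_eq0 invr_eq0.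
  rewrite !tofrac_eq0 (negbTE (rf_den_neq0 _)) orbF => /eqP h0.
  by rewrite /rf_ren /rf_num h0 /mp_ren comp_mpoly0 tofrac0 mul0r.
rewrite [X in _ * X = _]big1 ?[X in _ = _ * X]big1 ?mulr0 // => i _;
  first by rewrite -hF f0 r0 mul0r rmorph0.
by rewrite f0 r0 mul0r rmorph0.
Qed.
End Circ.

Lemma is_hom_circ t r q d e (f : ratfun r) (g : ratfun q) : t = (r + q)%N ->
  is_hom d f -> is_hom e g -> is_hom (d + e) (ih_circ t f g).
Proof.
move=> ht hf hg; apply: is_homD.
  apply: is_hom_sum => i _; have hi := ltn_ord i; apply: is_homM; apply: is_hom_ren => //.
    by apply: (@inord_inj r t (fun k => (i + k)%N)) => *; cbv beta in *; lia.
  apply: (@inord_inj q t (fun k => if (k <= i)%N then k else (k + r)%N)) => x /=.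
    by move=> hx; case: ifP => _; lia.
  by move=> y hx hy /=; case: ifP => h1; case: ifP => h2; lia.
rewrite -[d + e]add0r; apply: is_homM; first exact: is_hom_sign.
apply: is_hom_sum => i hi'; have hi := ltn_ord i; apply: is_homM; apply: is_hom_ren => //.
  by apply: (@inord_inj r t (fun k => (i + r - k)%N)) => *; cbv beta in *; lia.
apply: (@inord_inj q t (fun k => if (k < i)%N then k else (k + r)%N)) => x /=.
  by move=> hx; case: ifP => _; lia.
by move=> y hx hy /=; case: ifP => h1; case: ifP => h2; lia.
Qed.

Lemma is_homN r d (f : ratfun r) : is_hom d f -> is_hom d (- f).
Proof.
move=> hf; rewrite -mulN1r -[d]add0r; apply: is_homM => //.
have -> : -1 = rf_cst r (-1) by have [h e] := rf_cst_rmorph r; rewrite e rmorphN1.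
exact: is_homC.
Qed.

Lemma is_hom_br r q d e (f : ratfun r) (g : ratfun q) :
  is_hom d f -> is_hom e g -> is_hom (d + e) (ih_br f g).
Proof.
move=> hf hg; apply: is_homD; first exact: is_hom_circ.
by apply: is_homN; rewrite addrC; apply: is_hom_circ => //; rewrite addnC.
Qed.

Lemma rf_at_br r q d e (f : ratfun r) (g : ratfun q) s :
  is_hom d f -> is_hom e g -> distinct_pts (r + q) s ->
  rf_at (ih_br f g) s = rf_at (ih_circ (r + q) f g) s - rf_at (ih_circ (r + q) g f) s.
Proof. by move=> hf hg hs; have [h eh] := rf_at_morph hs; rewrite !eh -rmorphB. Qed.

Section Brackets.
Variables (d e : int) (i j k l : nat).
Local Notation sg z := ((-1) ^+ `|(z)%R|%N).

Lemma rf_at_br11 (f g : ratfun 1) : is_hom d f -> is_hom e g -> distinct_pts 2 [:: i; j; k] ->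
  rf_at (ih_br f g) [:: i; j; k] =
  rf_at f [:: i; j] * rf_at g [:: i; k] + rf_at f [:: j; k] * rf_at g [:: i; j]
  + sg (d + 1) * (rf_at f [:: k; j] * rf_at g [:: i; k])
  - (rf_at g [:: i; j] * rf_at f [:: i; k] + rf_at g [:: j; k] * rf_at f [:: i; j]
  + sg (e + 1) * (rf_at g [:: k; j] * rf_at f [:: i; k])).
Proof.
move=> hf hg hs; rewrite (rf_at_br hf hg hs).
rewrite (@rf_at_circ 2 1 1 f g _ d) // (@rf_at_circ 2 1 1 g f _ e) //.
move: (rf_at f) (rf_at g) (sg _) (sg _) => F G c1 c2.
by rewrite !big_ord_recl !big_ord0 /mkseq /= !addr0.
Qed.

Lemma rf_at_br12 (f : ratfun 1) (g : ratfun 2) :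
  is_hom d f -> is_hom e g -> distinct_pts 3 [:: i; j; k; l] ->
  rf_at (ih_br f g) [:: i; j; k; l] =
  rf_at f [:: i; j] * rf_at g [:: i; k; l] + rf_at f [:: j; k] * rf_at g [:: i; j; l]
  + rf_at f [:: k; l] * rf_at g [:: i; j; k]
  + sg (d + 1) * (rf_at f [:: k; j] * rf_at g [:: i; k; l] + rf_at f [:: l;
    k] * rf_at g [:: i; j; l])
  - (rf_at g [:: i; j; k] * rf_at f [:: i; l] + rf_at g [:: j; k; l] * rf_at f [:: i; j]
  + sg (e + 2) * (rf_at g [:: l; k; j] * rf_at f [:: i; l])).
Proof.
move=> hf hg hs; rewrite (rf_at_br hf hg hs).
rewrite (@rf_at_circ 3 1 2 f g _ d) // (@rf_at_circ 3 2 1 g f _ e) //.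
move: (rf_at f) (rf_at g) (sg _) (sg _) => F G c1 c2.
by rewrite !big_ord_recl !big_ord0 /mkseq /= !addr0 !addrA.
Qed.

Lemma rf_at_br21 (f : ratfun 2) (g : ratfun 1) :
  is_hom d f -> is_hom e g -> distinct_pts 3 [:: i; j; k; l] ->
  rf_at (ih_br f g) [:: i; j; k; l] =
  rf_at f [:: i; j; k] * rf_at g [:: i; l] + rf_at f [:: j; k; l] * rf_at g [:: i; j]
  + sg (d + 2) * (rf_at f [:: l; k; j] * rf_at g [:: i; l])
  - (rf_at g [:: i; j] * rf_at f [:: i; k; l] + rf_at g [:: j; k] * rf_at f [:: i; j; l]
  + rf_at g [:: k; l] * rf_at f [:: i; j; k]
  + sg (e + 1) * (rf_at g [:: k; j] * rf_at f [:: i; k; l] + rf_at g [:: l;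
    k] * rf_at f [:: i; j; l])).
Proof.
move=> hf hg hs; rewrite (rf_at_br hf hg hs).
rewrite (@rf_at_circ 3 2 1 f g _ d) // (@rf_at_circ 3 1 2 g f _ e) //.
move: (rf_at f) (rf_at g) (sg _) (sg _) => F G c1 c2.
by rewrite !big_ord_recl !big_ord0 /mkseq /= !addr0 !addrA.
Qed.
End Brackets.

Lemma rf_at_xvar r s j : distinct_pts r s -> (j <= r)%N ->
  rf_at (xvar r j) s = ycoord (nth 0%N s j) - ycoord (nth 0%N s 0).
Proof.
move=> hs hj; rewrite /rf_at /xvar rf_ren_poly; last exact: nth_inj.
rewrite /mp_ren comp_mpolyB !comp_mpolyXU -!tnth_nth !tnth_mktuple inordK //.
by rewrite tofracB.
Qed.

Lemma rf_at_cst r s q : distinct_pts r s -> rf_at (rf_cst r q) s = rat3 q.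
Proof.
move=> hs; rewrite /rf_at /rf_cst rf_ren_poly; last exact: nth_inj.
by rewrite /mp_ren comp_mpolyC.
Qed.

Lemma rf_at_xpow i j m : distinct_pts 1 [:: i; j] -> rf_at (xpow m) [:: i;
  j] = (ycoord j - ycoord i) ^+ m.
Proof.
move=> hs; have [h e] := rf_at_morph hs.
by rewrite e /xpow rmorphXn -e rf_at_xvar.
Qed.
Lemma rf_at_xpowV i j m : distinct_pts 1 [:: i; j] -> rf_at (xpow m)^-1 [:: i;
  j] = ((ycoord j - ycoord i) ^+ m)^-1.
Proof.
move=> hs; have [h e] := rf_at_morph hs.
by rewrite e fmorphV -e rf_at_xpow.
Qed.
Lemma rf_at_s1 i j : distinct_pts 1 [:: i; j] -> rf_at can_s1 [:: i;
  j] = s1_val (ycoord i) (ycoord j).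
Proof.
move=> hs; have [h e] := rf_at_morph hs.
by rewrite e /can_s1 fmorphV rmorphM rmorph_nat -e rf_at_xvar.
Qed.
Lemma rf_at_s2 i j k : distinct_pts 2 [:: i; j; k] -> rf_at can_s2 [:: i; j;
  k] = s2_val (ycoord i) (ycoord j) (ycoord k).
Proof.
move=> hs; have [h e] := rf_at_morph hs.
rewrite e /can_s2 rmorphM rmorphD !fmorphV !rmorphM rmorphB -!e rf_at_cst // !rf_at_xvar //=.
rewrite -[((1 / 12)%:MP)%:F]/(rat3 (1 / 12)) fmorph_div rmorph1 rmorph_nat mul1r mulrC.
by rewrite /s2_val opprB addrA subrK.
Qed.

Lemma hom_xpow m : is_hom m%:Z (xpow m).
Proof.
by rewrite -[m%:Z]natz; apply: (@is_homX 1 1); exact: is_hom_xvar.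
Qed.
Lemma hom_xpowV m : is_hom (- m%:Z) (xpow m)^-1.
Proof. exact/is_homV/hom_xpow. Qed.
Lemma hom_s1 : is_hom (-1) can_s1.
Proof.
apply: is_homV; rewrite -[1]add0r; apply: is_homM; last exact: is_hom_xvar.
by rewrite -(rf_cst_nat 1 2); exact: is_homC.
Qed.
Lemma hom_s2 : is_hom (-2) can_s2.
Proof.
rewrite -[-2]add0r; apply: is_homM; first exact: is_homC.
have h1 := is_hom_xvar 2 1; have h2 := is_hom_xvar 2 2.
by apply: is_homD; rewrite -[2]/(1 + 1 : int); apply: is_homV; apply: is_homM => //;
  apply: is_homD => //; exact: is_homN.
Qed.

(** * Double brackets of the derivations epsilon *)

Section DoubleBracket.
Variables (D1 D2 D3 : cder ablet) (m1 m2 m3 : nat).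
Hypotheses (h1 : is_eps_dual m1 D1) (h2 : is_eps_dual m2 D2) (h3 : is_eps_dual m3 D3).

Lemma double_brE x : [lie D1, [lie D2, D3]] x =
  D1 (D2 (D3 x)) - D1 (D3 (D2 x)) - (D2 (D3 (D1 x)) - D3 (D2 (D1 x))).
Proof. by rewrite !cderE_br cderD cderN. Qed.

Lemma double_br_supp (x : fliec ablet) w : ([lie D1, [lie D2, D3]] x : series ablet) w <> 0 ->
  exists v, [/\ (x : series ablet) v <> 0, count_mem Lb w = (count_mem Lb v + 3)%N
              & size w = (size v + (m1 + m2 + m3))%N].
Proof.
have comp (A B C : cder ablet) a b c : is_eps_dual a A -> is_eps_dual b B -> is_eps_dual c C ->
  (A (B (C x)) : series ablet) w <> 0 -> (a + b + c = m1 + m2 + m3)%N ->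
  exists v, [/\ (x : series ablet) v <> 0, count_mem Lb w = (count_mem Lb v + 3)%N
              & size w = (size v + (m1 + m2 + m3))%N].
  move=> hA hB hC /(eps_supp hA) [v1 [/(eps_supp hB) [v2 [/(eps_supp hC) [v3 [hv -> ->]] ->
    ->]] -> ->]] e.
  by exists v3; rewrite -e; split=> //; lia.
rewrite double_brE !fliec_valB !seriesB => h.
have [z1|/(comp _ _ _ _ _ _ h1 h2 h3)] := pselect ((D1 (D2 (D3 x)) : series ablet) w = 0);
  last by apply; lia.
have [z2|/(comp _ _ _ _ _ _ h1 h3 h2)] := pselect ((D1 (D3 (D2 x)) : series ablet) w = 0);
  last by apply; lia.
have [z3|/(comp _ _ _ _ _ _ h2 h3 h1)] := pselect ((D2 (D3 (D1 x)) : series ablet) w = 0);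
  last by apply; lia.
have [z4|/(comp _ _ _ _ _ _ h3 h2 h1)] := pselect ((D3 (D2 (D1 x)) : series ablet) w = 0);
  last by apply; lia.
by case: h; rewrite z1 z2 z3 z4 !subr0.
Qed.

Variables (K : fieldType) (k : {rmorphism rat -> K}).
Lemma double_br_eval y0 y1 y2 y3 : m3 = 0%N ->
  y0 - y1 != 0 -> y1 - y2 != 0 -> y2 - y3 != 0 ->
  y0 - y2 != 0 -> y1 - y3 != 0 -> y0 - y3 != 0 ->
  path_eval k La Lb (m1 + m2).+1 [:: y0; y1; y2; y3] ([lie D1, [lie D2, D3]] ga)
  = double_br_val m1 m2 y0 y1 y2 y3.
Proof.
move=> e3 n01 n12 n23 n02 n13 n03; move: h3; rewrite e3 => h0.
have [D3a _ _] := h0; rewrite double_brE !fliec_valB !evB D3a (_ : lie_ad 0 ga gb = gb) //.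
have e3' (D : cder ablet) m j z0 z1 z2 : is_eps_dual m D ->
  z0 - z1 != 0 -> z1 - z2 != 0 -> z0 - z2 != 0 ->
  path_eval k La Lb j.+1 [:: z0; z1; z2] (D3 (D ga)) =
    eps_act3 0 (fun a b => path_eval k La Lb j.+1 [:: a; b] (D ga)) z0 z1 z2.
  by move=> hD a b c; rewrite -[j.+1]addn0 (ev_eps3 k h0) // addn0.
have E1 : (m1 + m2).+1 = (m2.+1 + m1)%N by rewrite addnC addSn.
have E2 : (m1 + m2).+1 = (m1.+1 + m2)%N by rewrite addSn.
congr (_ - _ - (_ - _)).
- by rewrite E1 (ev_eps4 k h1) // !(ev_eps_b k h2).
- by rewrite E1 (ev_eps4 k h1) // !(e3' D2 m2) // /eps_act3 !(ev_eps_a k h2).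
- by rewrite E2 (ev_eps4 k h2) // !(e3' D1 m1) // /eps_act3 !(ev_eps_a k h1).
rewrite -[(m1 + m2).+1]addn0 (ev_eps4 k h0) // E2 !(ev_eps3 k h2) //.
by rewrite !(ev_eps_a k h1).
Qed.
End DoubleBracket.

Lemma lie_brZ3 (a b c : rat) (D1 D2 D3 : cder ablet) :
  [lie a *: D1, [lie b *: D2, c *: D3]] = (a * b * c) *: [lie D1, [lie D2, D3]].
Proof.
apply: cder_ext => x; rewrite cderE_scale !cderE_br !cderE_scale !cderD !cderN !cderZ.
rewrite !scalerBr !scalerA.
congr (_ - _ - (_ - _)); congr (_ *: _); ring.
Qed.

(** * The canonical elements *)

Section RationalValues.
Local Notation sg z := ((-1) ^+ `|(z)%R|%N : ratfun 3).

Lemma signz_even (z : int) m : z = m.*2%:Z -> sg z = 1.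
Proof. by move=> ->; rewrite absz_nat -signr_odd odd_double. Qed.
Lemma signz_odd (z : int) m : z = m.*2.+1%:Z -> sg z = -1.
Proof. by move=> ->; rewrite absz_nat -signr_odd /= odd_double. Qed.

Lemma distinct_pairs i j k : distinct_pts 2 [:: i; j; k] ->
  [/\ distinct_pts 1 [:: i; j], distinct_pts 1 [:: i; k], distinct_pts 1 [:: j;
    k] & distinct_pts 1 [:: k; j]].
Proof.
rewrite /distinct_pts /= !inE (eq_sym k j).
by move: (i == j) (i == k) (j == k) (i < 4)%N (j < 4)%N (k < 4)%N; do 6!case=> //=.
Qed.

Definition even_pow m (a b : ratfun 3) : ratfun 3 := (b - a) ^+ m.*2.

Lemma rf_at_xi2 n i j k : distinct_pts 2 [:: i; j; k] ->
  rf_at (xi2 n) [:: i; j; k] = xi2_val (even_pow n) (ycoord i) (ycoord j) (ycoord k).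
Proof.
move=> hs; have [p1 p2 p3 p4] := distinct_pairs hs.
rewrite /xi2 (rf_at_br11 hom_s1 (hom_xpow n.*2) hs).
rewrite (@signz_even _ 0) // (@signz_odd _ n); last by lia.
by rewrite !rf_at_s1 // !rf_at_xpow // mul1r mulN1r.
Qed.

(** The signs are those of the degrees [-2] of [s2], [2n] of [x^(2n)], [-1] of
    [s1] and [2n-1] of [xi2]. *)
Lemma rf_at_xi3 n : rf_at (xi3 n) [:: 0; 1; 2; 3]%N =
  xi3_val (even_pow n) (ycoord 0) (ycoord 1) (ycoord 2) (ycoord 3).
Proof.
have [h e] := @rf_at_morph 3 [:: 0; 1; 2; 3]%N isT.
rewrite e /xi3 rmorphD rmorphM -!e rf_at_cst //.
have h2 : is_hom (-1 + n.*2%:Z) (xi2 n) := is_hom_br hom_s1 (hom_xpow n.*2).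
rewrite (rf_at_br21 hom_s2 (hom_xpow n.*2)) // (rf_at_br12 hom_s1 h2) //.
rewrite (@signz_even _ 0) // (@signz_odd _ n); last by lia.
rewrite (@signz_odd _ n); last by lia.
rewrite !rf_at_xi2 // !rf_at_s1 // !rf_at_s2 // !rf_at_xpow // !mul1r !mulN1r.
rewrite fmorphV rmorph_nat -!/(even_pow _ _ _) /xi3_val.
by move: (even_pow n) s1_val s2_val (xi2_val _) => ? ? ? ?.
Qed.

Lemma rf_at_inner q i j k : distinct_pts 2 [:: i; j; k] ->
  rf_at (ih_br (xpow q.*2) (xpow 2)^-1) [:: i; j; k] =
    inner_val (even_pow q) (ycoord i) (ycoord j) (ycoord k).
Proof.
move=> hs; have [p1 p2 p3 p4] := distinct_pairs hs.
rewrite (rf_at_br11 (hom_xpow q.*2) (hom_xpowV 2) hs).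
rewrite (@signz_odd _ q); last by lia.
have -> : sg (- 2%:Z + 1) = -1 by [].
by rewrite !rf_at_xpow // !rf_at_xpowV // !mulN1r.
Qed.
End RationalValues.

Definition corr_coef (n p : nat) : rat :=
  bernoulli p.*2 * bernoulli (n - p).*2 / bernoulli n.*2
    * 'C(n.*2, p.*2)%:R / (24 * (n - p))%:R.

Lemma rf_at_corr n : rf_at (xi3_correction n) [:: 0; 1; 2; 3]%N =
  \sum_(1 <= p < n) rat3 (corr_coef n p) *
    corr_val (even_pow p) (even_pow (n - p)) (ycoord 0) (ycoord 1) (ycoord 2) (ycoord 3).
Proof.
have [h e] := @rf_at_morph 3 [:: 0; 1; 2; 3]%N isT.
rewrite e /xi3_correction rmorph_sum; apply: eq_bigr => p _ /=.
rewrite rmorphM -!e rf_at_cst //; congr (_ * _).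
have h2 : is_hom ((n - p).*2%:Z + - 2%:Z) (ih_br (xpow (n - p).*2) (xpow 2)^-1) :=
  is_hom_br (hom_xpow _) (hom_xpowV 2).
rewrite (rf_at_br12 (hom_xpow p.*2) h2) //.
rewrite (@signz_odd _ p); last by lia.
rewrite (@signz_even _ (n - p)); last by lia.
by rewrite !rf_at_inner // !rf_at_xpow // mul1r mulN1r.
Qed.

Lemma tate_depth3_add (K : fieldType) (L01 L12 L23 L02 L13 L03 L012 L123 L013 L023 L C y0
  y1 y2 y3 : K) :
  tate_depth3 L01 L12 L23 L02 L13 L03 L012 L123 L013 L023 (L + C) y0 y1 y2 y3 =
  tate_depth3 L01 L12 L23 L02 L13 L03 L012 L123 L013 L023 L y0 y1 y2 y3
  + (y0 - y3) * ((y0 - y1) * (y1 - y2) * (y2 - y3) * C).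
Proof. by rewrite /tate_depth3; move: (N3 _ _ _ _) (U2 _ _ _) (U2 _ _ _) => ? ? ?; ring. Qed.

(** The factor [B_(2n) / B_(2n)] cancels, and the binomial coefficient distributes
    the factorial of [2n]. *)
Lemma coef_match n p : (1 <= p < n)%N ->
  bernoulli n.*2 / (n.*2)`!%:R * corr_coef n p =
  1 / (n - p).*2%:R * (ueps_coef p.*2.+2 * ueps_coef (n - p).*2.+2 * ueps_coef 0).
Proof.
case/andP=> p0 pn; have b0 : bernoulli n.*2 != 0 by apply: bernoulli_neq0; lia.
rewrite /corr_coef /ueps_coef /= !subSS !subn0.
have hp : (p.*2 <= n.*2)%N by lia.
have e : (n.*2 - p.*2 = (n - p).*2)%N by lia.
have fz j : j`!%:R != 0 :> rat by rewrite Num.Theory.pnatr_eq0 -lt0n fact_gt0.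
have <- : 'C(n.*2, p.*2)%:R * (p.*2`!%:R * (n - p).*2`!%:R) = n.*2`!%:R :> rat.
  by rewrite -(bin_fact hp) e !natrM.
have cz : 'C(n.*2, p.*2)%:R != 0 :> rat by rewrite Num.Theory.pnatr_eq0 -lt0n bin_gt0.
rewrite -[(n - p).*2 in X in 1 / X]muln2 !natrM.
have qz : (n - p)%:R != 0 :> rat by rewrite Num.Theory.pnatr_eq0; lia.
move: qz cz b0 (fz p.*2) (fz (n - p).*2) => qz cz b0 f1 f2.
by field; rewrite qz cz b0 f1 f2.
Qed.

(** * The theorem *)

Section Main.
Variables (G : motivic_lie) (n : nat) (sigma : G).
Hypotheses (hn : (2 <= n)%N) (hsigma : is_canonical n sigma).

Let D := gm_i1 sigma.
Let f := gm_i sigma.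
Let M := n.*2.+1.

Let hdeg j (x : fliec ablet) : letter_homog La j x -> letter_homog La (j + M) (D x).
Proof. by case: hsigma => hd _ _ _; exact: gm_i1_deg hd j x. Qed.
Let hT : D Theta = 0. Proof. exact: gm_i1_Theta. Qed.
Let phi_x0 : phi gx0 = t01. Proof. exact: lie_hom_gen. Qed.
Let hphi : D t01 = [lie t01, phi (complete f)].
Proof.
rewrite -phi_x0 /D gm_i1_phi der0_gx0.
exact: (proj2 (lie_hom_morphism phi_gen)).
Qed.
Let hlen : len_homog M f.
Proof. by case: hsigma => hd _ _ _; exact: gm_i_deg hd. Qed.
Let M2 : (2 <= M)%N. Proof. by rewrite /M; lia. Qed.

Let nY i j : (i < j < 4)%N -> ycoord i - ycoord j != 0.
Proof. by move=> h; rewrite subr_eq0 ycoord_inj; lia. Qed.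

Let L1 i j : distinct_pts 1 [:: i; j] -> path_eval rat3 X0 X1 M [:: ycoord i;
  ycoord j] f = even_pow n (ycoord i) (ycoord j).
Proof.
move=> hs; have [_ h1 _ _] := hsigma.
by rewrite -[[:: _; _]]/[seq ycoord i | i <- [:: i;
  j]] (reduced_rf_at _ hlen h1 hs) // rf_at_xpow.
Qed.
Let L2 i j l : distinct_pts 2 [:: i; j; l] ->
  path_eval rat3 X0 X1 M [:: ycoord i; ycoord j; ycoord l] f =
    xi2_val (even_pow n) (ycoord i) (ycoord j) (ycoord l).
Proof.
move=> hs; have [_ _ h2 _] := hsigma.
by rewrite -[[:: _; _; _]]/[seq ycoord i | i <- [:: i; j;
  l]] (reduced_rf_at _ hlen h2 hs) // rf_at_xi2.
Qed.
Let L3 : path_eval rat3 X0 X1 M [:: ycoord 0; ycoord 1; ycoord 2;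
  ycoord 3] f = xi3_val (even_pow n) (ycoord 0) (ycoord 1) (ycoord 2) (ycoord 3)
  + \sum_(1 <= p < n) rat3 (corr_coef n p) *
    corr_val (even_pow p) (even_pow (n - p)) (ycoord 0) (ycoord 1) (ycoord 2) (ycoord 3).
Proof.
have [_ _ _ h3] := hsigma.
rewrite -[[:: _; _; _; _]]/[seq ycoord i | i <- [:: 0; 1; 2; 3]%N] (reduced_rf_at _ hlen h3) //.
have [h e] := @rf_at_morph 3 [:: 0; 1; 2; 3]%N isT.
by rewrite e rmorphD -!e rf_at_xi3 rf_at_corr.
Qed.

Let pw_sym m a b : even_pow m a b = even_pow m b a.
Proof. by rewrite /even_pow -opprB exprNn -signr_odd odd_double mul1r. Qed.

Lemma i1_depth1 : path_eval rat3 La Lb (M + 2) [:: ycoord 0;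
  ycoord 1] (D ga) = (ycoord 0 - ycoord 1) ^+ n.*2.+2.
Proof.
have := tate_der1 rat3 M2 hT hphi hdeg (ycoord 0) (ycoord 1).
rewrite /path_evald addSnnS L1 // => ->.
by rewrite pw_sym -exprD addnC addn2.
Qed.
Lemma i1_depth2 : path_eval rat3 La Lb (M + 3) [:: ycoord 0; ycoord 1; ycoord 2] (D ga) = 0.
Proof.
have := tate_der2 rat3 M2 hT hphi hdeg (nY (i := 0) (j := 1) isT) (nY (i := 1) (j :=
  2) isT) (nY (i := 0) (j := 2) isT).
rewrite /path_evald addSnnS /F2 !L1 // !L2 // => ->.
exact: (xi2_vanish (char0 rat3) (@pw_sym n) (nY (i := 0) (j := 1) isT) (nY (i := 1) (j :=
  2) isT) (nY (i := 0) (j := 2) isT)).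
Qed.
Lemma i1_depth3 : path_eval rat3 La Lb (M + 4) [:: ycoord 0; ycoord 1; ycoord 2;
  ycoord 3] (D ga) =
  \sum_(1 <= p < n) rat3 (corr_coef n p) *
     double_br_val p.*2.+2 (n - p).*2.+2 (ycoord 0) (ycoord 1) (ycoord 2) (ycoord 3).
Proof.
have n01 := nY (i := 0) (j := 1) isT; have n12 := nY (i := 1) (j := 2) isT.
have n23 := nY (i := 2) (j := 3) isT; have n02 := nY (i := 0) (j := 2) isT.
have n13 := nY (i := 1) (j := 3) isT; have n03 := nY (i := 0) (j := 3) isT.
have e : path_evald rat3 La Lb M.+1 [:: ycoord 0; ycoord 1; ycoord 2; ycoord 3] (D ga) =
  tate_depth3 (path_eval rat3 X0 X1 M [:: ycoord 0;
    ycoord 1] f) (path_eval rat3 X0 X1 M [:: ycoord 1; ycoord 2] f)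
   (path_eval rat3 X0 X1 M [:: ycoord 2; ycoord 3] f) (path_eval rat3 X0 X1 M [:: ycoord 0;
     ycoord 2] f)
   (path_eval rat3 X0 X1 M [:: ycoord 1; ycoord 3] f) (path_eval rat3 X0 X1 M [:: ycoord 0;
     ycoord 3] f)
   (path_eval rat3 X0 X1 M [:: ycoord 0; ycoord 1; ycoord 2] f) (path_eval rat3 X0 X1 M [::
     ycoord 1; ycoord 2; ycoord 3] f)
   (path_eval rat3 X0 X1 M [:: ycoord 0; ycoord 1; ycoord 3] f) (path_eval rat3 X0 X1 M [::
     ycoord 0; ycoord 2; ycoord 3] f)
   (path_eval rat3 X0 X1 M [:: ycoord 0; ycoord 1; ycoord 2;
     ycoord 3] f) (ycoord 0) (ycoord 1) (ycoord 2) (ycoord 3).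
  exact: (tate_der3 rat3 M2 hT hphi hdeg n01 n12 n23 n02 n13 n03).
move: e; rewrite /path_evald addSnnS !L1 // !L2 // L3 tate_depth3_add => ->.
rewrite (xi3_vanish (char0 rat3) n01 n12 n23 n02 n13 n03 (@pw_sym n)) add0r.
rewrite !mulr_sumr; apply: eq_bigr => p _.
have ct : (ycoord 0 - ycoord 3) * ((ycoord 0 - ycoord 1) * (ycoord 1 - ycoord 2) * (ycoord
  2 - ycoord 3)
    * corr_val (even_pow p) (even_pow (n - p)) (ycoord 0) (ycoord 1) (ycoord 2) (ycoord 3))
  = double_br_val p.*2.+2 (n - p).*2.+2 (ycoord 0) (ycoord 1) (ycoord 2) (ycoord 3).
  exact: (corr_tau n01 n12 n23 n02 n13 n03 p (n - p)%N).
rewrite -ct; move: (corr_val _ _ _ _ _ _) (ycoord 0 - ycoord 3) (_ * (ycoord 2 - ycoord 3))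
  (rat3 _) => c x y z.
by ring.
Qed.

Lemma i1_nob w : count_mem Lb w = 0%N -> (D ga : series ablet) w = 0.
Proof.
move=> h; apply: contrapT => /(der_a_supp M2 hdeg); by rewrite h.
Qed.
Lemma i1_counta w : count_mem La w <> M.+1 -> (D ga : series ablet) w = 0.
Proof. by apply: homog0; exact: (@hdeg 1 ga (@homog_gen _ La La)). Qed.
End Main.

Lemma count_ablet (w : seq ablet) : (count_mem La w + count_mem Lb w)%N = size w.
Proof. by elim: w => // -[] w /= <-; rewrite ?add0n ?addnS ?add1n ?addSn. Qed.

Lemma ga_supp v : (ga : series ablet) v <> 0 -> v = [:: La].
Proof. by rewrite /= /genS; case: eqP. Qed.

Theorem theorem1p2 (G : motivic_lie) (eps : nat -> cder ablet)
    (heps : forall m : nat, is_eps_dual m.*2 (eps m.*2))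
    (n : nat) (hn : (2 <= n)%N)
    (sigma : G) (hsigma : is_canonical n sigma) :
  let ueps (k : nat) : cder ablet := ueps_coef k *: eps k in
  let usigma : G := (bernoulli n.*2 / (n.*2)`!%:R) *: sigma in
  cder_ge (n.*2 + 5)
    (gm_i1 usigma
     - (ueps n.*2.+2
        + \sum_(1 <= p < n) let q := (n - p)%N in
            (1 / q.*2%:R) *:
              [lie ueps p.*2.+2, [lie ueps q.*2.+2, ueps 0%N]])).
Proof.
move=> ueps usigma; set D' := (X in cder_ge _ X).
pose c : rat := bernoulli n.*2 / (n.*2)`!%:R.
pose e p : cder ablet := eps p.*2.+2.
have he p : is_eps_dual p.*2.+2 (e p) := heps p.+1.
have he0 : is_eps_dual 0 (eps 0%N) := heps 0%N.
pose T p : cder ablet := [lie e p, [lie e (n - p)%N, eps 0%N]].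
pose t p : rat := c * corr_coef n p.
have D'E x : fliec_val (D' x) = c *: fliec_val (gm_i1 sigma x)
    - (c *: fliec_val (e n x) + \sum_(1 <= p < n) t p *: fliec_val (T p x)).
  have lin : gm_i1 usigma = c *: gm_i1 sigma.
    have [l _] := gm_i1_morphism G.
    have l0 : gm_i1 (0 : G) = 0.
      by apply: addrr_eq; have := l 1 0 0; rewrite !scale1r addr0.
    by have := l c sigma 0; rewrite !addr0 l0 addr0.
  have -> : D' = c *: gm_i1 sigma - (c *: e n + \sum_(1 <= p < n) t p *: T p).
    have e1 : ueps n.*2.+2 = c *: e n by rewrite /ueps /ueps_coef /= !subSS subn0.
    have e2 : \sum_(1 <= p < n) (1 / (n - p).*2%:R) *:
        [lie ueps p.*2.+2, [lie ueps (n - p).*2.+2, ueps 0%N]]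
        = \sum_(1 <= p < n) t p *: T p.
      rewrite !big_nat; apply: eq_bigr => p hp.
      by rewrite lie_brZ3 scalerA -(coef_match hp).
    by rewrite /D' lin e1 e2.
  have sumE (F : nat -> cder ablet) : fliec_val ((\sum_(1 <= p < n) F p) x)
      = \sum_(1 <= p < n) fliec_val (F p x).
    by elim/big_rec2: _ => // i u v _ <-.
  rewrite [fliec_val _]/= -/(fliec_val ((\sum_(1 <= p < n) t p *: T p) x)) sumE.
  by [].
have T_supp p x w : (1 <= p < n)%N -> (T p x : series ablet) w <> 0 ->
    exists v, [/\ (x : series ablet) v <> 0, count_mem Lb w = (count_mem Lb v + 3)%N
      & size w = (size v + n.*2.+4)%N].
  move=> hp /(double_br_supp (he p) (he (n - p)%N) he0) [v [h1 h2 h3]]; exists v; split=> //.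
  by rewrite h3; lia.
have T_ev0 p N ys : (1 <= p < n)%N -> size ys != 4%N -> path_eval rat3 La Lb N ys (T p ga) = 0.
  move=> hp hs; apply: ev_supp => // w h1 _ _; apply: contrapT.
  case/(T_supp _ _ _ hp) => v [/ga_supp -> h2 _]; move: h1 hs; rewrite h2 /=.
  by case: ys => [|? [|? [|? [|? []]]]].
have nY i j : (i < j < 4)%N -> ycoord i - ycoord j != 0 by move=> h;
  rewrite subr_eq0 ycoord_inj; lia.
have evD' N ys : path_eval rat3 La Lb N ys (D' ga) =
  rat3 c * path_eval rat3 La Lb N ys (gm_i1 sigma ga)
   - (rat3 c * path_eval rat3 La Lb N ys (e n ga) + \sum_(1 <= p < n) rat3 (t p) *
     path_eval rat3 La Lb N ys (T p ga)).
  rewrite D'E evB evD !evZ ev_sum; congr (_ - (_ + _)); apply: eq_bigr => p _.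
  by rewrite evZ.
have en_a : e n ga = lie_ad n.*2.+2 ga gb by case: (he n).
have en_ev0 N ys : size ys != 2%N -> path_eval rat3 La Lb N ys (e n ga) = 0.
  move=> hs; apply: ev_supp => // w h1 _ _; apply: contrapT; rewrite en_a.
  case/ad_supp => h2 _; move: h1 hs; rewrite h2.
  by case: ys => [|? [|? []]].
(* A word of length at most 2n+5 in the difference at [a] has 2n+2 letters [a],
   hence at most three letters [b]; each number of letters [b] is a depth. *)
have oa : ord_ge (n.*2.+1 + 5) (D' ga).
  move=> w hw.
  have hc := count_ablet w.
  have z0 : (gm_i1 sigma ga : series ablet) w = 0 ->
     (e n ga : series ablet) w = 0 -> (forall p, (1 <= p < n)%N ->
       (T p ga : series ablet) w = 0) ->
     (D' ga : series ablet) w = 0.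
    move=> z1 z2 z3; rewrite D'E !seriesE z1 z2 big_nat big1 ?mulr0 ?addr0 ?oppr0 //.
    by move=> p hp; rewrite seriesZ z3 ?mulr0.
  have [hs|hs] := eqVneq (count_mem La w) n.*2.+2; last first.
    apply: z0.
    - by apply: (i1_counta hsigma) => h; move: hs; rewrite h eqxx.
    - apply: contrapT; rewrite en_a => /ad_supp [h1 h2].
      by move: hs; rewrite -(eqn_add2r (count_mem Lb w)) hc h1 h2 addn1 eqxx.
    move=> p hp; apply: contrapT => /(T_supp _ _ _ hp) [v [/ga_supp -> h1 h2]].
    by move: hs; rewrite -(eqn_add2r (count_mem Lb w)) hc h1 h2 /= !addn3 add1n eqxx.
  have hN : size w = (n.*2.+1 + (count_mem Lb w).+1)%N by rewrite -hc hs addSnnS.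
  case hb: (count_mem Lb w) hN => [|[|[|[|r]]]] hN.
  - apply: z0.
    + exact: (i1_nob hn hsigma).
    + by apply: contrapT; rewrite en_a => /ad_supp []; rewrite hb.
    by move=> p hp; apply: contrapT => /(T_supp _ _ _ hp) [v [/ga_supp -> ]]; rewrite hb.
  - apply: (path_eval_eq0 (s := [:: 0; 1]%N) cover_ab Lab _ hN); rewrite ?hb //.
    rewrite evD' (i1_depth1 hn hsigma) en_a addn2 ev_ad.
    rewrite big_nat big1 => [|p hp]; last by rewrite T_ev0 ?mulr0.
    by rewrite addr0; exact: subrr.
  - apply: (path_eval_eq0 (s := [:: 0; 1; 2]%N) cover_ab Lab _ hN); rewrite ?hb //.
    rewrite evD' (i1_depth2 hn hsigma) en_ev0 //.
    rewrite big_nat big1 => [|p hp]; last by rewrite T_ev0 ?mulr0.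
    by rewrite !mulr0 !addr0; exact: subrr.
  - apply: (path_eval_eq0 (s := [:: 0; 1; 2; 3]%N) cover_ab Lab _ hN); rewrite ?hb //.
    rewrite evD' (i1_depth3 hn hsigma) en_ev0 // mulr0 add0r mulr_sumr -sumrB.
    rewrite big_nat big1 // => p hp.
    have eN : (n.*2.+1 + 4)%N = (p.*2.+2 + (n - p).*2.+2).+1 by lia.
    rewrite eN (double_br_eval (he p) (he (n - p)%N) he0) ?nY //.
    have -> : rat3 (t p) = rat3 c * rat3 (corr_coef n p) by exact: rmorphM.
    by rewrite mulrA; exact: subrr.
  by move: hw; rewrite hN; lia.
have oT : D' Theta = 0.
  have z k (D : cder ablet) : is_eps_dual k D -> D Theta = 0 by case.
  apply: fliec_inj; rewrite D'E gm_i1_Theta (z _ _ (he n)) big1 => [|p _].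
    by rewrite addr0; exact: subrr.
  rewrite /T double_brE !(z _ _ (he p)) !(z _ _ (he (n - p)%N)) !(z _ _ he0) !cder0.
  by rewrite subrr; exact: scaler0.
have hcom : com (genS La) (D' gb) = com (genS Lb) (D' ga).
  move: oT; rewrite /Theta cder_br => /(congr1 (@fliec_val _)) /=.
  by rewrite /com => /eqP; rewrite addrC addr_eq0 opprB => /eqP.
have b1 : (D' gb : series ablet) [:: La] = 0.
  rewrite D'E !seriesE; have [_ _ z2] := he n; rewrite z2.
  have [hd _ _ _] := hsigma.
  rewrite (homog0 (@gm_i1_deg G _ _ hd 0 gb (@homog_gen _ La Lb))); last by rewrite /=; lia.
  rewrite big_nat big1 ?mulr0 ?addr0 ?subrr // => p hp; rewrite seriesZ.
  have [->|/(T_supp _ _ _ hp) [v [_ h _]]] := pselect ((T p gb : series ablet) [:: La] = 0).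
    by rewrite mulr0.
  by move: h; rewrite addn3.
(* The value at [b] is controlled by its commutator with [a]. *)
apply: (@cder_ge_gen _ (n.*2 + 5) D'); case; first by rewrite -addSn; exact: oa.
rewrite -addSn => w hw; apply: contrapT => hne.
have /leq_ltn_trans/(_ hw) : (n.*2.+1 + 5 <= size w)%N; last by rewrite ltnn.
rewrite -ltnS -[X in (X < _)%N]add0n.
apply: (@com_a_supp _ (fun _ j => (0 + (n.*2.+1 + 5) < j)%N) (fliecP (D' gb)) b1 _ w hne).
move=> w' hw'; rewrite add0n ltnNge; apply/negP => h; apply: hw'; rewrite hcom.
by apply: (ord_ge_com (@ord_ge_gen _ Lb) oa); rewrite add1n ltnS.
Qed.
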